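(* Let $(W,S)$ be a Coxeter system with geometric representation $\mathfrak{h}^*$, let $R=\operatorname{Sym}(\mathfrak{h}^* )$, and let $H=n\mathcal{H}$ be the associated nil Hecke algebra. Then the following hold. (1) The two expressions $\partial_s\otimes s+1\otimes\partial_s$ and $\partial_s\otimes 1+s\otimes\partial_s$ agree in $H\otimes H$ (tensor product over $R$ of left $R$-modules), and the assignments $$\Delta(\lambda)=\lambda\cdot 1\otimes 1,\qquad \Delta(\partial_s)=\partial_s\otimes s+1\otimes\partial_s=\partial_s\otimes 1+s\otimes\partial_s\qquad(\lambda\in\mathfrak{h}^*,\ s\in S)$$ extend to a $k$-algebra morphism $\Delta\colon H\to H\times_R H$ into the Takeuchi product. (2) Together with the map $\varepsilon\colon H\to R$, $\varepsilon(h)=\rho_{n\mathcal{H}}(h)(1)$, this turns $H$ into a cocommutative Hopf algebroid over $R$. (3) The map $\operatorname{red}_H\colon H\to H\times_R H^{\mathrm{op}}$ is given on generators by $$\operatorname{red}_H(\lambda)=\lambda 1\boxtimes 1,\qquad \operatorname{red}_H(\partial_s)=\partial_s\boxtimes s+1\boxtimes\partial_s=\partial_s\boxtimes 1-s\boxtimes\partial_s .$$ (4) The subalgebra $R\star W\subseteq H$ is a Hopf subalgebroid of $H$.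
   Context: Ground field $k=\mathbb{R}$. All algebras are associative and unital, and algebra morphisms are unital. **Coxeter system and geometric representation.** $(W,S)$ is a Coxeter system: $W=\langle s\in S\mid s^2=1,\ (st)^{m_{st}}=1 \text{ for } s\neq t\rangle$, where $m_{st}=m_{ts}=\operatorname{ord}(st)\ge 2$ may be infinite (then no relation is imposed). Let $\mathfrak{h}^*=\bigoplus_{s\in S}\mathbb{R}\alpha_s$ with symmetric bilinear form $(\alpha_s,\alpha_t)=-\cos(\pi/m_{st})$, where $m_{ss}=1$ and $\pi/\infty=0$. For $\lambda\in\mathfrak{h}^*$ put $\langle\lambda,\alpha_s^\vee\rangle=\frac{2(\lambda,\alpha_s)}{(\alpha_s,\alpha_s)}$. The formula $s(\lambda)=\lambda-\langle\lambda,\alpha_s^\vee\rangle\alpha_s$ defines a faithful representation of $W$ on $\mathfrak{h}^*$ (the geometric representation), hence an action of $W$ on $R=\operatorname{Sym}(\mathfrak{h}^* )$ by algebra automorphisms. $R^W$ is the algebra of invariants. **Nil Hecke algebra.** $n\mathcal{H}$ is the $k$-algebra generated by the vector space $\mathfrak{h}^*$ and elements $\partial_s$ ($s\in S$) subject to: $\lambda\mu=\mu\lambda$ for $\lambda,\mu\in\mathfrak{h}^*$; $\partial_s\lambda=s(\lambda)\partial_s+\langle\lambda,\alpha_s^\vee\rangle$; $\partial_s^2=0$; and $\partial_s\partial_t\partial_s\cdots=\partial_t\partial_s\partial_t\cdots$ ($m_{st}$ factors on each side) for $s\ne t$ with $m_{st}<\infty$. It is known that $R$ embeds in $n\mathcal{H}$,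 that $n\mathcal{H}$ is a free left $R$-module with basis $\{\partial_w\mid w\in W\}$ (where $\partial_w=\partial_{s_1}\cdots\partial_{s_r}$ for any reduced expression $w=s_1\cdots s_r$), and that $s\mapsto 1-\alpha_s\partial_s$ defines an $R$-linear algebra embedding $R\star W\hookrightarrow n\mathcal{H}$. Via this embedding we write $s=1-\alpha_s\partial_s\in n\mathcal{H}$. The representation $\rho_{n\mathcal{H}}\colon n\mathcal{H}\to\operatorname{End}_{R^W}(R)$ is given by letting $\lambda$ act by multiplication and $\partial_s$ act by $f\mapsto\frac{f-s(f)}{\alpha_s}$. **Twisted group algebra.** $R\star W=R\otimes_k kW$ with product $(rg)(r'g')=r\,g(r')\,gg'$. It is a Hopf algebroid over $R$ with $\Delta(g)=g\otimes g$, $\varepsilon(rg)=r$, $\operatorname{red}(rg)=rg\boxtimes g^{-1}$ ($r\in R$, $g\in W$). ''Hopf subalgebroid'' means that it is a subalgebra containing $R$ to which the structure of $n\mathcal{H}$ restricts to a Hopf algebroid structure (namely this one). **Bialgebroids.** Let $R$ be a commutative $k$-algebra and $R\subseteq H$ a $k$-algebra. $H\otimes H$ denotes the tensor product over $R$ of two copies of $H$ regarded as left $R$-modules (so $rh\otimes h'=h\otimes rh'$). $H\boxtimes H$ denotes the balanced tensor product (so $hr\boxtimes h'=h\boxtimes rh'$). $H^{\mathrm{op}}$ is $H$ with the same $R$-bimodule structure and the opposite product, and $H\boxtimes H^{\mathrm{op}}$ is $H\boxtimes H$ as a vector space. Below, products such as $h_i'r$ are taken in $H$. The Takeuchi products are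 $$H\times_R H=\Big\{\sum_i h_i\otimes h_i'\in H\otimes H\ \Big|\ \forall r\in R:\ \sum_i h_ir\otimes h_i'=\sum_i h_i\otimes h_i'r\Big\},$$ $$H\times_R H^{\mathrm{op}}=\Big\{\sum_i h_i\boxtimes h_i'\in H\boxtimes H^{\mathrm{op}}\ \Big|\ \forall r\in R:\ \sum_i rh_i\boxtimes h_i'=\sum_i h_i\boxtimes h_i'r\Big\}.$$ They are $k$-algebras under componentwise multiplication (in the second case using the opposite product in the second factor). $H$ is a (left) bialgebroid over $R$ if it is equipped with left $R$-linear maps $\Delta\colon H\to H\otimes H$ and $\varepsilon\colon H\to R$ such that: (i) $(H,\Delta,\varepsilon)$ is a coassociative counital coalgebra in left $R$-modules; (ii) $\Delta$ takes values in $H\times_R H$ and is a $k$-algebra morphism $H\to H\times_R H$; (iii) $\rho_\varepsilon\colon H\to\operatorname{End}_k(R)$, $h\mapsto(r\mapsto\varepsilon(hr))$, is a representation of $H$ on $R$ whose restriction to $R$ is the regular representation. It is cocommutative if $\Delta$ is invariant under the flip of $H\otimes H$. It is a Hopf algebroid if the Galois map $$\operatorname{Gal}_H\colon H\boxtimes H\to H\otimes H,\qquad h\boxtimes h'\mapsto \sum h_{(1)}\otimes h_{(2)}h',\qquad \Delta(h)=\sum h_{(1)}\otimes h_{(2)},$$ is bijective. In that case $\operatorname{red}_H(h)=\operatorname{Gal}_H^{-1}(h\otimes 1)$, and this defines an algebra morphism $H\to H\times_R H^{\mathrm{op}}$. *)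

(* Defs.v *)
From HB Require Import structures.
From mathcomp Require Import all_boot all_order all_algebra finmap.
From mathcomp Require Import boolp reals trigo.
From mathcomp.multinomials Require Import monalg.
From mathcomp Require Import ring.

Set Implicit Arguments.
Unset Strict Implicit.
Unset Printing Implicit Defensive.

Import Order.TTheory GRing.Theory Num.Theory.
Local Open Scope ring_scope.
Local Open Scope quotient_scope.

(* A k-algebra is a ring A with a unital ring morphism [kin] from k to the     *)
(* centre of A, the scalar action being c . x = kin c * x.  MathComp's         *)
(* [algType] is not used because it demands 1 != 0, which is not known         *)
(* beforehand of an algebra given by generators and relations.                *)
HB.mixin Record isKAlgebra (k : pzRingType) A of GRing.PzRing A := {
  kin : k -> A;
  kin_zmod : zmod_morphism kin;
  kin_monoid : GRing.monoid_morphism kin;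
  kinC : forall c x, kin c * x = x * kin c
}.
#[short(type="kalgType")]
HB.structure Definition KAlgebra (k : pzRingType) :=
  {A of GRing.PzRing A & isKAlgebra k A}.
Arguments kin {k s}.

HB.instance Definition _ (k : pzRingType) (A : kalgType k) :=
  GRing.isZmodMorphism.Build k A kin kin_zmod.
HB.instance Definition _ (k : pzRingType) (A : kalgType k) :=
  GRing.isMonoidMorphism.Build k A kin kin_monoid.

Section Converse.
Variables (k : comPzRingType) (A : kalgType k).
Let kinc (c : k) : A^c := kin c.
Lemma kinc_zmod : zmod_morphism kinc. Proof. exact: kin_zmod. Qed.
Lemma kinc_monoid : GRing.monoid_morphism kinc.
Proof.
split=> [|c d]; first exact: (rmorph1 (kin : k -> A)).
by rewrite mulrC; exact: (rmorphM (kin : k -> A)).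
Qed.
Lemma kincC c (x : A^c) : kinc c * x = x * kinc c.
Proof. exact: (esym (kinC c (x : A))). Qed.
HB.instance Definition _ := isKAlgebra.Build k A^c kinc_zmod kinc_monoid kincC.
End Converse.

Definition kalg_morphism (k : pzRingType) (A B : kalgType k) (f : A -> B) : Prop :=
  [/\ zmod_morphism f, GRing.monoid_morphism f & forall c, f (kin c) = kin c].

(* [rho] as a morphism of k-algebras from A to End_k(V).                      *)
Definition is_representation (k : pzRingType) (A : kalgType k) (V : lmodType k)
    (rho : A -> V -> V) : Prop :=
  [/\ forall a, linear (rho a),
      forall a b v, rho (a + b) v = rho a v + rho b v,
      forall v, rho 1 v = v,
      forall a b v, rho (a * b) v = rho a (rho b v) &
      forall c v, rho (kin c) v = c *: v].

Section PresentedAlgebra.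
Variables (k : comPzRingType) (X : Type).

Inductive term : Type :=
| Const of k
| Var of X
| Add of term & term
| Mul of term & term.

Variable rel : term -> term -> Prop.

(* The congruence generated by the axioms of k-algebras and by [rel].         *)
Inductive term_eq : term -> term -> Prop :=
| TRefl t : term_eq t t
| TSym t u : term_eq t u -> term_eq u t
| TTrans t u v : term_eq t u -> term_eq u v -> term_eq t v
| TAdd t t' u u' : term_eq t t' -> term_eq u u' -> term_eq (Add t u) (Add t' u')
| TMul t t' u u' : term_eq t t' -> term_eq u u' -> term_eq (Mul t u) (Mul t' u')
| TAddA t u v : term_eq (Add t (Add u v)) (Add (Add t u) v)
| TAddC t u : term_eq (Add t u) (Add u t)
| TAdd0 t : term_eq (Add (Const 0) t) t
| TMulA t u v : term_eq (Mul t (Mul u v)) (Mul (Mul t u) v)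
| TMul1 t : term_eq (Mul (Const 1) t) t
| TMulDl t u v : term_eq (Mul (Add t u) v) (Add (Mul t v) (Mul u v))
| TMulDr t u v : term_eq (Mul t (Add u v)) (Add (Mul t u) (Mul t v))
| TMul0 t : term_eq (Mul (Const 0) t) (Const 0)
| TConstD c d : term_eq (Const (c + d)) (Add (Const c) (Const d))
| TConstM c d : term_eq (Const (c * d)) (Mul (Const c) (Const d))
| TConstC c t : term_eq (Mul (Const c) t) (Mul t (Const c))
| TRel t u : rel t u -> term_eq t u.

HB.instance Definition _ := gen_eqMixin term.
HB.instance Definition _ := gen_choiceMixin term.

Definition term_eqb (t u : term) := `[< term_eq t u >].

Lemma term_eqb_equiv : equiv_class_of term_eqb.
Proof.
split.
- by move=> t; apply/asboolP; exact: TRefl.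
- by move=> t u; apply/asboolP/asboolP; exact: TSym.
- move=> u t v /asboolP tu /asboolP uv; apply/asboolP; exact: TTrans tu uv.
Qed.
Canonical term_equiv := EquivRelPack term_eqb_equiv.

Definition presented := {eq_quot term_eqb}.
HB.instance Definition _ := Choice.on presented.

Definition pclass (t : term) : presented := \pi_({eq_quot term_eqb}) t.
Definition prepr (x : presented) : term := repr (x : {eq_quot term_eqb}).
Definition pgen (x : X) : presented := pclass (Var x).
Definition pconst (c : k) : presented := pclass (Const c).
Definition padd (x y : presented) := pclass (Add (prepr x) (prepr y)).
Definition pmul (x y : presented) := pclass (Mul (prepr x) (prepr y)).

Lemma pclassP t u : (pclass t = pclass u) <-> term_eq t u.
Proof.
by split=> [/eqP|tu]; [rewrite eqmodE => /asboolP
                     | apply/eqP; rewrite eqmodE; apply/asboolP].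
Qed.
Lemma preprK x : pclass (prepr x) = x. Proof. exact: reprK. Qed.
Lemma term_eq_repr t : term_eq (prepr (pclass t)) t.
Proof. by apply/pclassP; rewrite preprK. Qed.

Lemma paddE t u : padd (pclass t) (pclass u) = pclass (Add t u).
Proof. by apply/pclassP; apply: TAdd; exact: term_eq_repr. Qed.
Lemma pmulE t u : pmul (pclass t) (pclass u) = pclass (Mul t u).
Proof. by apply/pclassP; apply: TMul; exact: term_eq_repr. Qed.

Lemma pclass_ind (P : presented -> Prop) :
  (forall t, P (pclass t)) -> forall x, P x.
Proof. by move=> h x; rewrite -[x]preprK. Qed.

Let E := (paddE, pmulE).

Lemma paddA : associative padd.
Proof.
elim/pclass_ind=> t; elim/pclass_ind=> u; elim/pclass_ind=> v.
by rewrite !E; apply/pclassP; exact: TAddA.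
Qed.
Lemma paddC : commutative padd.
Proof.
elim/pclass_ind=> t; elim/pclass_ind=> u.
by rewrite !E; apply/pclassP; exact: TAddC.
Qed.
Lemma padd0 : left_id (pconst 0) padd.
Proof. by elim/pclass_ind=> t; rewrite !E; apply/pclassP; exact: TAdd0. Qed.
Lemma paddN : left_inverse (pconst 0) (pmul (pconst (-1))) padd.
Proof.
elim/pclass_ind=> t; rewrite pmulE paddE; apply/pclassP.
apply: TTrans (TAdd (TRefl _) (TSym (TMul1 t))) _.
apply: TTrans (TSym (TMulDl _ _ _)) _; apply: TTrans _ (TMul0 t).
by apply: TMul (TRefl t); rewrite -(addNr 1); apply/TSym/TConstD.
Qed.
HB.instance Definition _ := GRing.isZmodule.Build presented paddA paddC padd0 paddN.

Lemma pmulA : associative pmul.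
Proof.
elim/pclass_ind=> t; elim/pclass_ind=> u; elim/pclass_ind=> v.
by rewrite !E; apply/pclassP; exact: TMulA.
Qed.
Lemma pmul1 : left_id (pconst 1) pmul.
Proof. by elim/pclass_ind=> t; rewrite !E; apply/pclassP; exact: TMul1. Qed.
Lemma pmulr1 : right_id (pconst 1) pmul.
Proof.
elim/pclass_ind=> t; rewrite !E; apply/pclassP.
exact: TTrans (TSym (TConstC _ _)) (TMul1 _).
Qed.
Lemma pmulDl : left_distributive pmul padd.
Proof.
elim/pclass_ind=> t; elim/pclass_ind=> u; elim/pclass_ind=> v.
by rewrite !E; apply/pclassP; exact: TMulDl.
Qed.
Lemma pmulDr : right_distributive pmul padd.
Proof.
elim/pclass_ind=> t; elim/pclass_ind=> u; elim/pclass_ind=> v.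
by rewrite !E; apply/pclassP; exact: TMulDr.
Qed.
HB.instance Definition _ :=
  GRing.Zmodule_isPzRing.Build presented pmulA pmul1 pmulr1 pmulDl pmulDr.

Lemma pclassD t u : pclass (Add t u) = pclass t + pclass u.
Proof. by rewrite -paddE. Qed.
Lemma pclassM t u : pclass (Mul t u) = pclass t * pclass u.
Proof. by rewrite -pmulE. Qed.

Lemma pconstD c d : pconst (c + d) = pconst c + pconst d.
Proof. by rewrite -pclassD; apply/pclassP; exact: TConstD. Qed.
Lemma pconst_zmod : zmod_morphism pconst.
Proof.
move=> c d; apply/eqP; rewrite eq_sym subr_eq -pconstD.
by rewrite -addrA addNr addr0.
Qed.
Lemma pconst_monoid : GRing.monoid_morphism pconst.
Proof.
by split=> // c d; rewrite -pclassM; apply/pclassP; exact: TConstM.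
Qed.
Lemma pconstC c x : pconst c * x = x * pconst c.
Proof.
elim/pclass_ind: x => t; rewrite -!pclassM; apply/pclassP; exact: TConstC.
Qed.
HB.instance Definition _ :=
  isKAlgebra.Build k presented pconst_zmod pconst_monoid pconstC.

Section Eval.
Variables (A : kalgType k) (f : X -> A).

Fixpoint teval (t : term) : A :=
  match t with
  | Const c => kin c
  | Var x => f x
  | Add t u => teval t + teval u
  | Mul t u => teval t * teval u
  end.

Hypothesis f_rel : forall t u, rel t u -> teval t = teval u.

Lemma teval_eq t u : term_eq t u -> teval t = teval u.
Proof.
elim=> //=.
- by move=> ? ? ? _ -> _ ->.
- by move=> ? ? ? ? _ -> _ ->.
- by move=> ? ? ? ? _ -> _ ->.
- by move=> *; rewrite addrA.
- by move=> *; rewrite addrC.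
- by move=> *; rewrite raddf0 add0r.
- by move=> *; rewrite mulrA.
- by move=> *; rewrite rmorph1 mul1r.
- by move=> *; rewrite mulrDl.
- by move=> *; rewrite mulrDr.
- by move=> *; rewrite raddf0 mul0r.
- by move=> *; rewrite raddfD.
- by move=> *; rewrite rmorphM.
- by move=> *; rewrite kinC.
Qed.

Definition presented_lift (x : presented) : A := teval (prepr x).

Lemma presented_liftE t : presented_lift (pclass t) = teval t.
Proof. exact/teval_eq/term_eq_repr. Qed.

Lemma presented_lift_gen x : presented_lift (pgen x) = f x.
Proof. exact: presented_liftE. Qed.

Lemma presented_lift_morphism : kalg_morphism presented_lift.
Proof.
split=> [x y||c]; last exact: presented_liftE.
- apply/eqP; rewrite eq_sym subr_eq; apply/eqP.
  rewrite -{1}(subrK y x); move: (x - y); elim/pclass_ind=> u.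
  by elim/pclass_ind: y => t; rewrite -pclassD !presented_liftE.
- split=> [|x y]; first by rewrite presented_liftE /= rmorph1.
  elim/pclass_ind: x => t; elim/pclass_ind: y => u.
  by rewrite -pclassM !presented_liftE.
Qed.
End Eval.
End PresentedAlgebra.

(* The abelian group M (x) N modulo aM r m (x) n = m (x) aN r n (r : I),       *)
(* where each r acts on M through aM and on N through aN.                     *)
Section Tensor.
Variables (I : Type) (M N : zmodType) (aM : I -> M -> M) (aN : I -> N -> N).

Definition tneg (u : seq (M * N)) : seq (M * N) := [seq (- p.1, p.2) | p <- u].

(* Two lists [:: (m_1, n_1); ...; (m_l, n_l)] are related when the sums of    *)
(* the m_i (x) n_i are equal.                                                 *)
Inductive tens_eq : seq (M * N) -> seq (M * N) -> Prop :=
| TensRefl u : tens_eq u u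
| TensSym u v : tens_eq u v -> tens_eq v u
| TensTrans u v w : tens_eq u v -> tens_eq v w -> tens_eq u w
| TensCat u u' v v' : tens_eq u u' -> tens_eq v v' -> tens_eq (u ++ v) (u' ++ v')
| TensNeg u v : tens_eq u v -> tens_eq (tneg u) (tneg v)
| TensCatC u v : tens_eq (u ++ v) (v ++ u)
| Tens0l n : tens_eq [:: (0, n)] [::]
| TensDl m m' n : tens_eq [:: (m + m', n)] [:: (m, n); (m', n)]
| TensDr m n n' : tens_eq [:: (m, n + n')] [:: (m, n); (m, n')]
| TensBal r m n : tens_eq [:: (aM r m, n)] [:: (m, aN r n)].

Definition tens_eqb (u v : seq (M * N)) := `[< tens_eq u v >].

Lemma tens_eqb_equiv : equiv_class_of tens_eqb.
Proof.
split.
- by move=> t; apply/asboolP; exact: TensRefl.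
- by move=> t u; apply/asboolP/asboolP; exact: TensSym.
- move=> u t v /asboolP tu /asboolP uv; apply/asboolP; exact: TensTrans tu uv.
Qed.
Canonical tens_equiv := EquivRelPack tens_eqb_equiv.

Definition tens := {eq_quot tens_eqb}.
HB.instance Definition _ := Choice.on tens.

Definition tclass (u : seq (M * N)) : tens := \pi_({eq_quot tens_eqb}) u.
Definition trepr (x : tens) : seq (M * N) := repr (x : {eq_quot tens_eqb}).
Definition tpure (m : M) (n : N) : tens := tclass [:: (m, n)].
Definition tadd (x y : tens) := tclass (trepr x ++ trepr y).
Definition topp (x : tens) := tclass (tneg (trepr x)).

Lemma tclassP u v : (tclass u = tclass v) <-> tens_eq u v.
Proof.
by split=> [/eqP|uv]; [rewrite eqmodE => /asboolP
                     | apply/eqP; rewrite eqmodE; apply/asboolP].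
Qed.
Lemma treprK x : tclass (trepr x) = x. Proof. exact: reprK. Qed.
Lemma tens_eq_repr u : tens_eq (trepr (tclass u)) u.
Proof. by apply/tclassP; rewrite treprK. Qed.
Lemma tclass_ind (P : tens -> Prop) : (forall u, P (tclass u)) -> forall x, P x.
Proof. by move=> h x; rewrite -[x]treprK. Qed.

Lemma taddE u v : tadd (tclass u) (tclass v) = tclass (u ++ v).
Proof. by apply/tclassP; apply: TensCat; exact: tens_eq_repr. Qed.
Lemma toppE u : topp (tclass u) = tclass (tneg u).
Proof. by apply/tclassP; apply: TensNeg; exact: tens_eq_repr. Qed.

Lemma taddA : associative tadd.
Proof.
elim/tclass_ind=> t; elim/tclass_ind=> u; elim/tclass_ind=> v.
by rewrite !taddE catA.
Qed.
Lemma taddC : commutative tadd.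
Proof.
elim/tclass_ind=> t; elim/tclass_ind=> u.
by rewrite !taddE; apply/tclassP; exact: TensCatC.
Qed.
Lemma tadd0 : left_id (tclass [::]) tadd.
Proof. by elim/tclass_ind=> t; rewrite !taddE. Qed.
Lemma taddN : left_inverse (tclass [::]) topp tadd.
Proof.
elim/tclass_ind=> u; rewrite toppE taddE; apply/tclassP.
elim: u => [|[m n] u IH] /=; first exact: TensRefl.
have h : tens_eq [:: (- m, n); (m, n)] [::].
  apply: TensTrans (TensSym (TensDl _ _ _)) _; rewrite addNr; exact: Tens0l.
rewrite -[_ :: _]/([:: (- m, n)] ++ (tneg u ++ ([:: (m, n)] ++ u))).
rewrite (catA (tneg u)); apply: TensTrans (TensCat (TensRefl _)
  (TensCat (TensCatC (tneg u) _) (TensRefl u))) _.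
rewrite -(catA [:: (m, n)]) catA; apply: TensTrans (TensCat (TensRefl _) IH) _.
by rewrite cats0.
Qed.
HB.instance Definition _ := GRing.isZmodule.Build tens taddA taddC tadd0 taddN.

Lemma tclassD u v : tclass (u ++ v) = tclass u + tclass v.
Proof. by rewrite -taddE. Qed.

Lemma tclassE u : tclass u = \sum_(p <- u) tpure p.1 p.2.
Proof.
elim: u => [|[m n] u IH]; first by rewrite big_nil.
by rewrite -cat1s tclassD IH big_cons.
Qed.

Lemma tpureDl m m' n : tpure (m + m') n = tpure m n + tpure m' n.
Proof. by rewrite -tclassD; apply/tclassP; exact: TensDl. Qed.
Lemma tpureDr m n n' : tpure m (n + n') = tpure m n + tpure m n'.
Proof. by rewrite -tclassD; apply/tclassP; exact: TensDr. Qed.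
Lemma tpureA r m n : tpure (aM r m) n = tpure m (aN r n).
Proof. by apply/tclassP; exact: TensBal. Qed.

Definition balanced (Z : zmodType) (f : M -> N -> Z) : Prop :=
  [/\ forall m m' n, f (m + m') n = f m n + f m' n,
      forall m n n', f m (n + n') = f m n + f m n' &
      forall r m n, f (aM r m) n = f m (aN r n)].

Lemma tpure_balanced : balanced tpure.
Proof. by split; [exact: tpureDl|exact: tpureDr|exact: tpureA]. Qed.

(* The map m (x) n |-> f m n; meaningful when f is balanced.                  *)
Definition tlift (Z : zmodType) (f : M -> N -> Z) (x : tens) : Z :=
  \sum_(p <- trepr x) f p.1 p.2.

Section Lift.
Variables (Z : zmodType) (f : M -> N -> Z).
Hypothesis f_bal : balanced f.

Lemma balanced0l n : f 0 n = 0.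
Proof. by case: f_bal => h _ _; apply: (addrI (f 0 n)); rewrite -h !addr0. Qed.
Lemma balancedNl m n : f (- m) n = - f m n.
Proof.
case: f_bal => h _ _.
by apply/eqP; rewrite -addr_eq0 -h addNr balanced0l.
Qed.

Lemma tlift_eq u v : tens_eq u v ->
  \sum_(p <- u) f p.1 p.2 = \sum_(p <- v) f p.1 p.2.
Proof.
case: (f_bal) => fDl fDr fA; elim=> //= {u v}.
- by move=> u v w _ -> _ ->.
- by move=> u u' v v' _ e _ e'; rewrite !big_cat /= e e'.
- move=> u v _ e; rewrite !big_map /=.
  under eq_bigr do rewrite balancedNl.
  by under [RHS]eq_bigr do rewrite balancedNl; rewrite !sumrN e.
- by move=> u v; rewrite !big_cat /= addrC.
- by move=> n; rewrite big_seq1 big_nil balanced0l.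
- by move=> m m' n; rewrite big_seq1 big_cons big_seq1 fDl.
- by move=> m n n'; rewrite big_seq1 big_cons big_seq1 fDr.
- by move=> r m n; rewrite !big_seq1 fA.
Qed.

Lemma tliftE u : tlift f (tclass u) = \sum_(p <- u) f p.1 p.2.
Proof. exact/tlift_eq/tens_eq_repr. Qed.
Lemma tlift_pure m n : tlift f (tpure m n) = f m n.
Proof. by rewrite tliftE big_seq1. Qed.
Lemma tliftD x y : tlift f (x + y) = tlift f x + tlift f y.
Proof.
elim/tclass_ind: x => u; elim/tclass_ind: y => v.
by rewrite -tclassD !tliftE big_cat.
Qed.
End Lift.
End Tensor.

Definition tmap (I J : Type) (M N M' N' : zmodType)
    (aM : I -> M -> M) (aN : I -> N -> N) (aM' : J -> M' -> M') (aN' : J -> N' -> N')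
    (f : M -> M') (g : N -> N') : tens aM aN -> tens aM' aN' :=
  tlift (fun m n => tpure aM' aN' (f m) (g n)).

Definition tflip (I : Type) (M N : zmodType) (aM : I -> M -> M) (aN : I -> N -> N) :
    tens aM aN -> tens aN aM :=
  tlift (fun m n => tpure aN aM n m).

(* A (x) B over R with R acting on A and B by left multiplication along a and  *)
(* b, its Takeuchi subgroup                                                   *)
(*   { sum x_i (x) y_i | for all r, sum x_i r (x) y_i = sum x_i (x) y_i r },   *)
(* and the componentwise product of the latter.                               *)
Section Takeuchi.
Variables (k : comPzRingType) (R : comAlgType k) (A B : kalgType k).
Variables (a : R -> A) (b : R -> B).

Definition lmult (C : pzRingType) (c : R -> C) (r : R) (x : C) : C := c r * x.

Definition ltens := tens (lmult a) (lmult b).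
HB.instance Definition _ := GRing.Zmodule.on ltens.
Definition lpure (x : A) (y : B) : ltens := tpure (lmult a) (lmult b) x y.

(* x (x) y |-> x g (x) y h *)
Definition rmult (g : A) (h : B) : ltens -> ltens :=
  tlift (fun x y => lpure (x * g) (y * h)).

Definition takeuchi_cond (x : ltens) : Prop :=
  forall r, rmult (a r) 1 x = rmult 1 (b r) x.

Lemma lpure_mult_balanced g h : balanced (lmult a) (lmult b)
  (fun x y => lpure (x * g) (y * h)).
Proof.
split=> [x x' y|x y y'|r x y].
- by rewrite mulrDl; exact: tpureDl.
- by rewrite mulrDl; exact: tpureDr.
- by rewrite /lmult -!mulrA; exact: tpureA.
Qed.

Let lc (u : seq (A * B)) : ltens := tclass (lmult a) (lmult b) u.

Lemma lc_ind (P : ltens -> Prop) : (forall u, P (lc u)) -> forall x, P x.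
Proof. exact: tclass_ind. Qed.

Lemma lcD u v : lc (u ++ v) = lc u + lc v. Proof. exact: tclassD. Qed.

Lemma lcE u : lc u = \sum_(p <- u) lpure p.1 p.2. Proof. exact: tclassE. Qed.

Lemma rmultE g h u :
  rmult g h (lc u) = \sum_(p <- u) lpure (p.1 * g) (p.2 * h).
Proof. by rewrite /rmult tliftE //; exact: lpure_mult_balanced. Qed.

Lemma rmult_lc g h u : rmult g h (lc u) = lc [seq (p.1 * g, p.2 * h) | p <- u].
Proof. by rewrite rmultE lcE big_map. Qed.

Lemma rmult_pure g h x y : rmult g h (lpure x y) = lpure (x * g) (y * h).
Proof. by rewrite [LHS](rmultE g h [:: (x, y)]) big_seq1. Qed.

Lemma rmultD g h : {morph rmult g h : x y / x + y}.
Proof. by move=> x y; rewrite /rmult tliftD //; exact: lpure_mult_balanced. Qed.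

Lemma rmult0 g h : rmult g h 0 = 0.
Proof. by apply: (addrI (rmult g h 0)); rewrite -rmultD !addr0. Qed.

Lemma rmultN g h : {morph rmult g h : x / - x}.
Proof. by move=> x; apply/eqP; rewrite -addr_eq0 -rmultD addNr rmult0. Qed.

Lemma rmult_comp g h g' h' x :
  rmult g' h' (rmult g h x) = rmult (g * g') (h * h') x.
Proof.
elim/lc_ind: x => u; rewrite rmult_lc !rmultE big_map /=.
by apply: eq_bigr => p _; rewrite -!mulrA.
Qed.

Lemma rmult_id x : rmult 1 1 x = x.
Proof.
elim/lc_ind: x => u; rewrite rmultE lcE.
by apply: eq_bigr => p _; rewrite !mulr1.
Qed.

Lemma rmult_suml g h (J : Type) (s : seq J) (F : J -> ltens) :
  rmult g h (\sum_(i <- s) F i) = \sum_(i <- s) rmult g h (F i).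
Proof. by apply: (big_morph (rmult g h)); [exact: rmultD | exact: rmult0]. Qed.

(* (sum x_i (x) y_i) * (sum g_j (x) h_j) = sum x_i g_j (x) y_i h_j            *)
Definition tmul (x y : ltens) : ltens := tlift (fun g h => rmult g h x) y.

Lemma tmul_balanced x : takeuchi_cond x ->
  balanced (lmult a) (lmult b) (fun g h => rmult g h x).
Proof.
move=> xT; split.
- move=> g g' h; elim/lc_ind: x xT => u _; rewrite !rmultE -big_split /=.
  by apply: eq_bigr => p _; rewrite mulrDr; exact: tpureDl.
- move=> g h h'; elim/lc_ind: x xT => u _; rewrite !rmultE -big_split /=.
  by apply: eq_bigr => p _; rewrite mulrDr; exact: tpureDr.
- move=> r g h; have := congr1 (rmult g h) (xT r).
  by rewrite !rmult_comp !mul1r.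
Qed.

Lemma tmulE x v : takeuchi_cond x ->
  tmul x (lc v) = \sum_(p <- v) rmult p.1 p.2 x.
Proof. by move=> xT; rewrite /tmul tliftE //; exact: tmul_balanced. Qed.

Lemma tmul_pure x g h : takeuchi_cond x -> tmul x (lpure g h) = rmult g h x.
Proof. by move=> xT; rewrite [LHS](tmulE [:: (g, h)] xT) big_seq1. Qed.

Lemma tmul_rmult x y g h : takeuchi_cond x ->
  tmul x (rmult g h y) = rmult g h (tmul x y).
Proof.
move=> xT; elim/lc_ind: y => v; rewrite rmult_lc !tmulE // big_map rmult_suml.
by apply: eq_bigr => p _; rewrite rmult_comp.
Qed.

Lemma tcond0 : takeuchi_cond 0.
Proof. by move=> r; rewrite !rmult0. Qed.
Lemma tcondD x y : takeuchi_cond x -> takeuchi_cond y -> takeuchi_cond (x + y).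
Proof. by move=> xT yT r; rewrite !rmultD xT yT. Qed.
Lemma tcondN x : takeuchi_cond x -> takeuchi_cond (- x).
Proof. by move=> xT r; rewrite !rmultN xT. Qed.
Lemma tcondM x y : takeuchi_cond x -> takeuchi_cond y -> takeuchi_cond (tmul x y).
Proof. by move=> xT yT r; rewrite -!tmul_rmult // yT. Qed.
Lemma tcond1 : takeuchi_cond (lpure 1 1).
Proof.
move=> r; rewrite !rmult_pure !mul1r.
by rewrite -[a r]mulr1 -[b r in RHS]mulr1; exact: tpureA.
Qed.

Lemma tmulDr x y z : takeuchi_cond x -> tmul x (y + z) = tmul x y + tmul x z.
Proof. by move=> xT; rewrite /tmul tliftD //; exact: tmul_balanced. Qed.
Lemma tmulDl x y z : tmul (x + y) z = tmul x z + tmul y z.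
Proof.
rewrite /tmul /tlift -big_split /=.
by apply: eq_bigr => p _; rewrite rmultD.
Qed.
Lemma tmul0 x : takeuchi_cond x -> tmul x 0 = 0.
Proof. by move=> xT; rewrite [LHS](tmulE [::] xT) big_nil. Qed.
Lemma tmulA x y z : takeuchi_cond x -> takeuchi_cond y ->
  tmul x (tmul y z) = tmul (tmul x y) z.
Proof.
move=> xT yT; elim/lc_ind: z => w; rewrite !tmulE //; last exact: tcondM.
elim: w => [|p w IH]; first by rewrite !big_nil tmul0.
by rewrite !big_cons tmulDr // IH tmul_rmult.
Qed.
Lemma tmul1x x : tmul (lpure 1 1) x = x.
Proof.
elim/lc_ind: x => v; rewrite tmulE; last exact: tcond1.
by rewrite lcE; apply: eq_bigr => p _; rewrite rmult_pure !mul1r.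
Qed.
Lemma tmulx1 x : takeuchi_cond x -> tmul x (lpure 1 1) = x.
Proof. by move=> xT; rewrite tmul_pure // rmult_id. Qed.

Record takeuchi := Takeuchi {
  takeuchi_val :> ltens;
  takeuchi_bool : `[< takeuchi_cond takeuchi_val >]
}.
HB.instance Definition _ := [isSub for takeuchi_val].
HB.instance Definition _ := [Choice of takeuchi by <:].

Lemma takeuchiP (x : takeuchi) : takeuchi_cond x.
Proof. by case: x => x /= /asboolP. Qed.
Definition mk_takeuchi x (xT : takeuchi_cond x) : takeuchi :=
  Takeuchi (introT (asboolP _) xT).

Definition tk0 := mk_takeuchi tcond0.
Definition tk1 := mk_takeuchi tcond1.
Definition tk_add (x y : takeuchi) := mk_takeuchi (tcondD (takeuchiP x) (takeuchiP y)).
Definition tk_opp (x : takeuchi) := mk_takeuchi (tcondN (takeuchiP x)).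
Definition tk_mul (x y : takeuchi) := mk_takeuchi (tcondM (takeuchiP x) (takeuchiP y)).

Lemma tk_addA : associative tk_add. Proof. by move=> *; apply/val_inj/addrA. Qed.
Lemma tk_addC : commutative tk_add. Proof. by move=> *; apply/val_inj/addrC. Qed.
Lemma tk_add0 : left_id tk0 tk_add. Proof. by move=> *; apply/val_inj/add0r. Qed.
Lemma tk_addN : left_inverse tk0 tk_opp tk_add.
Proof. by move=> *; apply/val_inj/addNr. Qed.
HB.instance Definition _ := GRing.isZmodule.Build takeuchi tk_addA tk_addC tk_add0 tk_addN.

Lemma tk_mulA : associative tk_mul.
Proof. by move=> x y z; apply/val_inj/tmulA; exact: takeuchiP. Qed.
Lemma tk_mul1 : left_id tk1 tk_mul.
Proof. by move=> x; apply/val_inj/tmul1x. Qed.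
Lemma tk_mulr1 : right_id tk1 tk_mul.
Proof. by move=> x; apply/val_inj/tmulx1/takeuchiP. Qed.
Lemma tk_mulDl : left_distributive tk_mul tk_add.
Proof. by move=> *; apply/val_inj/tmulDl. Qed.
Lemma tk_mulDr : right_distributive tk_mul tk_add.
Proof. by move=> *; apply/val_inj/tmulDr/takeuchiP. Qed.
HB.instance Definition _ :=
  GRing.Zmodule_isPzRing.Build takeuchi tk_mulA tk_mul1 tk_mulr1 tk_mulDl tk_mulDr.

Lemma tcond_kin c : takeuchi_cond (lpure (kin c) 1).
Proof.
move=> r; rewrite !rmult_pure kinC !mulr1 mul1r.
by rewrite -[b r]mulr1; exact: tpureA.
Qed.
Definition tk_kin c := mk_takeuchi (tcond_kin c).
Lemma tk_kin_zmod : zmod_morphism tk_kin.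
Proof.
move=> c d; apply/eqP; rewrite eq_sym subr_eq; apply/eqP/val_inj => /=.
by rewrite -[LHS]/(lpure _ _) -[RHS]tpureDl -raddfD subrK.
Qed.
Lemma tk_kin_monoid : GRing.monoid_morphism tk_kin.
Proof.
split=> [|c d]; apply/val_inj => /=; first by rewrite rmorph1.
rewrite -[RHS]/(tmul _ _) tmul_pure ?rmult_pure ?rmorphM ?mulr1 //.
exact: tcond_kin.
Qed.
Lemma tk_kinC c x : tk_kin c * x = x * tk_kin c.
Proof.
apply/val_inj; rewrite -[LHS]/(tmul _ _) -[RHS]/(tmul _ _).
rewrite (tmul_pure _ _ (takeuchiP x)) /=; elim/lc_ind: {x}(takeuchi_val x) => u.
rewrite tmulE ?rmultE; last exact: tcond_kin.
by apply: eq_bigr => p _; rewrite rmult_pure kinC mul1r mulr1.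
Qed.
HB.instance Definition _ :=
  isKAlgebra.Build k takeuchi tk_kin_zmod tk_kin_monoid tk_kinC.
End Takeuchi.

Section Bialgebroid.
Variables (k : comPzRingType) (R : comAlgType k) (H : kalgType k) (eta : R -> H).

(* H is a k-algebra containing R, by means of eta.                            *)
Definition is_subalgebra_map : Prop :=
  [/\ zmod_morphism eta, GRing.monoid_morphism eta, forall c, eta c%:A = kin c &
      injective eta].

(* H (x) H: (r h) (x) h' = h (x) (r h')                                       *)
Definition tens_lr := ltens eta eta.
HB.instance Definition _ := GRing.Zmodule.on tens_lr.
Definition lrpure (h h' : H) : tens_lr := lpure eta eta h h'.

(* H [x] H: left multiplication by r in the converse algebra H^c is h |-> h r, *)
(* so that (h r) [x] h' = h [x] (r h').                                       *)
Definition eta_c : R -> H^c := eta.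
Definition tens_bal := ltens eta_c eta.
HB.instance Definition _ := GRing.Zmodule.on tens_bal.
Definition bpure (h h' : H) : tens_bal := lpure eta_c eta h h'.

(* H x_R H                                                                    *)
Definition takeuchi_lr := takeuchi eta eta.
HB.instance Definition _ := KAlgebra.on takeuchi_lr.
Definition lrval (x : takeuchi_lr) : tens_lr := takeuchi_val x.

(* H x_R H^op: right multiplication by r in H^c is h |-> r h, so the elements  *)
(* satisfy sum r h_i [x] h'_i = sum h_i [x] h'_i r; the componentwise product  *)
(* of H^c x_R H is (h [x] h') (g [x] g') = g h [x] h' g', whose converse is    *)
(* h g [x] g' h'.                                                             *)
Definition takeuchi_op := (takeuchi eta_c eta)^c.
HB.instance Definition _ := KAlgebra.on takeuchi_op.
Definition opval (x : takeuchi_op) : tens_bal :=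
  takeuchi_val (x : takeuchi eta_c eta).

(* r . (h (x) h') = (r h) (x) h'                                              *)
Definition lr_act (r : R) : tens_lr -> tens_lr :=
  tmap _ _ (lmult eta r) idfun.

(* (H (x) H) (x) H -> H (x) (H (x) H)                                         *)
Definition tens_assoc :
    tens lr_act (lmult eta) -> tens (lmult eta) lr_act :=
  tlift (fun (x : tens_lr) (h3 : H) =>
    tlift (fun h1 h2 : H => tpure (lmult eta) lr_act h1 (lrpure h2 h3)) x).

Variables (Delta : H -> takeuchi_lr) (eps : H -> R).
Let Delta_lr (h : H) : tens_lr := lrval (Delta h).

Record is_bialgebroid : Prop := {
  bia_subalgebra : is_subalgebra_map;
  bia_Delta_linear : forall r h, Delta_lr (eta r * h) = lr_act r (Delta_lr h);
  bia_eps_zmod : zmod_morphism eps;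
  bia_eps_linear : forall r h, eps (eta r * h) = r * eps h;
  bia_coassoc : forall h,
    tens_assoc (tmap _ _ Delta_lr idfun (Delta_lr h)) =
    tmap _ _ idfun Delta_lr (Delta_lr h);
  bia_counitl : forall h,
    tlift (fun h1 h2 : H => eta (eps h1) * h2) (Delta_lr h) = h;
  bia_counitr : forall h,
    tlift (fun h1 h2 : H => eta (eps h2) * h1) (Delta_lr h) = h;
  bia_Delta_morphism : kalg_morphism Delta;
  bia_eps_rep : is_representation (fun h r => eps (h * eta r));
  bia_eps_regular : forall r r', eps (eta r * eta r') = r * r'
}.

Definition is_cocommutative : Prop :=
  forall h, tflip (Delta_lr h) = Delta_lr h.

(* h [x] h' |-> sum h_(1) (x) h_(2) h'                                        *)
Definition galois : tens_bal -> tens_lr :=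
  tlift (fun h h' : H => rmult 1 h' (Delta_lr h)).

Record is_hopf_algebroid : Prop := {
  hopf_bialgebroid : is_bialgebroid;
  hopf_galois : bijective galois
}.

(* red is h |-> galois^-1 (h (x) 1), as a map into H x_R H^op.                *)
Definition is_red (red : H -> takeuchi_op) : Prop :=
  forall h, galois (opval (red h)) = lrpure h 1.
End Bialgebroid.

(* The injective algebra morphism j identifies A with a subalgebra of H that   *)
(* contains R, and the structure maps of H restrict to those of A.            *)
Record is_hopf_subalgebroid (k : comPzRingType) (R : comAlgType k)
    (A H : kalgType k) (etaA : R -> A) (eta : R -> H) (j : A -> H)
    (DeltaA : A -> takeuchi_lr etaA) (epsA : A -> R) (redA : A -> takeuchi_op etaA)
    (Delta : H -> takeuchi_lr eta) (eps : H -> R) (red : H -> takeuchi_op eta) :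
    Prop := {
  hsub_morphism : kalg_morphism j;
  hsub_inj : injective j;
  hsub_eta : forall r, j (etaA r) = eta r;
  hsub_hopf : is_hopf_algebroid DeltaA epsA;
  hsub_red : is_red DeltaA redA;
  hsub_Delta : forall x,
    tmap _ _ j j (lrval (DeltaA x)) = lrval (Delta (j x));
  hsub_eps : forall x, epsA x = eps (j x);
  hsub_redE : forall x,
    tmap _ _ (j : A^c -> H^c) j (opval (redA x)) = opval (red (j x))
}.

(* An action of the group W on the commutative k-algebra R by algebra          *)
(* automorphisms.                                                             *)
Record alg_action (k : comNzRingType) (R : comAlgType k) (W : groupType) := AlgAction {
  act :> W -> R -> R;
  act_linear : forall w, linear (act w);
  act_monoid : forall w, GRing.monoid_morphism (act w);
  act1 : forall r, act 1%g r = r;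
  actM : forall v w r, act (v * w)%g r = act v (act w r)
}.

(* R * W = R (x)_k kW, as finitely supported functions from W to R:            *)
(* << r *g w >> is r w, and (r g) (r' g') = r g(r') g g'.                      *)
Section Twisted.
Variables (k : comNzRingType) (R : comAlgType k) (W : groupType).

Definition twisted of alg_action R W := {malg R[W]}.
HB.instance Definition _ a := GRing.Zmodule.copy (twisted a) {malg R[W]}.

Variable a : alg_action R W.

Definition tw (r : R) (w : W) : twisted a := << r *g w >>.

Definition tw_mul (x y : twisted a) : twisted a :=
  \sum_(g <- msupp x) \sum_(h <- msupp y) tw (x@_g * a g (y@_h)) (g * h)%g.

Lemma act_zmod w : zmod_morphism (a w).
Proof. by move=> x y; rewrite -scaleN1r addrC (act_linear a) scaleN1r addrC. Qed.
HB.instance Definition _ w := GRing.isZmodMorphism.Build R R (a w) (act_zmod w).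
HB.instance Definition _ w := GRing.isMonoidMorphism.Build R R (a w) (act_monoid a w).

Lemma twD r r' w : tw (r + r') w = tw r w + tw r' w.
Proof. exact: monalgUD. Qed.
Lemma tw0 w : tw 0 w = 0. Proof. exact: monalgU0. Qed.

Lemma tw_sumEw (Z : zmodType) (F : W -> R -> Z) (d : {fset W}) (x : twisted a) :
  (forall w, F w 0 = 0) -> (msupp x `<=` d)%fset ->
  \sum_(g <- msupp x) F g x@_g = \sum_(g <- d) F g x@_g.
Proof.
move=> F0 le; rewrite (big_fset_incl _ le) // => g _ /mcoeff_outdom ->.
exact: F0.
Qed.

Lemma tw_sumD (Z : zmodType) (F : W -> R -> Z) (x y : twisted a) :
  (forall w r r', F w (r + r') = F w r + F w r') ->
  \sum_(g <- msupp (x + y)) F g (x + y)@_g =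
  \sum_(g <- msupp x) F g x@_g + \sum_(g <- msupp y) F g y@_g.
Proof.
move=> FD; have F0 w : F w 0 = 0 by apply: (addrI (F w 0)); rewrite -FD !addr0.
rewrite (tw_sumEw F0 (msuppD_le x y)).
rewrite (tw_sumEw F0 (fsubsetUl (msupp x) (msupp y))).
rewrite (tw_sumEw F0 (fsubsetUr (msupp x) (msupp y))) -big_split /=.
by apply: eq_bigr => g _; rewrite mcoeffD FD.
Qed.

Lemma tw_sumU (Z : zmodType) (F : W -> R -> Z) r w : F w 0 = 0 ->
  \sum_(g <- msupp (tw r w)) F g (tw r w)@_g = F w r.
Proof.
move=> F0; rewrite (big_fset_incl _ (@msuppU_le _ _ w r)) /=; last first.
  move=> g; rewrite inE => /eqP -> /mcoeff_outdom ->; exact: F0.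
by rewrite big_seq_fset1 mcoeffUU.
Qed.

Lemma tw_mulDl : left_distributive tw_mul +%R.
Proof.
move=> x y z; rewrite /tw_mul.
apply: (tw_sumD (F := fun g r => \sum_(h <- msupp z) tw (r * a g z@_h) (g * h)%g)).
by move=> g r r'; rewrite -big_split /=; apply: eq_bigr => h _; rewrite mulrDl twD.
Qed.
Lemma tw_mulDr : right_distributive tw_mul +%R.
Proof.
move=> x y z; rewrite /tw_mul -big_split /=; apply: eq_bigr => g _.
apply: (tw_sumD (F := fun h r => tw (x@_g * a g r) (g * h)%g)).
by move=> h r r'; rewrite raddfD mulrDr twD.
Qed.
Lemma tw_mulE r g r' h : tw_mul (tw r g) (tw r' h) = tw (r * a g r') (g * h)%g.
Proof.
rewrite /tw_mul (tw_sumU (F := fun g r => \sum_(h' <- msupp (tw r' h))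
  tw (r * a g (tw r' h)@_h') (g * h')%g)); last first.
  by apply: big1 => h' _; rewrite mul0r tw0.
by rewrite (tw_sumU (F := fun h r' => tw (r * a g r') (g * h)%g)) // raddf0 mulr0 tw0.
Qed.

Lemma tw_ind (P : twisted a -> Prop) :
  P 0 -> (forall x y, P x -> P y -> P (x + y)) -> (forall r w, P (tw r w)) ->
  forall x, P x.
Proof.
move=> P0 PD PU x; rewrite (monalgE x).
by apply: big_ind => // g _; exact: PU.
Qed.

Lemma tw_mul0l x : tw_mul 0 x = 0.
Proof. by apply: (addrI (tw_mul 0 x)); rewrite -tw_mulDl !addr0. Qed.
Lemma tw_mul0r x : tw_mul x 0 = 0.
Proof. by apply: (addrI (tw_mul x 0)); rewrite -tw_mulDr !addr0. Qed.

Lemma tw_mulA : associative tw_mul.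
Proof.
move=> x y z; elim/tw_ind: x => [|x x' ex ex'|r g]; first by rewrite !tw_mul0l.
  by rewrite !tw_mulDl ex ex'.
elim/tw_ind: y => [|y y' ey ey'|r' h].
- by rewrite tw_mul0l tw_mul0r tw_mul0l.
- by rewrite tw_mulDl !tw_mulDr tw_mulDl ey ey'.
elim/tw_ind: z => [|z z' ez ez'|r'' l]; first by rewrite !tw_mul0r.
  by rewrite !tw_mulDr ez ez'.
by rewrite !tw_mulE rmorphM actM !mulrA mulgA.
Qed.
Lemma tw_mul1 : left_id (tw 1 1%g) tw_mul.
Proof.
move=> x; elim/tw_ind: x => [|x y ex ey|r g]; first by rewrite tw_mul0r.
  by rewrite tw_mulDr ex ey.
by rewrite tw_mulE act1 mul1r mul1g.
Qed.
Lemma tw_mulr1 : right_id (tw 1 1%g) tw_mul.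
Proof.
move=> x; elim/tw_ind: x => [|x y ex ey|r g]; first by rewrite tw_mul0l.
  by rewrite tw_mulDl ex ey.
by rewrite tw_mulE rmorph1 mulr1 mulg1.
Qed.
HB.instance Definition _ :=
  GRing.Zmodule_isPzRing.Build (twisted a) tw_mulA tw_mul1 tw_mulr1 tw_mulDl tw_mulDr.

Definition tw_eta (r : R) : twisted a := tw r 1%g.
Definition tw_kin (c : k) : twisted a := tw_eta c%:A.

Lemma tw_kin_zmod : zmod_morphism tw_kin.
Proof.
move=> c d; apply/eqP; rewrite eq_sym subr_eq -twD -scalerDl subrK //.
Qed.
Lemma tw_kin_monoid : GRing.monoid_morphism tw_kin.
Proof.
split=> [|c d]; first by rewrite /tw_kin scale1r.
rewrite -[RHS]/(tw_mul _ _) tw_mulE act1 mulg1.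
by rewrite -scalerAl mul1r scalerA.
Qed.
Lemma tw_kinC c x : tw_kin c * x = x * tw_kin c.
Proof.
elim/tw_ind: x => [|x y ex ey|r g]; first by rewrite mulr0 mul0r.
  by rewrite mulrDl mulrDr ex ey.
rewrite -[LHS]/(tw_mul _ _) -[RHS]/(tw_mul _ _) !tw_mulE act1 mulg1 mul1g.
have -> : a g c%:A = c%:A.
  have := act_linear a g c 1 0; rewrite addr0 raddf0 addr0 => ->.
  by rewrite rmorph1.
by rewrite mulrC.
Qed.
HB.instance Definition _ :=
  isKAlgebra.Build k (twisted a) tw_kin_zmod tw_kin_monoid tw_kinC.
End Twisted.

Section LinearGroup.
Variables (K : comNzRingType) (V : lmodType K).

Record linaut := LinAut {
  la_fun :> V -> V;
  la_inv : V -> V;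
  la_linear : linear la_fun;
  la_funK : cancel la_fun la_inv;
  la_invK : cancel la_inv la_fun
}.
HB.instance Definition _ := gen_eqMixin linaut.
HB.instance Definition _ := gen_choiceMixin linaut.

Lemma linautP (f g : linaut) : (forall v, f v = g v) -> f = g.
Proof.
case: f g => [f f' fl fK fK'] [g g' gl gK gK'] /= /funext e.
rewrite -e in gl gK gK' *; have e' : f' = g'.
  by apply/funext => v; rewrite -[v in LHS]gK' fK.
rewrite -e' in gK gK' *.
by congr LinAut; exact: Prop_irrelevance.
Qed.

Definition la_one : linaut :=
  @LinAut idfun idfun (fun _ _ _ => erefl) (fun _ => erefl) (fun _ => erefl).

Lemma la_comp_linear (f g : linaut) : linear (f \o g).
Proof. by move=> c u v /=; rewrite !la_linear. Qed.
Definition la_mul (f g : linaut) : linaut :=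
  LinAut (la_comp_linear f g) (can_comp (@la_funK f) (@la_funK g))
    (can_comp (@la_invK g) (@la_invK f)).

Lemma la_inv_linear (f : linaut) : linear (la_inv f).
Proof.
move=> c u v; rewrite -{1}[u](@la_invK f) -{1}[v](@la_invK f).
by rewrite -la_linear la_funK.
Qed.
Definition la_invg (f : linaut) : linaut :=
  LinAut (la_inv_linear f) (@la_invK f) (@la_funK f).

Lemma la_mulA : associative la_mul. Proof. by move=> f g h; apply/linautP. Qed.
Lemma la_mul1 : left_id la_one la_mul. Proof. by move=> f; apply/linautP. Qed.
Lemma la_mulr1 : right_id la_one la_mul. Proof. by move=> f; apply/linautP. Qed.
Lemma la_mulV : left_inverse la_one la_invg la_mul.
Proof. by move=> f; apply/linautP => v /=; rewrite la_funK. Qed.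
Lemma la_mulrV : right_inverse la_one la_invg la_mul.
Proof. by move=> f; apply/linautP => v /=; rewrite la_invK. Qed.
HB.instance Definition _ :=
  isGroup.Build linaut la_mulA la_mul1 la_mulr1 la_mulV la_mulrV.
End LinearGroup.

(* m s t is the order of s t in W, with 0 standing for infinity; (W, S) has    *)
(* the presentation < s in S | s^2 = 1, (s t)^(m s t) = 1 for s <> t >.        *)
Record coxeter_system (S : Type) (W : groupType) (sg : S -> W) (m : S -> S -> nat) :
    Prop := {
  cox_diag : forall s, m s s = 1%N;
  cox_sym : forall s t, m s t = m t s;
  cox_off_diag : forall s t, s <> t -> m s t <> 1%N;
  cox_order : forall s t n, ((sg s * sg t) ^+ n = 1)%g <-> (m s t %| n)%N;
  cox_presentation : forall (G : groupType) (f : S -> G),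
    (forall s, (f s * f s = 1)%g) ->
    (forall s t, s <> t -> (0 < m s t)%N -> ((f s * f t) ^+ m s t = 1)%g) ->
    exists! phi : W -> G,
      {morph phi : v w / (v * w)%g} /\ (forall s, phi (sg s) = f s)
}.

Lemma lin_sub (K : comNzRingType) (V : lmodType K) (u v w : V) (c x y : K) :
  c *: u + v - (c * x + y) *: w = c *: (u - x *: w) + (v - y *: w).
Proof. by rewrite scalerBr scalerA addrACA -opprD -scalerDl. Qed.

Lemma scale4D (K : comNzRingType) (V : lmodType K) (u v : V)
    (x1 y1 y2 x2 x y : K) : x1 + x2 = x -> y1 + y2 = y ->
  x1 *: u + (y1 *: v + (y2 *: v + x2 *: u)) = x *: u + y *: v.
Proof.
by move=> <- <-; rewrite !scalerDl -!addrA; congr (_ + _); rewrite addrA addrC.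
Qed.

Section GeometricRepresentation.
Variables (K : realType) (S : choiceType) (m : S -> S -> nat).

Definition hstar := {malg K[S]}.
HB.instance Definition _ := GRing.Lmodule.on hstar.

Definition alpha (s : S) : hstar := << s >>.

Definition cox_angle (s t : S) : K := if m s t == 0%N then 0 else pi / (m s t)%:R.

Definition cox_form (l u : hstar) : K :=
  \sum_(s <- msupp l) \sum_(t <- msupp u) l@_s * u@_t * - cos (cox_angle s t).

(* < l, alpha_s^vee > *)
Definition coroot (s : S) (l : hstar) : K :=
  2 * cox_form l (alpha s) / cox_form (alpha s) (alpha s).

Definition simple_reflection (s : S) (l : hstar) : hstar :=
  l - coroot s l *: alpha s.

Lemma cox_formUr (l : hstar) t :
  cox_form l (alpha t) = mmap idfun (fun s => - cos (cox_angle s t)) l.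
Proof.
rewrite /cox_form /mmap; apply: eq_bigr => s _.
by rewrite msuppU oner_eq0 big_seq_fset1 mcoeffUU mulr1.
Qed.

Lemma cox_formD (l l' : hstar) t :
  cox_form (l + l') (alpha t) = cox_form l (alpha t) + cox_form l' (alpha t).
Proof. by rewrite !cox_formUr; exact: raddfD. Qed.

Lemma cox_formZ c (l : hstar) t :
  cox_form (c *: l) (alpha t) = c * cox_form l (alpha t).
Proof.
rewrite !cox_formUr (mmapEw (msuppZ_le c l)) /mmap big_distrr /=.
by apply: eq_bigr => s _; rewrite mcoeffZ mulrA.
Qed.

Lemma cox_formUU s t : cox_form (alpha s) (alpha t) = - cos (cox_angle s t).
Proof. by rewrite cox_formUr mmapU /= mul1r. Qed.

Hypothesis m_diag : forall s, m s s = 1%N.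
Hypothesis m_sym : forall s t, m s t = m t s.
Hypothesis m_off : forall s t, s <> t -> m s t <> 1%N.

Lemma cox_form_diag s : cox_form (alpha s) (alpha s) = 1.
Proof. by rewrite cox_formUU /cox_angle m_diag /= divr1 cospi opprK. Qed.

Lemma reflE s l : simple_reflection s l = l - (2 * cox_form l (alpha s)) *: alpha s.
Proof. by rewrite /simple_reflection /coroot cox_form_diag divr1. Qed.

Lemma refl_linear s : linear (simple_reflection s).
Proof.
move=> c u v; rewrite !reflE cox_formD cox_formZ mulrDr.
by rewrite mulrCA lin_sub.
Qed.

Lemma reflK s : involutive (simple_reflection s).
Proof.
move=> l; rewrite reflE; set x := simple_reflection s l.
have -> : cox_form x (alpha s) = - cox_form l (alpha s).
  rewrite /x reflE -scaleNr cox_formD cox_formZ cox_form_diag; ring.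
by rewrite /x reflE mulrN scaleNr opprK subrK.
Qed.

Definition refl_aut s : linaut hstar :=
  LinAut (@refl_linear s) (@reflK s) (@reflK s).

Lemma refl_aut2 s : (refl_aut s * refl_aut s = 1)%g.
Proof. by apply: linautP => v; exact: reflK. Qed.

(* chebU c n = (sin (n x) / sin x, sin ((n + 1) x) / sin x) for c = cos x      *)
Fixpoint chebU (c : K) (n : nat) : K * K :=
  if n is n'.+1 then
    let: (u, v) := chebU c n' in (v, 2 * c * v - u)
  else (0, 1).

Lemma chebU_inv c n :
  let: (u, v) := chebU c n in u ^+ 2 + v ^+ 2 - 2 * c * u * v = 1.
Proof.
elim: n => [|n] /=; first by rewrite expr0n expr1n mulr0 mul0r subr0 add0r.
by case: (chebU c n) => u v e; rewrite -[RHS]e; ring.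
Qed.

Lemma chebU_sin (x : K) n :
  (chebU (cos x) n).1 * sin x = sin (n%:R * x) /\
  (chebU (cos x) n).2 * sin x = sin (n.+1%:R * x).
Proof.
elim: n => [|n] /=; first by rewrite !mul0r sin0 !mul1r.
case: (chebU (cos x) n) => u v /= [eu ev]; split=> //.
have e1 : n.+2%:R * x = n.+1%:R * x + x by rewrite -[n.+2]addn1 natrD mulrDl mul1r.
have e2 : n%:R * x = n.+1%:R * x - x by rewrite -[n.+1]addn1 natrD mulrDl mul1r addrK.
rewrite mulrBl eu e2 e1 sinB sinD -ev; ring.
Qed.

Lemma refl_comp_pow s t n l : s <> t ->
  let c := cos (cox_angle s t) in
  let p := cox_form l (alpha s) in
  let q := cox_form l (alpha t) in
  let: (u, v) := chebU c n in
  ((refl_aut s * refl_aut t) ^+ n)%g l =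
    l - (2 * u * (p * u + q * v)) *: alpha s
      - (2 * u * (p * (2 * c * u - v) + q * u)) *: alpha t.
Proof.
move=> st c p q; elim: n => [|n IH] /=.
  by rewrite mulr0 !mul0r !scale0r !subr0.
have := chebU_inv c n; case: (chebU c n) IH => u v IH uv.
rewrite expgS -[LHS]/(simple_reflection s (simple_reflection t
  (((refl_aut s * refl_aut t) ^+ n)%g l))) IH.
have cst : cox_form (alpha s) (alpha t) = - c by rewrite cox_formUU.
have cts : cox_form (alpha t) (alpha s) = - c.
  by rewrite cox_formUU /cox_angle m_sym.
rewrite !reflE -!scaleNr !(cox_formD, cox_formZ) !cox_form_diag cst cts -/p -/q.
rewrite -!addrA; congr (_ + _).
set A := alpha s; set B := alpha t.
apply: scale4D.
- apply/eqP; rewrite -subr_eq0; apply/eqP.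
  transitivity ((- 2 * (p + 2 * c * q)) * (1 - (u ^+ 2 + v ^+ 2 - 2 * c * u * v))).
    ring.
  by rewrite uv subrr mulr0.
- apply/eqP; rewrite -subr_eq0; apply/eqP.
  transitivity ((- 2 * q) * (1 - (u ^+ 2 + v ^+ 2 - 2 * c * u * v))); first by ring.
  by rewrite uv subrr mulr0.
Qed.

Lemma refl_aut_braid s t : s <> t -> (0 < m s t)%N ->
  ((refl_aut s * refl_aut t) ^+ m s t = 1)%g.
Proof.
move=> st m_gt0; apply: linautP => l.
have [eu _] := chebU_sin (cox_angle s t) (m s t).
have /= := @refl_comp_pow s t (m s t) l st.
case: (chebU _ _) eu => u v /= eu ->.
have m_neq0 : (m s t)%:R != 0 :> K by rewrite pnatr_eq0 -lt0n.
suff -> : u = 0 by rewrite mulr0 !mul0r !scale0r !subr0.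
have mE : cox_angle s t = pi / (m s t)%:R by rewrite /cox_angle gtn_eqF.
apply: (@mulIf _ (sin (cox_angle s t))); last first.
  by rewrite eu mul0r mE mulrC divfK // sinpi.
apply/lt0r_neq0/sin_gt0_pi; rewrite mE.
have m_gt1 : (1 < m s t)%N by have := m_off st; case: (m s t) m_gt0 => [|[]].
apply/andP; split; first by rewrite divr_gt0 ?pi_gt0 // ltr0n.
by rewrite ltr_pdivrMr ?ltr0n // ltr_pMr ?pi_gt0 // ltr1n.
Qed.
End GeometricRepresentation.

Lemma linear_parts (K : comNzRingType) (V V' : lmodType K) (F : V -> V') :
  linear F -> [/\ F 0 = 0, {morph F : x y / x + y} & forall c x, F (c *: x) = c *: F x].
Proof.
move=> Fl; have F0 : F 0 = 0.
  by have := Fl (-1) 0 0; rewrite !scaleN1r !addNr.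
split=> // [x y|c x]; first by have := Fl 1 x y; rewrite !scale1r.
by have := Fl c x 0; rewrite F0 !addr0.
Qed.

Lemma malg_scaleU (K : comNzRingType) (M : choiceType) (c : K) (x : M) :
  << c *g x >> = c *: << x >> :> {malg K[M]}.
Proof.
apply/malgP => t; rewrite mcoeffZ !mcoeffU.
by case: (x == t); rewrite ?mulr1 ?mulr0.
Qed.

Section SymmetricAlgebra.
Variables (K : realType) (S : choiceType).

(* Sym(h^* ) is the polynomial algebra on the basis (alpha_s) of h^*.           *)
Definition Sym := {malg K[{cmonom S}]}.
HB.instance Definition _ := GRing.ComAlgebra.on Sym.

Definition sym_kin (c : K) : Sym := c%:A.
Lemma sym_kin_zmod : zmod_morphism sym_kin.
Proof. by move=> c d; rewrite /sym_kin scalerBl. Qed.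
Lemma sym_kin_monoid : GRing.monoid_morphism sym_kin.
Proof.
split=> [|c d]; first exact: scale1r.
by rewrite /sym_kin -scalerAl mul1r scalerA.
Qed.
Lemma sym_kinC c (x : Sym) : sym_kin c * x = x * sym_kin c.
Proof. exact: mulrC. Qed.
HB.instance Definition _ :=
  isKAlgebra.Build K Sym sym_kin_zmod sym_kin_monoid sym_kinC.

Definition symX (s : S) : Sym := << ucm s >>.

(* The inclusion of h^* in Sym(h^* ).                                          *)
Definition hincl (l : hstar K S) : Sym := \sum_(s <- msupp l) l@_s *: symX s.

(* Evaluation of a polynomial at a family of pairwise commuting elements.     *)
Definition sym_eval (A : kalgType K) (f : S -> A) (r : Sym) : A :=
  \sum_(mu <- msupp r) kin r@_mu * \prod_(s <- finsupp mu) f s ^+ mu s.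

Section EvalSym.
Variable f : S -> Sym.

Definition cmeval (mu : {cmonom S}) : Sym := \prod_(s <- finsupp mu) f s ^+ mu s.

Lemma cmevalEw (mu : {cmonom S}) (d : {fset S}) : (finsupp mu `<=` d)%fset ->
  cmeval mu = \prod_(s <- d) f s ^+ mu s.
Proof.
move=> le; rewrite /cmeval (big_fset_incl _ le) // => s _.
by rewrite memNfinsupp => /eqP ->.
Qed.

Lemma cmeval_morphism : mmorphism cmeval.
Proof.
split=> [mu nu|]; last by rewrite /cmeval mdom1 big_seq_fset0.
rewrite (cmevalEw (d := finsupp mu `|` finsupp nu)%fset); last first.
  by rewrite mdomD.
rewrite (cmevalEw (fsubsetUl (finsupp mu) (finsupp nu))).
rewrite (cmevalEw (fsubsetUr (finsupp mu) (finsupp nu))) -big_split /=.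
by apply: eq_bigr => s _; rewrite cmM exprD.
Qed.
HB.instance Definition _ := monalg.isMultiplicative.Build _ _ cmeval cmeval_morphism.

Lemma sym_evalE r : sym_eval f r = mmap (in_alg Sym) cmeval r.
Proof. by []. Qed.

Lemma sym_eval_monoid : GRing.monoid_morphism (sym_eval f).
Proof.
split=> [|x y]; rewrite !sym_evalE; first exact: rmorph1.
exact: rmorphM.
Qed.

Lemma sym_eval_linear : linear (sym_eval f).
Proof.
move=> c x y; rewrite !sym_evalE raddfD; congr (_ + _).
by rewrite -[RHS]mulr_algl; exact: (mmapZ c x).
Qed.

Lemma sym_evalX s : sym_eval f (symX s) = f s.
Proof.
rewrite sym_evalE mmapU /= scale1r mul1r /cmeval mdomU big_seq_fset1.
by rewrite cmUU expr1.
Qed.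

Lemma sym_eval_hincl l : sym_eval f (hincl l) = \sum_(s <- msupp l) l@_s *: f s.
Proof.
have [e0 eD eZ] := linear_parts sym_eval_linear.
rewrite /hincl (big_morph (sym_eval f) eD e0); apply: eq_bigr => s _.
by rewrite eZ sym_evalX.
Qed.
End EvalSym.

Lemma hinclEw (l : hstar K S) (d : {fset S}) : (msupp l `<=` d)%fset ->
  hincl l = \sum_(s <- d) l@_s *: symX s.
Proof.
move=> le; rewrite /hincl (big_fset_incl _ le) // => s _ /mcoeff_outdom ->.
by rewrite scale0r.
Qed.

Lemma hincl_linear : linear hincl.
Proof.
move=> c l u; pose d := (msupp l `|` msupp u)%fset.
have le : (msupp (c *: l + u) `<=` d)%fset.
  apply: fsubset_trans (msuppD_le _ _) _; exact: fsetSU (msuppZ_le c l).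
rewrite (hinclEw le) (hinclEw (fsubsetUl (msupp l) (msupp u))).
rewrite (hinclEw (fsubsetUr (msupp l) (msupp u))) scaler_sumr -big_split /=.
apply: eq_bigr => s _.
by rewrite mcoeffD mcoeffZ scalerDl scalerA.
Qed.

Lemma hincl_alpha s : hincl (alpha K s) = symX s.
Proof. by rewrite /hincl msuppU oner_eq0 big_seq_fset1 mcoeffUU scale1r. Qed.

(* The automorphism of Sym(h^* ) induced by a linear automorphism of h^*.      *)
Definition sym_aut (g : linaut (hstar K S)) : Sym -> Sym :=
  sym_eval (fun s => hincl (g (alpha K s))).

Lemma sym_aut_hincl g l : sym_aut g (hincl l) = hincl (g l).
Proof.
rewrite /sym_aut sym_eval_hincl.
have [h0 hD hZ] := linear_parts hincl_linear.
have [g0 gD gZ] := linear_parts (la_linear g).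
rewrite [in RHS](monalgE l) (big_morph g gD g0) (big_morph hincl hD h0).
apply: eq_bigr => s _; rewrite -hZ -gZ; congr (hincl (g _)).
exact: (esym (malg_scaleU _ _)).
Qed.

Lemma sym_monomE (c : K) (mu : {cmonom S}) :
  << c *g mu >> = c *: \prod_(s <- finsupp mu) symX s ^+ mu s :> Sym.
Proof.
pose e (s : S) n : {cmonom S} := iter n (mmul (ucm s)) mone.
have eE s n i : e s n i = (n * (s == i))%N.
  elim: n => [|n IH]; first by rewrite cm1.
  by rewrite [e s n.+1]/(mmul _ _) cmM IH cmU mulSn.
have M (x y : {cmonom S}) : << mmul x y >> = << x >> * << y >> :> Sym.
  by rewrite [RHS]fgmulUU mulr1.
have oneE : (1 : Sym) = << mone >>.
  by apply/malgP => nu; rewrite !mcoeff1.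
have XE s n : symX s ^+ n = << e s n >>.
  elim: n => [|n IH]; first by rewrite expr0; exact: oneE.
  by rewrite exprS IH; exact: (esym (M (ucm s) (e s n))).
under eq_bigr do rewrite XE.
rewrite -(big_morph (fun x : {cmonom S} => << x >> : Sym) M (esym oneE)).
have -> : \big[mmul/mone]_(s <- finsupp mu) e s (mu s) = mu.
  apply/eqP/cmP => i.
  have mD : {morph (fun x : {cmonom S} => x i) : x y / mmul x y >-> (x + y)%N}.
    by move=> x y; exact: cmM.
  rewrite (big_morph (fun x : {cmonom S} => x i) mD (cm1 i)).
  under eq_bigr do rewrite eE.
  case: (boolP (i \in finsupp mu)) => hi.
    rewrite (big_fsetD1 i) //= eqxx muln1 big_seq big1 ?addn0 // => s.
    by rewrite !inE => /andP[/negPf -> _]; rewrite muln0.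
  have := hi; rewrite memNfinsupp => /eqP ->; rewrite big_seq big1 // => s hs.
  by case: eqP hi => [<-|_]; rewrite ?muln0 // hs.
exact: malg_scaleU.
Qed.

Lemma sym_eval_eq (F G : Sym -> Sym) : linear F -> GRing.monoid_morphism F ->
  linear G -> GRing.monoid_morphism G ->
  (forall s, F (symX s) = G (symX s)) -> F =1 G.
Proof.
move=> Fl [F1 FM] Gl [G1 GM] FG r.
have [F0 FD FZ] := linear_parts Fl; have [G0 GD GZ] := linear_parts Gl.
rewrite (monalgE r) (big_morph F FD F0) (big_morph G GD G0).
apply: eq_bigr => mu _.
rewrite sym_monomE.
rewrite FZ GZ; congr (_ *: _).
rewrite (big_morph F FM F1) (big_morph G GM G1); apply: eq_bigr => s _.
elim: (mu s) => [|n IH]; first by rewrite !expr0 F1 G1.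
by rewrite !exprS FM GM IH FG.
Qed.
End SymmetricAlgebra.

Section GeometricAction.
Variables (K : realType) (S : choiceType) (W : groupType) (sg : S -> W).
Variables (m : S -> S -> nat) (cox : coxeter_system sg m).

Let refl s : linaut (hstar K S) :=
  refl_aut K (cox_diag cox) s.

Lemma geometric_rep_exists : exists phi : W -> linaut (hstar K S),
  {morph phi : v w / (v * w)%g} /\ (forall s, phi (sg s) = refl s).
Proof.
have [||phi [h _]] := cox_presentation cox (f := refl).
- by move=> s; exact: refl_aut2.
- by move=> s t; exact: (refl_aut_braid K (cox_diag cox) (cox_sym cox) (cox_off_diag cox)).
- by exists phi.
Qed.

(* The representation of W on h^* in which every s in S acts by the formula    *)
(* for s(lambda).                                                             *)
Definition geometric_rep : W -> linaut (hstar K S) :=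
  sval (cid geometric_rep_exists).

Lemma geometric_repM : {morph geometric_rep : v w / (v * w)%g}.
Proof. exact: (svalP (cid geometric_rep_exists)).1. Qed.

Lemma geometric_rep_refl s l :
  geometric_rep (sg s) l = simple_reflection m s l.
Proof.
have e : geometric_rep (sg s) = refl s := (svalP (cid geometric_rep_exists)).2 s.
by rewrite e.
Qed.

Lemma geometric_rep1 : geometric_rep 1%g = 1%g.
Proof. by apply: (mulgI (geometric_rep 1%g)); rewrite -geometric_repM !mulg1. Qed.

Let act w : Sym K S -> Sym K S := sym_aut (geometric_rep w).

Lemma geo_act_linear w : linear (act w). Proof. exact: sym_eval_linear. Qed.
Lemma geo_act_monoid w : GRing.monoid_morphism (act w).
Proof. exact: sym_eval_monoid. Qed.
Lemma geo_act1 r : act 1%g r = r.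
Proof.
apply: (@sym_eval_eq _ _ (act 1%g) idfun) => //; [exact: geo_act_linear| |].
  exact: geo_act_monoid.
by move=> s; rewrite /= -hincl_alpha /act sym_aut_hincl geometric_rep1.
Qed.
Lemma geo_actM v w r : act (v * w)%g r = act v (act w r).
Proof.
apply: (@sym_eval_eq _ _ (act (v * w)%g) (act v \o act w)).
- exact: geo_act_linear.
- exact: geo_act_monoid.
- by move=> c x y /=; rewrite !geo_act_linear.
- have [h1 hM] := geo_act_monoid v; have [h1' hM'] := geo_act_monoid w.
  by split=> [|x y] /=; rewrite ?h1' ?h1 // hM' hM.
- by move=> s /=; rewrite -hincl_alpha /act !sym_aut_hincl geometric_repM.
Qed.

Definition geometric_action : alg_action (Sym K S) W :=
  AlgAction geo_act_linear geo_act_monoid geo_act1 geo_actM.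

Definition sym_invariant (f : Sym K S) : Prop :=
  forall w, geometric_action w f = f.
End GeometricAction.

Section NilHecke.
Variables (K : realType) (S : choiceType) (m : S -> S -> nat).

Let gen := (hstar K S + S)%type.
Let H_ (l : hstar K S) : term K gen := Var K (inl l).
Let D_ (s : S) : term K gen := Var K (inr s).

(* x y x y ... (n factors)                                                    *)
Fixpoint alternating (X : Type) (n : nat) (x y : term K X) : term K X :=
  if n is n'.+1 then Mul x (alternating n' y x) else Const X 1.

(* [NHLin] expresses that the vector space h^*, and not merely its underlying  *)
(* set, is a part of the generators.                                          *)
Inductive nh_rel : term K gen -> term K gen -> Prop :=
| NHLin c l u : nh_rel (H_ (c *: l + u)) (Add (Mul (Const gen c) (H_ l)) (H_ u))
| NHComm l u : nh_rel (Mul (H_ l) (H_ u)) (Mul (H_ u) (H_ l))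
| NHCross s l : nh_rel (Mul (D_ s) (H_ l))
    (Add (Mul (H_ (simple_reflection m s l)) (D_ s)) (Const gen (coroot m s l)))
| NHNil s : nh_rel (Mul (D_ s) (D_ s)) (Const gen 0)
| NHBraid s t : s <> t -> (0 < m s t)%N ->
    nh_rel (alternating (m s t) (D_ s) (D_ t)) (alternating (m s t) (D_ t) (D_ s)).

Definition nilHecke := presented nh_rel.
HB.instance Definition _ := KAlgebra.on nilHecke.

Definition nh_vec (l : hstar K S) : nilHecke := pgen nh_rel (inl l).
Definition nh_del (s : S) : nilHecke := pgen nh_rel (inr s).

(* The element s = 1 - alpha_s del_s.                                         *)
Definition nh_refl (s : S) : nilHecke := 1 - nh_vec (alpha K s) * nh_del s.

(* The map R -> nH extending lambda |-> lambda.                               *)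
Definition nh_eta : Sym K S -> nilHecke :=
  sym_eval (fun s => nh_vec (alpha K s)).
End NilHecke.

(* The representation of nH on R by R^W-linear maps in which lambda acts by    *)
(* multiplication and del_s by f |-> (f - s(f)) / alpha_s.  As R is a domain,  *)
(* [nhr_del] determines the quotient, and the generators determine rho.       *)
Record is_nh_representation (K : realType) (S : choiceType) (W : groupType)
    (sg : S -> W) (m : S -> S -> nat) (cox : coxeter_system sg m)
    (rho : nilHecke K m -> Sym K S -> Sym K S) : Prop := {
  nhr_rep : is_representation rho;
  nhr_invariant_linear : forall h f g, sym_invariant cox f ->
    rho h (f * g) = f * rho h g;
  nhr_vec : forall l f, rho (nh_vec m l) f = hincl l * f;
  nhr_del : forall s f,
    hincl (alpha K s) * rho (nh_del K m s) f = f - geometric_action K cox (sg s) f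
}.

Section TwistedGroupAlgebra.
Variables (K : realType) (S : choiceType) (W : groupType) (sg : S -> W).
Variables (m : S -> S -> nat) (cox : coxeter_system sg m).

Definition RW := twisted (geometric_action K cox).
HB.instance Definition _ := KAlgebra.on RW.

(* The element r w of R * W.                                                  *)
Definition rw (r : Sym K S) (w : W) : RW := tw (geometric_action K cox) r w.
Definition rw_eta (r : Sym K S) : RW := rw r 1%g.
Definition rw_eps (x : RW) : Sym K S := \sum_(w <- msupp x) x@_w.
End TwistedGroupAlgebra.

(* Main.v *)
(* The polynomial representation detects relations.  For s <> t with           *)
(* m = m_st finite, let X be the difference of the two alternating words of    *)
(* length m in del_s and del_t.  In any algebra satisfying the other relations *)
(* of nH one has X l = w(l) X, w the longest element of the dihedral group of  *)
(* s and t: the lower terms of the two commutation formulas agree.  Hence X    *)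
(* acts on R by 0 as soon as it kills 1.  Conversely an R-linear combination   *)
(* of alternating words that acts on R by 0 is 0, since these words, applied   *)
(* to powers of a dominant element of their plane, are triangular.  Both       *)
(* arguments also work for H (x) H, by means of the forms                      *)
(* (f, g) |-> h(f) h'(g), and give the braid relations for the Delta(del_s)    *)
(* and (s t)^m = 1 for s = 1 - alpha_s del_s.                                  *)
(* If tau is the anti-automorphism of nH fixing R and all del_s, then          *)
(* red = (tau [x] id) o Delta o tau, and h (x) h' |-> red(h) h' inverts the    *)
(* Galois map.                                                                 *)
(* R * W embeds because nH also acts on functions from W to Frac R, with       *)
(* (l g)(v) = v^-1(l) g(v) and (s g)(v) = g(s v).                              *)

Require Import Defs.
From HB Require Import structures.
From mathcomp Require Import all_boot all_order all_algebra finmap.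
From mathcomp Require Import boolp reals trigo.
From mathcomp.multinomials Require Import monalg.
From mathcomp Require Import ring lra.

Set Implicit Arguments.
Unset Strict Implicit.
Unset Printing Implicit Defensive.

Import Order.TTheory GRing.Theory Num.Theory.
Local Open Scope ring_scope.

(** Among the relations of nH only the braid relations resist direct computation, and one mechanism
    handles them. Let a family satisfy the other relations ([nh_family]). When a linear form l is
    pushed through an alternating word, deleting an inner letter brings two equal letters together
    and gives 0, so only the deletions of the first and of the last letter survive
    ([alt_chevalley]). For the two words of length M = m_st these lower terms coincide, whence X l =
    w(l) X for the difference X, with w the longest element of the dihedral group
    ([braid_diff_lam]). Each braid relation then reduces to a statement about X on few test vectors.

    For the Demazure operators the test vectors are the constants, which both words kill
    ([demazure_braided]); this gives the representation rho on R. For the elements Delta(del_s) one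
    needs in addition that the relevant part of H (x) H is detected by R. The words in del_s and
    del_t are independent as operators on R: a word of length n sends the n-th power of a dominant
    vector to a positive constant ([rho_alt_dominant]), and completing words to the longest one
    makes the system triangular ([dbasis_indep]). Applied in both factors, by means of the forms (f,
    g) |-> h(f) h'(g), this yields [dspan2_detect] and then [delta_braid_pair].

    Once Delta is an algebra morphism, the axioms are inductions on multiplication by one generator;
    the main inputs are that s is group-like ([D_mul_rfl]) and that eps(h del_s) = 0. The
    anti-automorphism tau fixing R and every del_s produces red out of Delta, and the identities s s
    = 1 and del_s s = - del_s show that h (x) h' |-> red(h) h' inverts the Galois map ([nh_is_red],
    [nh_ungalois], [galois_bijective]).

    The elements s = 1 - alpha_s del_s satisfy the Coxeter relations, because (s t)^M - 1 lies in
    the span of the words and acts on R by 0 ([rfl_braid]). So W maps to the units of H, its image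
    consists of group-like elements ([D_gelt], [red_gelt]), and the Hopf structure of H restricts to
    that of R * W. For injectivity, H also acts on functions from W to the fraction field of R;
    there w acts by translation, and the delta function at 1 reveals all coefficients
    ([rw_map_inj]). The braid relations of this action come from interpolation: thanks to X l = w(l)
    X a function may be assumed to vanish at all points read by the two words except the farthest
    ([fbraid_poly]), where both words have the same leading coefficient ([lead_sym]). *)

Section LinearEndomorphisms.
Variables (K : comNzRingType) (V : lmodType K).

Record lend := Lend { lend_fun :> V -> V; lend_linear : linear lend_fun }.
HB.instance Definition _ := gen_eqMixin lend.
HB.instance Definition _ := gen_choiceMixin lend.

Lemma lendP (f g : lend) : (forall v, f v = g v) -> f = g.
Proof.
case: f g => [f fl] [g gl] /= /funext e; rewrite -e in gl *.
by congr Lend; exact: Prop_irrelevance.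
Qed.

Lemma lend_parts (f : lend) :
  [/\ f 0 = 0, {morph f : x y / x + y} & forall c x, f (c *: x) = c *: f x].
Proof. exact/linear_parts/lend_linear. Qed.

Lemma lend0_linear : linear (fun _ : V => 0 : V).
Proof. by move=> c u v; rewrite scaler0 addr0. Qed.
Lemma lendD_linear (f g : lend) : linear (fun v => f v + g v).
Proof. by move=> c u v; rewrite !lend_linear scalerDr addrACA. Qed.
Lemma lendN_linear (f : lend) : linear (fun v => - f v).
Proof. by move=> c u v; rewrite lend_linear opprD scalerN. Qed.
Lemma lendM_linear (f g : lend) : linear (fun v => f (g v)).
Proof. by move=> c u v; rewrite !lend_linear. Qed.
Lemma lend_kin_linear (c : K) : linear (fun v : V => c *: v).
Proof. by move=> d u v; rewrite scalerDr !scalerA mulrC. Qed.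

Definition lend0 := Lend lend0_linear.
Definition lend_add f g := Lend (lendD_linear f g).
Definition lend_opp f := Lend (lendN_linear f).
Definition lend_mul f g := Lend (lendM_linear f g).
Definition lend_kin c := Lend (lend_kin_linear c).

Lemma lend_addA : associative lend_add.
Proof. by move=> f g h; apply: lendP => v /=; rewrite addrA. Qed.
Lemma lend_addC : commutative lend_add.
Proof. by move=> f g; apply: lendP => v /=; rewrite addrC. Qed.
Lemma lend_add0 : left_id lend0 lend_add.
Proof. by move=> f; apply: lendP => v /=; rewrite add0r. Qed.
Lemma lend_addN : left_inverse lend0 lend_opp lend_add.
Proof. by move=> f; apply: lendP => v /=; rewrite addNr. Qed.
HB.instance Definition _ :=
  GRing.isZmodule.Build lend lend_addA lend_addC lend_add0 lend_addN.

Definition lend_one := Lend (fun (c : K) (u v : V) => erefl (c *: u + v)).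
Lemma lend_mulA : associative lend_mul. Proof. by move=> f g h; apply: lendP. Qed.
Lemma lend_mul1 : left_id lend_one lend_mul. Proof. by move=> f; apply: lendP. Qed.
Lemma lend_mulr1 : right_id lend_one lend_mul. Proof. by move=> f; apply: lendP. Qed.
Lemma lend_mulDl : left_distributive lend_mul lend_add.
Proof. by move=> f g h; apply: lendP. Qed.
Lemma lend_mulDr : right_distributive lend_mul lend_add.
Proof. by move=> f g h; apply: lendP => v /=; case: (lend_parts f) => _ ->. Qed.
HB.instance Definition _ := GRing.Zmodule_isPzRing.Build lend
  lend_mulA lend_mul1 lend_mulr1 lend_mulDl lend_mulDr.

Lemma lend_kin_zmod : zmod_morphism lend_kin.
Proof. by move=> c d; apply: lendP => v /=; rewrite scalerBl. Qed.
Lemma lend_kin_monoid : GRing.monoid_morphism lend_kin.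
Proof.
by split=> [|c d]; apply: lendP => v /=; rewrite ?scale1r // -scalerA.
Qed.
Lemma lend_kinC c f : lend_kin c * f = f * lend_kin c.
Proof. by apply: lendP => v /=; case: (lend_parts f) => _ _ ->. Qed.
HB.instance Definition _ :=
  isKAlgebra.Build K lend lend_kin_zmod lend_kin_monoid lend_kinC.

Lemma lendDE (f g : lend) v : (f + g) v = f v + g v. Proof. by []. Qed.
Lemma lendNE (f : lend) v : (- f) v = - f v. Proof. by []. Qed.
Lemma lendME (f g : lend) v : (f * g) v = f (g v). Proof. by []. Qed.

Lemma lend_representation (A : kalgType K) (f : A -> lend) :
  kalg_morphism f -> is_representation (fun a v => f a v).
Proof.
case=> fz [f1 fM] fk; split.
- by move=> a; exact: lend_linear.
- move=> a b v; have /= -> : f (a + b) = f a + f b; last by [].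
  by apply/eqP; rewrite -subr_eq -fz addrK.
- by move=> v; rewrite f1.
- by move=> a b v; rewrite fM.
- by move=> c v; rewrite fk.
Qed.
End LinearEndomorphisms.

Section UnitGroup.
Variable A : pzRingType.

(** The inverse is part of the data, so that the units of an arbitrary ring form a group into which
    the presentation of W can be mapped. *)
Record runit := RUnit {
  runit_val :> A; runit_inv : A;
  runit_mulV : runit_val * runit_inv = 1;
  runit_Vmul : runit_inv * runit_val = 1
}.
HB.instance Definition _ := gen_eqMixin runit.
HB.instance Definition _ := gen_choiceMixin runit.

Lemma runitP (x y : runit) : x = y :> A -> x = y.
Proof.
case: x y => [x x' xx' x'x] [y y' yy' y'y] /= e; rewrite -e in yy' y'y *.
have e' : x' = y' by rewrite -[x']mulr1 -yy' mulrA x'x mul1r.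
rewrite -e' in yy' y'y *; congr RUnit; exact: Prop_irrelevance.
Qed.

Lemma runit_one_mulV : (1 : A) * 1 = 1. Proof. exact: mulr1. Qed.
Definition runit_one := RUnit runit_one_mulV runit_one_mulV.
Lemma runit_mul_mulV (x y : runit) : ((x : A) * (y : A)) * (runit_inv y * runit_inv x) = 1.
Proof. by rewrite mulrA -(mulrA (x : A)) runit_mulV mulr1 runit_mulV. Qed.
Lemma runit_mul_Vmul (x y : runit) : (runit_inv y * runit_inv x) * ((x : A) * (y : A)) = 1.
Proof. by rewrite mulrA -(mulrA (runit_inv y)) runit_Vmul mulr1 runit_Vmul. Qed.
Definition runit_mul x y := RUnit (runit_mul_mulV x y) (runit_mul_Vmul x y).
Definition runit_invg x := RUnit (runit_Vmul x) (runit_mulV x).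
Lemma runit_mulA : associative runit_mul.
Proof. by move=> x y z; apply/runitP/mulrA. Qed.
Lemma runit_mul1 : left_id runit_one runit_mul.
Proof. by move=> x; apply/runitP/mul1r. Qed.
Lemma runit_mulr1 : right_id runit_one runit_mul.
Proof. by move=> x; apply/runitP/mulr1. Qed.
Lemma runit_mulVg : left_inverse runit_one runit_invg runit_mul.
Proof. by move=> x; apply/runitP/runit_Vmul. Qed.
Lemma runit_mulgV : right_inverse runit_one runit_invg runit_mul.
Proof. by move=> x; apply/runitP/runit_mulV. Qed.
HB.instance Definition _ :=
  isGroup.Build runit runit_mulA runit_mul1 runit_mulr1 runit_mulVg runit_mulgV.

Lemma runitX (x : runit) n : (x ^+ n)%g = (x : A) ^+ n :> A.
Proof. by elim: n => [|n IH] //; rewrite expgS exprS -IH. Qed.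
End UnitGroup.

(** * Generation of W by S *)

Section CoxeterGeneration.
Variables (S : Type) (W : groupType) (sg : S -> W) (m : S -> S -> nat).
Hypothesis cox : coxeter_system sg m.

Lemma cox_sg2 s : (sg s * sg s = 1)%g.
Proof.
by have := (cox_order cox s s 1).2; rewrite (cox_diag cox) expg1; apply.
Qed.

Lemma cox_sgV s : ((sg s)^-1 = sg s)%g.
Proof. by apply: (mulgI (sg s)); rewrite mulgV cox_sg2. Qed.

(** This is already closed under inverses, because every generator is an involution. *)
Definition cox_generated (w : W) : Prop := forall P : W -> Prop,
  P 1%g -> (forall s v, P v -> P (sg s * v)%g) -> P w.

Lemma cox_generated1 : cox_generated 1%g. Proof. by move=> P. Qed.
Lemma cox_generatedM v w :
  cox_generated v -> cox_generated w -> cox_generated (v * w)%g.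
Proof.
move=> vg wg P P1 PM; apply: (vg (fun v => P (v * w)%g)).
  by rewrite mul1g; exact: wg.
by move=> s u Pu; rewrite -mulgA; exact: PM.
Qed.
Lemma cox_generated_sg s : cox_generated (sg s).
Proof. by move=> P P1 PM; rewrite -[sg s]mulg1; exact: PM. Qed.
Lemma cox_generatedV w : cox_generated w -> cox_generated (w^-1)%g.
Proof.
move=> wg; apply: (wg (fun w => cox_generated (w^-1)%g)).
  by rewrite invg1; exact: cox_generated1.
move=> s v vg; rewrite invgM cox_sgV.
exact: cox_generatedM vg (cox_generated_sg s).
Qed.

Record cox_span := CoxSpan { cox_span_val :> W; _ : `[< cox_generated cox_span_val >] }.
HB.instance Definition _ := [isSub for cox_span_val].
HB.instance Definition _ := [Choice of cox_span by <:].

Let mk w (g : cox_generated w) := CoxSpan (introT (asboolP _) g).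
Let gP (x : cox_span) : cox_generated x.
Proof. by case: x => x /= /asboolP. Qed.
Let cs1 := mk cox_generated1.
Let csM x y := mk (cox_generatedM (gP x) (gP y)).
Let csV x := mk (cox_generatedV (gP x)).
Let csA : associative csM. Proof. by move=> *; apply/val_inj/mulgA. Qed.
Let cs1M : left_id cs1 csM. Proof. by move=> *; apply/val_inj/mul1g. Qed.
Let csM1 : right_id cs1 csM. Proof. by move=> *; apply/val_inj/mulg1. Qed.
Let csVM : left_inverse cs1 csV csM. Proof. by move=> *; apply/val_inj/mulVg. Qed.
Let csMV : right_inverse cs1 csV csM. Proof. by move=> *; apply/val_inj/mulgV. Qed.
HB.instance Definition _ := isGroup.Build cox_span csA cs1M csM1 csVM csMV.

(* W retracts onto the subgroup generated by S, and the composite of the       *)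
(* retraction with the inclusion fixes S, so it is the identity by the         *)
(* uniqueness in the presentation.                                             *)
Lemma cox_ind (P : W -> Prop) :
  P 1%g -> (forall s v, P v -> P (sg s * v)%g) -> forall w, P w.
Proof.
move=> P1 PM w.
have valX (x : cox_span) n : val (x ^+ n)%g = (val x ^+ n)%g.
  by elim: n => [|n IH] //; rewrite !expgS -IH.
have [||phi [[phiM phis] _]] := cox_presentation cox (f := fun s => mk (cox_generated_sg s)).
- by move=> s; apply/val_inj/cox_sg2.
- move=> s t _ _; apply/val_inj; rewrite valX /=.
  exact: (cox_order cox s t (m s t)).2 (dvdnn _).
have [||psi [_ psiU]] := cox_presentation cox (f := sg).
- exact: cox_sg2.
- by move=> s t _ _; exact: (cox_order cox s t (m s t)).2 (dvdnn _).
have e1 : psi = val \o phi.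
  by apply: psiU; split=> [v u|s] /=; rewrite ?phiM ?phis.
have e2 : psi = idfun by apply: psiU.
have <- : val (phi w) = w by have := congr1 (@^~ w) (etrans (esym e1) e2).
exact: (gP (phi w)).
Qed.
End CoxeterGeneration.

(** * Tensor products and Takeuchi products *)

Section ZmodMorphism.
Variables (U V : zmodType) (f : U -> V).
Hypothesis fz : zmod_morphism f.

Lemma zmorph0 : f 0 = 0.
Proof. by rewrite -(subrr 0) fz subrr. Qed.
Lemma zmorphD : {morph f : x y / x + y}.
Proof. by move=> x y; apply/eqP; rewrite -subr_eq -fz addrK. Qed.
Lemma zmorphN : {morph f : x / - x}.
Proof. by move=> x; rewrite -[- x]sub0r fz zmorph0 sub0r. Qed.
Lemma zmorph_sum (I : Type) (r : seq I) (F : I -> U) :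
  f (\sum_(i <- r) F i) = \sum_(i <- r) f (F i).
Proof. exact: (big_morph f zmorphD zmorph0). Qed.
End ZmodMorphism.

Lemma morphD_zmod (U V : zmodType) (f : U -> V) :
  {morph f : x y / x + y} -> zmod_morphism f.
Proof. by move=> fD x y; apply/eqP; rewrite eq_sym subr_eq -fD subrK. Qed.

Section TensorFacts.
Variables (I : Type) (M N : zmodType) (aM : I -> M -> M) (aN : I -> N -> N).

Lemma tens_ind (P : tens aM aN -> Prop) :
  P 0 -> (forall x y, P x -> P y -> P (x + y)) ->
  (forall p q, P (tpure aM aN p q)) -> forall x, P x.
Proof.
move=> P0 PD Pp x; elim/tclass_ind: x => u; rewrite tclassE.
by apply: big_ind => // -[p q] _; exact: Pp.
Qed.

Lemma tpure_zmodl n : zmod_morphism (fun p => tpure aM aN p n).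
Proof. by apply: morphD_zmod => p q; exact: tpureDl. Qed.
Lemma tpure_zmodr p : zmod_morphism (tpure aM aN p).
Proof. by apply: morphD_zmod => q r; exact: tpureDr. Qed.

Section Lift.
Variables (Z : zmodType) (f : M -> N -> Z).
Hypothesis f_bal : balanced aM aN f.
Lemma tlift_zmod : zmod_morphism (tlift f : tens aM aN -> Z).
Proof. by apply: morphD_zmod => x y; exact: tliftD. Qed.
End Lift.

Lemma tens_eq_on (Z : zmodType) (f g : tens aM aN -> Z) :
  zmod_morphism f -> zmod_morphism g ->
  (forall p q, f (tpure aM aN p q) = g (tpure aM aN p q)) -> f =1 g.
Proof.
move=> fz gz e; elim/tens_ind => [|x y ex ey|//].
  by rewrite (zmorph0 fz) (zmorph0 gz).
by rewrite (zmorphD fz) (zmorphD gz) ex ey.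
Qed.
End TensorFacts.

Lemma tmap_balanced (I J : Type) (M N M' N' : zmodType)
    (aM : I -> M -> M) (aN : I -> N -> N) (aM' : J -> M' -> M') (aN' : J -> N' -> N')
    (f : M -> M') (g : N -> N') :
  zmod_morphism f -> zmod_morphism g ->
  (forall r p q, tpure aM' aN' (f (aM r p)) (g q) = tpure aM' aN' (f p) (g (aN r q))) ->
  balanced aM aN (fun p q => tpure aM' aN' (f p) (g q)).
Proof.
move=> fz gz h; split=> [p p' q|p q q'|//].
- by rewrite (zmorphD fz) tpureDl.
- by rewrite (zmorphD gz) tpureDr.
Qed.

Section TakeuchiFacts.
Variables (k : comPzRingType) (R : comAlgType k) (A B : kalgType k).
Variables (a : R -> A) (b : R -> B).

Lemma lpureDl x x' y : lpure a b (x + x') y = lpure a b x y + lpure a b x' y.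
Proof. exact: tpureDl. Qed.
Lemma lpure0l y : lpure a b 0 y = 0.
Proof. exact: (zmorph0 (morphD_zmod (fun x x' => lpureDl x x' y))). Qed.
Lemma lpureDr x y y' : lpure a b x (y + y') = lpure a b x y + lpure a b x y'.
Proof. exact: tpureDr. Qed.
Lemma lpureNl x y : lpure a b (- x) y = - lpure a b x y.
Proof. exact: (zmorphN (tpure_zmodl _ _ y)). Qed.
Lemma lpureNr x y : lpure a b x (- y) = - lpure a b x y.
Proof. exact: (zmorphN (tpure_zmodr _ _ x)). Qed.
Lemma lpureBl x x' y : lpure a b (x - x') y = lpure a b x y - lpure a b x' y.
Proof. by rewrite lpureDl lpureNl. Qed.
Lemma lpureBr x y y' : lpure a b x (y - y') = lpure a b x y - lpure a b x y'.
Proof. by rewrite lpureDr lpureNr. Qed.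
Lemma lpure_suml (I : Type) (r : seq I) (F : I -> A) y :
  lpure a b (\sum_(i <- r) F i) y = \sum_(i <- r) lpure a b (F i) y.
Proof. exact: (zmorph_sum (tpure_zmodl _ _ y)). Qed.
Lemma lpure_sumr (I : Type) (r : seq I) (F : I -> B) x :
  lpure a b x (\sum_(i <- r) F i) = \sum_(i <- r) lpure a b x (F i).
Proof. exact: (zmorph_sum (tpure_zmodr _ _ x)). Qed.
Lemma lpureA r x y : lpure a b (a r * x) y = lpure a b x (b r * y).
Proof. exact: (tpureA (lmult a) (lmult b)). Qed.

Lemma ltens_ind (P : ltens a b -> Prop) :
  P 0 -> (forall x y, P x -> P y -> P (x + y)) ->
  (forall p q, P (lpure a b p q)) -> forall x, P x.
Proof. exact: tens_ind. Qed.

Lemma rmult_zmod g h : zmod_morphism (rmult (a := a) (b := b) g h).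
Proof. exact/morphD_zmod/rmultD. Qed.

Lemma rmultDl g g' h x : rmult (a := a) (b := b) (g + g') h x = rmult g h x + rmult g' h x.
Proof.
elim/ltens_ind: x => [|x y ex ey|p q]; first by rewrite !rmult0 addr0.
  by rewrite !rmultD ex ey addrACA.
by rewrite !rmult_pure mulrDr lpureDl.
Qed.
Lemma rmultDr g h h' x : rmult (a := a) (b := b) g (h + h') x = rmult g h x + rmult g h' x.
Proof.
elim/ltens_ind: x => [|x y ex ey|p q]; first by rewrite !rmult0 addr0.
  by rewrite !rmultD ex ey addrACA.
by rewrite !rmult_pure mulrDr lpureDr.
Qed.

Lemma tmul_zmodr (x : takeuchi a b) : zmod_morphism (tmul (x : ltens a b)).
Proof. by apply: morphD_zmod => y y'; exact/tmulDr/takeuchiP. Qed.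

Lemma takeuchi_valD (x y : takeuchi a b) :
  takeuchi_val (x + y) = takeuchi_val x + takeuchi_val y.
Proof. by []. Qed.
Lemma takeuchi_valM (x y : takeuchi a b) :
  takeuchi_val (x * y) = tmul (takeuchi_val x) (takeuchi_val y).
Proof. by []. Qed.

End TakeuchiFacts.

Section TakeuchiMap.
Variables (k : comPzRingType) (R : comAlgType k) (A B A' B' : kalgType k).
Variables (a : R -> A) (b : R -> B) (a' : R -> A') (b' : R -> B').
Variables (f : A -> A') (g : B -> B').
Hypotheses (fm : kalg_morphism f) (gm : kalg_morphism g).
Hypotheses (fa : forall r, f (a r) = a' r) (gb : forall r, g (b r) = b' r).

Let fz : zmod_morphism f. Proof. by case: fm. Qed.
Let gz : zmod_morphism g. Proof. by case: gm. Qed.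
Let fM : {morph f : x y / x * y}. Proof. by case: fm => _ []. Qed.
Let gM : {morph g : x y / x * y}. Proof. by case: gm => _ []. Qed.
Let f1 : f 1 = 1. Proof. by case: fm => _ []. Qed.
Let g1 : g 1 = 1. Proof. by case: gm => _ []. Qed.

Definition ltens_map : ltens a b -> ltens a' b' :=
  tmap (lmult a') (lmult b') f g.

Lemma ltens_map_balanced : balanced (lmult a) (lmult b)
  (fun p q => tpure (lmult a') (lmult b') (f p) (g q)).
Proof.
apply: tmap_balanced => // r p q.
rewrite /lmult fM gM fa gb; exact: lpureA.
Qed.

Lemma ltens_map_pure p q : ltens_map (lpure a b p q) = lpure a' b' (f p) (g q).
Proof. exact: (tlift_pure ltens_map_balanced). Qed.
Lemma ltens_map_zmod : zmod_morphism ltens_map.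
Proof. exact: (tlift_zmod ltens_map_balanced). Qed.

Lemma ltens_map_rmult p q x : ltens_map (rmult p q x) = rmult (f p) (g q) (ltens_map x).
Proof.
move: x; apply: (@tens_eq_on _ _ _ _ _ _ (ltens_map \o rmult p q)
  (rmult (f p) (g q) \o ltens_map)).
- by move=> x y /=; rewrite rmult_zmod ltens_map_zmod.
- by move=> x y /=; rewrite ltens_map_zmod rmult_zmod.
move=> x y; rewrite /= [rmult p q _]rmult_pure ltens_map_pure.
by rewrite [X in rmult _ _ X]ltens_map_pure rmult_pure fM gM.
Qed.

Lemma ltens_map_cond x : takeuchi_cond x -> takeuchi_cond (ltens_map x).
Proof.
by move=> xT r; rewrite -fa -gb -f1 -{1}g1 -!ltens_map_rmult xT.
Qed.

Lemma ltens_map_tmul x y : takeuchi_cond x ->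
  ltens_map (tmul x y) = tmul (ltens_map x) (ltens_map y).
Proof.
move=> xT; move: y; have xT' := ltens_map_cond xT.
apply: (@tens_eq_on _ _ _ _ _ _ (ltens_map \o tmul x)
  (tmul (ltens_map x) \o ltens_map)).
- by apply: morphD_zmod => u v /=; rewrite tmulDr // (zmorphD ltens_map_zmod).
- by apply: morphD_zmod => u v /=; rewrite (zmorphD ltens_map_zmod) tmulDr.
move=> u v /=; rewrite [tmul x _]tmul_pure // ltens_map_rmult.
by rewrite [X in tmul _ X]ltens_map_pure tmul_pure.
Qed.

Definition takeuchi_map (x : takeuchi a b) : takeuchi a' b' :=
  mk_takeuchi (ltens_map_cond (takeuchiP x)).

Lemma takeuchi_map_morphism : kalg_morphism takeuchi_map.
Proof.
case: fm => _ _ fk; split=> [x y||c]; first exact/val_inj/ltens_map_zmod.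
- split=> [|x y]; first by apply: val_inj; rewrite /= ltens_map_pure f1 g1.
  exact/val_inj/ltens_map_tmul/takeuchiP.
- by apply: val_inj; rewrite /= ltens_map_pure fk g1.
Qed.
End TakeuchiMap.

(** * Evaluation of polynomials at commuting elements of a noncommutative algebra *)

Section CommutingProducts.
Variables (A : pzRingType) (I : eqType) (g : I -> A).
Hypothesis gC : forall i j, g i * g j = g j * g i.

Lemma commuting_prod i (s : seq I) : g i * \prod_(j <- s) g j = \prod_(j <- s) g j * g i.
Proof.
elim: s => [|j s IH]; first by rewrite big_nil mulr1 mul1r.
by rewrite !big_cons mulrA gC -mulrA IH mulrA.
Qed.

Lemma commuting_prod_perm (s t : seq I) : perm_eq s t ->
  \prod_(j <- s) g j = \prod_(j <- t) g j.
Proof.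
elim: s t => [|i s IH] t st; first by rewrite perm_sym in st; move/perm_nilP: st => ->.
have it : i \in t by rewrite -(perm_mem st) mem_head.
case/splitPr: it st => t1 t2 st.
rewrite big_cons (IH (t1 ++ t2)); last first.
  by rewrite -(perm_cons i); apply: perm_trans st _; rewrite (perm_catCA t1 [:: i] t2).
by rewrite !big_cat /= big_cons mulrA commuting_prod mulrA.
Qed.
End CommutingProducts.

Lemma commuting_prod_split (A : pzRingType) (I : eqType) (g h : I -> A) (s : seq I) :
  (forall i j, h i * g j = g j * h i) ->
  \prod_(i <- s) (g i * h i) = \prod_(i <- s) g i * \prod_(i <- s) h i.
Proof.
move=> hg; have hs i t : h i * \prod_(j <- t) g j = \prod_(j <- t) g j * h i.
  elim: t => [|j t IH]; first by rewrite !big_nil mulr1 mul1r.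
  by rewrite !big_cons mulrA hg -mulrA IH mulrA.
elim: s => [|i s IH]; first by rewrite !big_nil mulr1.
by rewrite !big_cons IH !mulrA; congr (_ * _); rewrite -!mulrA hs.
Qed.

Section SymEvaluation.
Variables (K : realType) (S : choiceType).

(** Growing a polynomial by one variable at a time fits the commutation rules of nH, which are given
    for linear forms. *)
Lemma sym_ind (P : Sym K S -> Prop) :
  (forall c, P c%:A) -> (forall x y, P x -> P y -> P (x + y)) ->
  (forall s x, P x -> P (symX K s * x)) -> forall x, P x.
Proof.
move=> PC PD PX x; have P0 : P 0 by rewrite -(scale0r 1).
rewrite (monalgE x); apply: big_ind => // mu _.
rewrite sym_monomE -mulr_algl mulrC.
have PXn s n y : P y -> P (symX K s ^+ n * y).
  move=> Py; elim: n => [|n IH]; first by rewrite (expr0 (symX K s)) (mul1r y).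
  by rewrite (exprS (symX K s)) -(mulrA (symX K s)); exact: PX.
elim: (enum_fset (finsupp mu)) => [|s d IH].
  rewrite big_nil (mul1r (x@_mu)%:A); exact: PC.
rewrite big_cons -(mulrA (symX K s ^+ mu s)); exact: PXn.
Qed.

Variables (A : kalgType K) (f : S -> A).
Hypothesis fC : forall s t, f s * f t = f t * f s.

Let e (mu : {cmonom S}) : A := \prod_(s <- finsupp mu) f s ^+ mu s.

Let fXC i j p q : f i ^+ p * f j ^+ q = f j ^+ q * f i ^+ p.
Proof. by apply: commrX; apply/commr_sym/commrX; exact: fC. Qed.

Let eEw (mu : {cmonom S}) (d : {fset S}) : (finsupp mu `<=` d)%fset ->
  e mu = \prod_(s <- d) f s ^+ mu s.
Proof.
move=> le.
(* The target is noncommutative, so the factors with exponent 0 are first moved to the end, which is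
   legitimate as all factors commute. *)
have -> : \prod_(s <- d) f s ^+ mu s = \prod_(s <- [seq s <- d | s \in finsupp mu] ++
   [seq s <- d | s \notin finsupp mu]) f s ^+ mu s.
  apply: commuting_prod_perm; first by move=> i j; exact: fXC.
  by rewrite perm_sym; exact/permPl/perm_filterC.
rewrite big_cat /= [X in _ * X]big1_seq ?mulr1 => [|s]; last first.
  by rewrite mem_filter memNfinsupp => /andP[_ /andP[/eqP -> _]].
apply: commuting_prod_perm; first by move=> i j; exact: fXC.
apply: uniq_perm; rewrite ?filter_uniq ?fset_uniq // => s.
rewrite mem_filter; case: (boolP (s \in finsupp mu)) => //= hs.
by rewrite (fsubsetP le).
Qed.

Let eM (mu nu : {cmonom S}) : e (mmul mu nu) = e mu * e nu.
Proof.
rewrite (eEw (d := finsupp mu `|` finsupp nu)%fset); last by rewrite mdomD.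
rewrite (eEw (fsubsetUl (finsupp mu) (finsupp nu))).
rewrite (eEw (fsubsetUr (finsupp mu) (finsupp nu))).
rewrite -commuting_prod_split; last by move=> i j; exact: fXC.
by apply: eq_bigr => s _; rewrite cmM exprD.
Qed.

Lemma sym_eval_zmod : zmod_morphism (sym_eval f).
Proof.
apply: morphD_zmod => x y; rewrite /sym_eval.
have W (z : Sym K S) (d : {fset {cmonom S}}) : (msupp z `<=` d)%fset ->
    \sum_(mu <- msupp z) kin z@_mu * e mu = \sum_(mu <- d) kin z@_mu * e mu.
  move=> le; rewrite (big_fset_incl _ le) // => mu _ /mcoeff_outdom ->.
  by rewrite (raddf0 (kin : K -> A)) mul0r.
rewrite (W _ _ (msuppD_le x y)) (W _ _ (fsubsetUl (msupp x) (msupp y))).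
rewrite (W _ _ (fsubsetUr (msupp x) (msupp y))) -big_split /=.
by apply: eq_bigr => mu _; rewrite mcoeffD (raddfD (kin : K -> A)) mulrDl.
Qed.

Let evU c mu : sym_eval f << c *g mu >> = kin c * e mu.
Proof.
rewrite /sym_eval (big_fset_incl _ (@msuppU_le _ _ mu c)) /=; last first.
  by move=> nu _ /mcoeff_outdom ->; rewrite (raddf0 (kin : K -> A)) mul0r.
by rewrite big_seq_fset1 mcoeffUU.
Qed.

Lemma sym_eval_commuting_monoid : GRing.monoid_morphism (sym_eval f).
Proof.
split=> [|x y].
  have -> : (1 : Sym K S) = << 1 *g mone >> by apply/malgP => nu; rewrite !mcoeff1.
  by rewrite evU (rmorph1 (kin : K -> A)) mul1r /e mdom1 big_seq_fset0.
have D := zmorphD sym_eval_zmod; have Z := zmorph0 sym_eval_zmod.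
rewrite (monalgE x) mulr_suml !(big_morph _ D Z) mulr_suml; apply: eq_bigr => mu _.
rewrite (monalgE y) mulr_sumr !(big_morph _ D Z) mulr_sumr; apply: eq_bigr => nu _.
have -> : << x@_mu *g mu >> * << y@_nu *g nu >> =
    << x@_mu * y@_nu *g mmul mu nu >> :> Sym K S by exact: fgmulUU.
apply: etrans (evU (x@_mu * y@_nu) (mmul mu nu)) _.
apply: etrans (congr1 ( *%R _) (eM mu nu)) _.
apply: etrans (esym (congr2 *%R (evU x@_mu mu) (evU y@_nu nu))).
move: x@_mu y@_nu (e mu) (e nu) => c d p q.
by rewrite (rmorphM (kin : K -> A)) -!mulrA; congr (_ * _); rewrite !mulrA kinC.
Qed.

Lemma sym_eval_kin c : sym_eval f c%:A = kin c.
Proof.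
have -> : c%:A = << c *g mone >> :> Sym K S.
  have -> : (1 : Sym K S) = << mone >> by apply/malgP => nu; rewrite !mcoeff1.
  exact: (esym (malg_scaleU _ _)).
by apply: etrans (evU c mone) _; rewrite /e mdom1 big_seq_fset0 mulr1.
Qed.

Lemma sym_eval_symX s : sym_eval f (symX K s) = f s.
Proof.
by rewrite evU (rmorph1 (kin : K -> A)) mul1r /e mdomU big_seq_fset1 cmUU expr1.
Qed.
End SymEvaluation.

(** * Alternating words and dihedral groups *)

Section AlternatingWords.
Variable A : pzRingType.
Implicit Types x y : A.

Fixpoint alt n x y : A := if n is n'.+1 then x * alt n' y x else 1.

Lemma altS n x y : alt n.+1 x y = x * alt n y x. Proof. by []. Qed.

Lemma altSr n x y : alt n.+1 x y = alt n x y * (if odd n then y else x).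
Proof.
elim: n x y => [|n IH] x y; first by rewrite /= mul1r mulr1.
by rewrite altS IH mulrA -altS /=; case: (odd n).
Qed.

Lemma altD n k x y :
  alt (n + k) x y = alt n x y * (if odd n then alt k y x else alt k x y).
Proof.
elim: n x y => [|n IH] x y; first by rewrite add0n /= mul1r.
by rewrite addSn altS IH mulrA -altS /=; case: (odd n).
Qed.

Variables x y : A.
Hypotheses (x2 : x * x = 0) (y2 : y * y = 0).

Lemma alt_nill n : x * alt n.+1 x y = 0.
Proof. by rewrite altS mulrA x2 mul0r. Qed.
End AlternatingWords.

Lemma teval_alternating (K : realType) (X : Type) (A : kalgType K) (f : X -> A)
    (n : nat) (t u : term K X) :
  teval f (Defs.alternating n t u) = alt n (teval f t) (teval f u).
Proof.
elim: n t u => [|n IH] t u /=; first exact: (rmorph1 (kin : K -> A)).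
by rewrite IH.
Qed.

Section DihedralGeometry.
Variables (K : realType) (S : choiceType) (m : S -> S -> nat).
Hypothesis m_diag : forall s, m s s = 1%N.
Hypothesis m_sym : forall s t, m s t = m t s.
Hypothesis m_off : forall s t, s <> t -> m s t <> 1%N.

Local Notation V := (hstar K S).
Local Notation a s := (alpha K s).
Local Notation p l s := (cox_form m l (alpha K s)).
Local Notation r s := (@simple_reflection K S m s).
Local Notation ang s t := (@cox_angle K S m s t).

Fixpoint alt_refl n s t (l : V) : V := if n is n'.+1 then r s (alt_refl n' t s l) else l.

Lemma alt_reflSr n s t l :
  alt_refl n.+1 s t l = alt_refl n s t (r (if odd n then t else s) l).
Proof.
elim: n s t => [|n IH] s t //.
by rewrite -[LHS]/(r s (alt_refl n.+1 t s l)) IH /=; case: (odd n).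
Qed.

Lemma alt_refl_linear n s t : linear (alt_refl n s t).
Proof.
elim: n s t => [|n IH] s t c u v //=.
by rewrite IH (refl_linear m_diag).
Qed.

Lemma coroot_form s l : coroot m s l = 2 * p l s.
Proof. by rewrite /coroot (cox_form_diag K m_diag) divr1. Qed.

Lemma form_refl s t l : p (r s l) t = p l t + 2 * cos (ang s t) * p l s.
Proof.
rewrite (reflE m_diag) -scaleNr cox_formD cox_formZ cox_formUU; ring.
Qed.

Lemma form_refl_diag s l : p (r s l) s = - p l s.
Proof. by rewrite form_refl /cox_angle m_diag /= divr1 cospi; ring. Qed.

Lemma cox_angle_sym s t : ang s t = ang t s.
Proof. by rewrite /cox_angle m_sym. Qed.

Lemma coroot_refl_diag s l : coroot m s (r s l) = - coroot m s l.
Proof. by rewrite !coroot_form form_refl_diag mulrN. Qed.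

(* The pairings of (..., s, t) l with the two simple roots, in terms of the    *)
(* Chebyshev values U_n = sin (n x) / sin x at the angle x of s and t.         *)
Lemma alt_refl_form n s t l :
  let c := cos (ang s t) in let u := (chebU c n).1 in let v := (chebU c n).2 in
  let q := p l (if odd n then t else s) in let q' := p l (if odd n then s else t) in
  p (alt_refl n t s l) s = v * q + u * q' /\
  p (alt_refl n t s l) t = - (u * q + (2 * c * u - v) * q').
Proof.
elim: n s t => [|n IH] s t /=; first by split; ring.
have [] := IH t s; rewrite (cox_angle_sym t s).
case: (chebU _ n) => u v /= e1 e2; rewrite if_neg.
rewrite form_refl_diag form_refl (cox_angle_sym t s) e1 e2.
by case: (odd n) => /=; split; ring.
Qed.

(** For the angle x = pi/m_st the coefficients are sin((n + 1) x)/sin x and sin(n x)/sin x; for n <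
    m_st these are the positive roots of the dihedral group. *)
Lemma alt_refl_root n s t :
  let c := cos (ang s t) in
  alt_refl n s t (a (if odd n then t else s)) =
  (chebU c n).2 *: a s + (chebU c n).1 *: a t.
Proof.
elim: n s t => [|n IH] s t /=; first by rewrite scale1r scale0r addr0.
have := IH t s; rewrite (cox_angle_sym t s) if_neg /= => ->.
case: (chebU _ n) => u v /=.
have [_ rD rZ] := linear_parts (refl_linear (K := K) m_diag s).
rewrite rD !rZ !(reflE m_diag) (cox_form_diag K m_diag) cox_formUU (cox_angle_sym t s).
rewrite !scalerBr !scalerA -!scaleNr -addrA -!scalerDl addrC.
by congr (_ *: _ + _); ring.
Qed.

Section Pair.
Variables s t : S.
Hypotheses (st : s <> t) (mst : (0 < m s t)%N).
Let c := cos (ang s t).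
Let M := m s t.

Lemma cox_ge2 : (1 < m s t)%N.
Proof. by have := m_off st; case: (m s t) mst => [|[]]. Qed.

Let thetaE : ang s t = pi / M%:R.
Proof. by rewrite /cox_angle gtn_eqF. Qed.

Let M0 : M%:R != 0 :> K. Proof. by rewrite pnatr_eq0 -lt0n. Qed.

Let theta_gt0 : 0 < ang s t.
Proof. by rewrite thetaE divr_gt0 ?pi_gt0 // ltr0n. Qed.

Let sin_theta n : (0 < n < M)%N -> 0 < sin (n%:R * ang s t).
Proof.
case/andP=> n0 nM; apply: sin_gt0_pi; apply/andP; split.
  by rewrite mulr_gt0 // ltr0n.
by rewrite thetaE mulrA ltr_pdivrMr ?ltr0n // mulrC ltr_pM2l ?pi_gt0 // ltr_nat.
Qed.

Let sin_theta0 : 0 < sin (ang s t).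
Proof. by have := @sin_theta 1%N; rewrite mul1r; apply; exact: cox_ge2. Qed.

(** With x = pi/M the entries are sin(pi - x)/sin x and sin(pi)/sin x. *)
Lemma cheb_top : chebU c M.-1 = (1, 0).
Proof.
have [] := chebU_sin (ang s t) M.-1; rewrite -/c.
case: (chebU c _) => u v /= eu ev.
have MK : M = (M.-1 + 1)%N by rewrite addn1 (prednK mst).
have Mpi : M%:R * ang s t = pi by rewrite thetaE mulrC divfK.
congr (_, _); apply: (@mulIf _ (sin (ang s t))); rewrite ?lt0r_neq0 //.
  rewrite eu mul1r.
  have -> : M.-1%:R * ang s t = pi - ang s t.
    by rewrite -Mpi {2}MK natrD mulrDl mul1r addrK.
  by rewrite sinB sinpi cospi; ring.
by rewrite ev (prednK mst) Mpi sinpi mul0r.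
Qed.

(** For n < M - 1 the arguments n x and (n + 1) x both lie in [0, pi) and the second is positive;
    the remaining case is [cheb_top]. *)
Lemma cheb_pos n : (n < M)%N -> 0 < (chebU c n).2 + (chebU c n).1.
Proof.
move=> nM; have [] := chebU_sin (ang s t) n; rewrite -/c.
have [-> _ _|nM1] := eqVneq n M.-1; first by rewrite cheb_top /= add0r ltr01.
case: (chebU c n) => u v /= eu ev.
have n1M : (n.+1 < M)%N by rewrite ltn_neqAle nM -eqSS (prednK mst) in nM1 *; rewrite nM1.
have v0 : 0 < v.
  by rewrite -(pmulr_lgt0 _ sin_theta0) ev; apply: sin_theta.
have u0 : 0 <= u.
  rewrite -(pmulr_lge0 _ sin_theta0) eu; case: (n) nM => [|k] nM.
    by rewrite mul0r sin0.
  exact/ltW/sin_theta.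
by rewrite ltr_wpDr.
Qed.

Lemma cos_lt1 : c < 1.
Proof.
have := cos2Dsin2 (ang s t); rewrite -/c.
have : 0 < sin (ang s t) ^+ 2 by rewrite exprn_gt0.
by move: (sin (ang s t)) => x x0 e; nra.
Qed.

(** The element w' of length M - 1 carries a simple root to alpha_s, so pairing w'(l) with alpha_s
    amounts to pairing l with that simple root. This is what matches the lower terms of the
    commutation formulas for the two longest words. *)
Lemma alt_refl_form_top l :
  p (alt_refl M.-1 t s l) s = p l (if odd M.-1 then s else t).
Proof.
have [-> _] := alt_refl_form M.-1 s t l.
by rewrite -/c cheb_top mul0r add0r mul1r.
Qed.

Lemma alt_refl_root_top : alt_refl M.-1 t s (a (if odd M.-1 then s else t)) = a s.
Proof.
have := alt_refl_root M.-1 t s; rewrite (cox_angle_sym t s) /= => ->.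
by rewrite -/c cheb_top /= scale1r scale0r add0r.
Qed.

(** If w' is the element of length M - 1 with w'(alpha_x) = alpha_s for a simple root alpha_x, then
    r_s w' = w' r_x, and the two sides are the two words of length M. *)
Lemma alt_refl_braid l : alt_refl M s t l = alt_refl M t s l.
Proof.
rewrite -[M](prednK mst); rewrite [RHS]alt_reflSr.
rewrite -[LHS]/(r s (alt_refl M.-1 t s l)).
have [_ _ _] := linear_parts (alt_refl_linear M.-1 t s).
have [F0 FD FZ] := linear_parts (alt_refl_linear M.-1 t s).
rewrite !(reflE m_diag) -!scaleNr FD FZ alt_refl_root_top.
by rewrite alt_refl_form_top.
Qed.

(** It pairs with both simple roots to 1 - c > 0, hence is strictly dominant in the plane of s and
    t. *)
Definition dominant : V := a s + a t.

(** Prefixing s keeps the word reduced as long as n < M, which is the reason for positivity;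
    numerically the pairing is (1 - c)(v + u) with the Chebyshev values of [cheb_pos]. *)
Lemma dominant_form n : (n < M)%N ->
  0 < p (alt_refl n t s dominant) s.
Proof.
move=> nM; have [-> _] := alt_refl_form n s t dominant.
have ds : p dominant s = 1 - c.
  by rewrite cox_formD (cox_form_diag K m_diag) cox_formUU (cox_angle_sym t s).
have dt : p dominant t = 1 - c.
  by rewrite cox_formD (cox_form_diag K m_diag) cox_formUU addrC.
have -> : forall b : bool, p dominant (if b then t else s) = 1 - c by case.
have -> : forall b : bool, p dominant (if b then s else t) = 1 - c by case.
by rewrite -mulrDl mulr_gt0 ?cheb_pos // subr_gt0 cos_lt1.
Qed.
End Pair.
End DihedralGeometry.

(** * The symmetric algebra is a domain *)

Lemma digits_inj B n (a b : nat -> nat) :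
  (forall i, a i < B)%N -> (forall i, b i < B)%N ->
  (\sum_(0 <= i < n) a i * B ^ i = \sum_(0 <= i < n) b i * B ^ i)%N ->
  forall i, (i < n)%N -> a i = b i.
Proof.
elim: n a b => // n IH a b aB bB.
have E (c : nat -> nat) : (\sum_(0 <= i < n.+1) c i * B ^ i =
    (\sum_(0 <= i < n) c i.+1 * B ^ i) * B + c 0)%N.
  rewrite big_nat_recl // expn0 muln1 addnC big_distrl /=; congr (_ + _)%N.
  by apply: eq_bigr => i _; rewrite expnSr mulnA.
rewrite !E => e [_|i iN].
  by have := congr1 (modn^~ B) e; rewrite !modnMDl !modn_small.
apply: (IH (fun i => a i.+1) (fun i => b i.+1)) => //.
have B0 : (0 < B)%N by apply: leq_ltn_trans (aB 0%N).
by have := congr1 (divn^~ B) e; rewrite !divnMDl // !divn_small // !addn0.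
Qed.

Section SymDomain.
Variables (K : realType) (S : choiceType).

Section Specialization.
Variable wgt : S -> nat.

Definition cmonom_weight (mu : {cmonom S}) : nat :=
  (\sum_(s <- finsupp mu) mu s * wgt s)%N.

Lemma cmonom_weightEw (mu : {cmonom S}) (d : {fset S}) : (finsupp mu `<=` d)%fset ->
  cmonom_weight mu = (\sum_(s <- d) mu s * wgt s)%N.
Proof.
move=> le; rewrite /cmonom_weight (big_fset_incl _ le) // => s _.
by rewrite memNfinsupp => /eqP ->.
Qed.

Definition weight_monom (mu : {cmonom S}) : {poly K} := 'X^(cmonom_weight mu).

Lemma weight_monom_morphism : mmorphism weight_monom.
Proof.
split=> [mu nu|]; last by rewrite /weight_monom /cmonom_weight mdom1 big_seq_fset0.
rewrite /weight_monom -exprD; congr ('X^_).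
rewrite (cmonom_weightEw (d := finsupp mu `|` finsupp nu)%fset); last by rewrite mdomD.
rewrite (cmonom_weightEw (fsubsetUl (finsupp mu) (finsupp nu))).
rewrite (cmonom_weightEw (fsubsetUr (finsupp mu) (finsupp nu))) -big_split /=.
by apply: eq_bigr => s _; rewrite cmM mulnDl.
Qed.
HB.instance Definition _ :=
  monalg.isMultiplicative.Build _ _ weight_monom weight_monom_morphism.

(* X_s |-> X ^ (wgt s)                                                         *)
Definition weight_spec (f : Sym K S) : {poly K} := mmap (@polyC K) weight_monom f.

Lemma weight_specM : {morph weight_spec : f g / f * g}.
Proof. by move=> f g; rewrite /weight_spec; exact: rmorphM. Qed.

Lemma weight_spec_neq0 (f : Sym K S) : f != 0 ->
  {in msupp f &, injective cmonom_weight} -> weight_spec f != 0.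
Proof.
rewrite -msupp_eq0 => /fset0Pn [mu muf] inj.
apply/eqP => /(congr1 (fun q : {poly K} => q`_(cmonom_weight mu))).
rewrite coef0 /weight_spec /mmap coef_sum (big_fsetD1 mu) //=.
rewrite coefCM coefXn eqxx mulr1 big_seq big1 ?addr0.
  by move/eqP; rewrite mcoeff_eq0 muf.
move=> nu; rewrite in_fsetD1 => /andP[numu nuf].
rewrite coefCM coefXn; case: eqP => [e|]; last by rewrite mulr0.
by rewrite (inj _ _ muf nuf e) eqxx in numu.
Qed.
End Specialization.

(** Kronecker substitution: the weights are powers of a number B larger than all exponents that
    occur, so the base B digits of the weight of a monomial are its exponents. *)
Lemma weight_separates (d : {fset {cmonom S}}) :
  exists wgt, {in d &, injective (cmonom_weight wgt)}.
Proof.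
pose D : {fset S} := (\bigcup_(mu <- d) finsupp mu)%fset.
have leD (mu : {cmonom S}) : mu \in d -> (finsupp mu `<=` D)%fset.
  by move=> mud; apply/fsubsetP => s hs; apply/bigfcupP; exists mu; rewrite ?mud.
pose B := (\max_(mu <- d) \max_(s <- finsupp mu) mu s)%N.+1.
have ltB (mu : {cmonom S}) s : mu \in d -> (mu s < B)%N.
  move=> mud; rewrite ltnS; have [hs|] := boolP (s \in finsupp mu).
    by apply: (bigmaxn_sup_seq mu) => //; exact: (bigmaxn_sup_seq s).
  by rewrite memNfinsupp => /eqP ->.
exists (fun s => B ^ index s D)%N => mu nu mud nud.
have E (x : {cmonom S}) : x \in d -> cmonom_weight (fun s => B ^ index s D)%N x =
    (\sum_(0 <= i < size D) odflt 0 (omap x (onth D i)) * B ^ i)%N.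
  move=> xd; rewrite (cmonom_weightEw _ (leD _ xd)).
  case: (enum_fset D) (fset_uniq D) => [|s0 r] ur; first by rewrite !big_nil.
  rewrite (big_nth s0) big_nat [RHS]big_nat; apply: eq_bigr => i /andP[_ iD].
  by rewrite index_uniq // (onthE _ i) (nth_map s0).
rewrite !E // => /digits_inj H; apply/eqP/cmP => s.
have HB x : x \in d -> forall i, (odflt 0 (omap x (onth D i)) < B)%N.
  by move=> xd i; case: onth => //= s'; exact: ltB.
have [sD|sD] := boolP (s \in D).
  have := H (HB _ mud) (HB _ nud) (index s D); rewrite index_mem => /(_ sD).
  by rewrite onthE (nth_map s) ?index_mem //= nth_index.
have Z (x : {cmonom S}) : x \in d -> x s = 0%N.
  move=> xd; apply/eqP; rewrite -memNfinsupp.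
  by apply: contra sD; exact: (fsubsetP (leD _ xd)).
by rewrite !Z.
Qed.

(** A specialization to one variable that separates the monomials of f and of g keeps both nonzero,
    and one-variable polynomials form a domain. *)
Lemma sym_mulf_eq0 (f g : Sym K S) : f * g = 0 -> (f == 0) || (g == 0).
Proof.
move=> fg; have [wgt inj] := weight_separates (msupp f `|` msupp g)%fset.
apply: contraT; rewrite negb_or => /andP[f0 g0].
have := mulf_neq0 (weight_spec_neq0 (wgt := wgt) f0 _) (weight_spec_neq0 (wgt := wgt) g0 _).
rewrite -weight_specM fg /weight_spec raddf0 eqxx; apply.
- by move=> x y xf yf; apply: inj; rewrite inE ?xf ?yf.
- by move=> x y xf yf; apply: inj; rewrite inE ?xf ?yf orbT.
Qed.

Lemma sym_mulfI (f g h : Sym K S) : f != 0 -> f * g = f * h -> g = h.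
Proof.
move=> f0 e; have : f * (g - h) = 0 by rewrite mulrBr e subrr.
by move/sym_mulf_eq0; rewrite (negPf f0) subr_eq0 => /eqP.
Qed.

Lemma symX_neq0 (s : S) : symX K s != 0.
Proof. by rewrite /symX monalgU_eq0 oner_eq0. Qed.

Lemma hincl_eq0 (l : hstar K S) : hincl l = 0 -> l = 0.
Proof.
move=> e; apply/malgP => s; rewrite mcoeff0.
have := congr1 (fun f : Sym K S => f@_(ucm s)) e.
rewrite /hincl mcoeff0 raddf_sum /=.
have -> : \sum_(t <- msupp l) (l@_t *: symX K t)@_(ucm s) =
    \sum_(t <- msupp l) l@_t * (t == s)%:R.
  apply: eq_bigr => t _; rewrite mcoeffZ mcoeffU1; congr (_ * (nat_of_bool _)%:R).
  apply/eqP/eqP => [/(congr1 (fun mu : {cmonom S} => mu s))|-> //].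
  by rewrite !cmU eqxx; case: eqP.
case: (boolP (s \in msupp l)) => sl; last by rewrite mcoeff_outdom.
rewrite (big_fsetD1 s) //= eqxx mulr1 big_seq big1 ?addr0 // => t.
by rewrite !inE => /andP[/negPf -> _]; rewrite mulr0.
Qed.

End SymDomain.

(** * The nil Hecke algebra and its polynomial representation *)

Section NilHeckeFamilies.
Variables (K : realType) (S : choiceType) (m : S -> S -> nat).

(** The braid relations are kept apart in [nh_braided]: the commutation formulas derived from a
    family hold before these relations are known, and serve to prove them. *)
Record nh_family (A : kalgType K) (lam : hstar K S -> A) (d : S -> A) : Prop := {
  nhf_lin : forall c l u, lam (c *: l + u) = kin c * lam l + lam u;
  nhf_comm : forall l u, lam l * lam u = lam u * lam l;
  nhf_cross : forall s l,
    d s * lam l = lam (simple_reflection m s l) * d s + kin (coroot m s l);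
  nhf_nil : forall s, d s * d s = 0
}.

Definition nh_braided (A : kalgType K) (d : S -> A) : Prop := forall s t,
  s <> t -> (0 < m s t)%N -> alt (m s t) (d s) (d t) = alt (m s t) (d t) (d s).

Definition nh_val (A : Type) (lam : hstar K S -> A) (d : S -> A)
  (x : hstar K S + S) : A := match x with inl l => lam l | inr s => d s end.

Definition nh_lift (A : kalgType K) (lam : hstar K S -> A) (d : S -> A) :
  nilHecke K m -> A := presented_lift (nh_val lam d).

Section Lift.
Variables (A : kalgType K) (lam : hstar K S -> A) (d : S -> A).
Hypotheses (fam : nh_family lam d) (br : nh_braided d).

Lemma nh_val_rel t u : nh_rel m t u -> teval (nh_val lam d) t = teval (nh_val lam d) u.
Proof.
case=> [c l l'|l l'|s l|s|s s' ss' mss'] /=.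
- exact: (nhf_lin fam).
- exact: (nhf_comm fam).
- exact: (nhf_cross fam).
- by rewrite (nhf_nil fam) (raddf0 (kin : K -> A)).
- by rewrite !teval_alternating; exact: br.
Qed.

Lemma nh_lift_morphism : kalg_morphism (nh_lift lam d).
Proof. exact: presented_lift_morphism nh_val_rel. Qed.
Lemma nh_lift_vec l : nh_lift lam d (nh_vec m l) = lam l.
Proof. exact: (presented_lift_gen nh_val_rel (inl l)). Qed.
Lemma nh_lift_del s : nh_lift lam d (nh_del K m s) = d s.
Proof. exact: (presented_lift_gen nh_val_rel (inr s)). Qed.
End Lift.

Lemma nh_generators_family : nh_family (nh_vec m) (nh_del K m).
Proof.
pose cls := pclass (@nh_rel K S m).
have D t u : cls (Add t u) = cls t + cls u by exact: pclassD.
have M t u : cls (Mul t u) = cls t * cls u by exact: pclassM.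
have R t u : nh_rel m t u -> cls t = cls u by move=> tu; apply/pclassP/TRel.
split=> [c l u|l u|s l|s].
- by have := R _ _ (NHLin m c l u); rewrite D M.
- by have := R _ _ (NHComm m l u); rewrite !M.
- by have := R _ _ (NHCross m s l); rewrite D !M.
- by have := R _ _ (NHNil K m s); rewrite M.
Qed.

Lemma nh_generators_braided : nh_braided (nh_del K m).
Proof.
move=> s t st mst.
have E n x y : pclass (nh_rel m) (Defs.alternating n x y) =
    alt n (pclass (nh_rel m) x) (pclass (nh_rel m) y).
  by elim: n x y => //= n IH x y; rewrite pclassM IH.
rewrite -!E; apply/pclassP/TRel; exact: NHBraid.
Qed.

Section Family.
Variables (A : kalgType K) (lam : hstar K S -> A) (d : S -> A).
Hypothesis fam : nh_family lam d.

Lemma nhf_zmod : zmod_morphism lam.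
Proof.
move=> l u; rewrite addrC -scaleN1r (nhf_lin fam).
have -> : kin (-1) = -1 :> A.
  exact: etrans (raddfN (kin : K -> A) 1) (congr1 -%R (rmorph1 (kin : K -> A))).
by rewrite mulN1r addrC.
Qed.
Lemma nhfZ c l : lam (c *: l) = kin c * lam l.
Proof. by have := nhf_lin fam c l 0; rewrite (zmorph0 nhf_zmod) !addr0. Qed.


(** Moving l to the left, each letter either reflects it or is deleted at the cost of a scalar.
    Deleting an inner letter leaves a square, so only the deletions of the first and of the last
    letter remain. *)
Lemma alt_chevalley n s t l :
  alt n.+2 (d s) (d t) * lam l =
    lam (alt_refl m n.+2 s t l) * alt n.+2 (d s) (d t)
    + kin (coroot m s (alt_refl m n.+1 t s l)) * alt n.+1 (d t) (d s)
    + kin (coroot m (if odd n then s else t) l) * alt n.+1 (d s) (d t).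
Proof.
elim: n s t => [|n IH] s t.
  rewrite /= !mulr1 -mulrA (nhf_cross fam t) mulrDr mulrA (nhf_cross fam s).
  by rewrite mulrDl -!mulrA -kinC.
rewrite [alt n.+3 _ _]altS -[in LHS]mulrA IH !mulrDr !mulrA.
rewrite (nhf_cross fam s) -!kinC -!mulrA alt_nill ?(nhf_nil fam) // mulr0 addr0.
rewrite mulrDl -!mulrA -!addrA; congr (_ + _); congr (_ + _).
by rewrite /= if_neg; case: odd.
Qed.

Hypothesis m_diag : forall s, m s s = 1%N.
Hypothesis m_sym : forall s t, m s t = m t s.
Hypothesis m_off : forall s t, s <> t -> m s t <> 1%N.

(* The lower terms of the two Chevalley formulas for the longest word agree.   *)
Lemma braid_diff_lam s t l : s <> t -> (0 < m s t)%N ->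
  (alt (m s t) (d s) (d t) - alt (m s t) (d t) (d s)) * lam l =
  lam (alt_refl m (m s t) s t l) * (alt (m s t) (d s) (d t) - alt (m s t) (d t) (d s)).
Proof.
move=> st mst; have ts : t <> s by move=> e; apply: st.
have mts : (0 < m t s)%N by rewrite -m_sym.
have b := alt_refl_braid (K := K) m_diag m_sym m_off st mst l.
(* By these two identities, deleting the first letter of either word has the same coefficient as
   deleting the last letter of the other; the shorter words left over are the same as well. *)
have f1 := alt_refl_form_top (K := K) m_diag m_sym m_off st mst l.
have f2 := alt_refl_form_top (K := K) m_diag m_sym m_off ts mts l.
have := cox_ge2 m_off st mst; rewrite -(m_sym s t) in f2.
move: b f1 f2; case: (m s t) => [|[|n]] // b f1 f2 _.
rewrite [n.+2.-1]/= in f1 f2.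
rewrite mulrBl !alt_chevalley [RHS]mulrBr -b !(coroot_form m_diag) f1 f2 /= if_neg.
have cancel (Z : zmodType) (x y e f : Z) : x + e + f - (y + f + e) = x - y.
  by rewrite -(addrA x) -(addrA y) (addrC e f) opprD addrACA subrr addr0.
by case: (odd n) => /=; exact: cancel.
Qed.
End Family.

Section Induction.
Local Notation H := (nilHecke K m).
Implicit Type P : H -> Prop.

Lemma nh_ind P : (forall c, P (kin c)) -> (forall l, P (nh_vec m l)) ->
  (forall s, P (nh_del K m s)) -> (forall x y, P x -> P y -> P (x + y)) ->
  (forall x y, P x -> P y -> P (x * y)) -> forall x, P x.
Proof.
move=> Pk Pl Pd PD PM x; elim/pclass_ind: x => t.
elim: t => [c|[l|s]|t IHt u IHu|t IHt u IHu].
- exact: Pk.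
- exact: Pl.
- exact: Pd.
- by rewrite pclassD; exact: PD.
- by rewrite pclassM; exact: PM.
Qed.

(** Right multiplication suits Delta, since Delta(h g) arises from Delta(h) by right multiplications
    in the two factors; the left version below suits red. *)
Lemma nh_indr P : P 1 -> (forall x y, P x -> P y -> P (x + y)) ->
  (forall c x, P x -> P (kin c * x)) -> (forall l x, P x -> P (x * nh_vec m l)) ->
  (forall s x, P x -> P (x * nh_del K m s)) -> forall x, P x.
Proof.
move=> P1 PD Pk Pl Pd x.
suff h : forall y, P y -> P (y * x) by rewrite -[x]mul1r; exact: h.
move: x; apply: nh_ind => [c y Py|l y Py|s y Py|x y hx hy z Pz|x y hx hy z Pz].
- by rewrite -kinC; exact: Pk.
- exact: Pl.
- exact: Pd.
- by rewrite mulrDr; apply: PD; [exact: hx|exact: hy].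
- by rewrite mulrA; apply: hy; exact: hx.
Qed.

Lemma nh_indl P : P 1 -> (forall x y, P x -> P y -> P (x + y)) ->
  (forall c x, P x -> P (kin c * x)) -> (forall l x, P x -> P (nh_vec m l * x)) ->
  (forall s x, P x -> P (nh_del K m s * x)) -> forall x, P x.
Proof.
move=> P1 PD Pk Pl Pd x.
suff h : forall y, P y -> P (x * y) by rewrite -[x]mulr1; exact: h.
move: x; apply: nh_ind => [c y Py|l y Py|s y Py|x y hx hy z Pz|x y hx hy z Pz].
- exact: Pk.
- exact: Pl.
- exact: Pd.
- by rewrite mulrDl; apply: PD; [exact: hx|exact: hy].
- by rewrite -mulrA; apply: hx; exact: hy.
Qed.

End Induction.

Section Eta.
Local Notation eta := (@nh_eta K S m).

Let fam := nh_generators_family.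
Let vecC s t : nh_vec m (alpha K s) * nh_vec m (alpha K t) =
  nh_vec m (alpha K t) * nh_vec m (alpha K s).
Proof. exact: (nhf_comm fam). Qed.

Lemma nh_eta_zmod : zmod_morphism eta. Proof. exact: sym_eval_zmod. Qed.
Lemma nh_eta_monoid : GRing.monoid_morphism eta.
Proof. exact: sym_eval_commuting_monoid. Qed.
Lemma nh_etaM : {morph eta : x y / x * y}. Proof. by case: nh_eta_monoid. Qed.
Lemma nh_eta1 : eta 1 = 1. Proof. by case: nh_eta_monoid. Qed.
Lemma nh_eta_kin c : eta c%:A = kin c. Proof. exact: sym_eval_kin. Qed.
Lemma nh_etaZ c r : eta (c *: r) = kin c * eta r.
Proof. by rewrite -[c *: r](mulr_algl c r) nh_etaM nh_eta_kin. Qed.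
Lemma nh_eta_symX s : eta (symX K s) = nh_vec m (alpha K s).
Proof. exact: sym_eval_symX. Qed.

Lemma nh_eta_hincl l : eta (hincl l) = nh_vec m l.
Proof.
rewrite /hincl (zmorph_sum nh_eta_zmod) [in RHS](monalgE l) (zmorph_sum (nhf_zmod fam)).
apply: eq_bigr => s _.
rewrite nh_etaZ nh_eta_symX -(nhfZ fam); congr (nh_vec m _).
exact: (esym (malg_scaleU _ _)).
Qed.
End Eta.
End NilHeckeFamilies.

(** The twisted product rule with denominators cleared; it gives both the existence of divided
    differences of products and [demazureM]. *)
Lemma twisted_leibniz (R : comNzRingType) (x a a' da f f' df : R) :
  x * da = a - a' -> x * df = f - f' -> x * (da * f + a' * df) = a * f - a' * f'.
Proof.
move=> ea ef; transitivity ((x * da) * f + a' * (x * df)); first by ring.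
by rewrite ea ef; ring.
Qed.

Lemma mulr_linear_comb (k : pzRingType) (R : comAlgType k) (x a b f g : R) c :
  x * a = f -> x * b = g -> x * (c *: a + b) = c *: f + g.
Proof. by move=> <- <-; rewrite mulrDr scalerAr. Qed.

Local Opaque fgmul symX sym_aut hincl.

Section Demazure.
Variables (K : realType) (S : choiceType) (W : groupType) (sg : S -> W).
Variables (m : S -> S -> nat) (cox : coxeter_system sg m).
Local Notation R := (Sym K S).
Local Notation act := (geometric_action K cox).
Local Notation X s := (symX K s).

Lemma act_hincl s l : act (sg s) (hincl l) = hincl (simple_reflection m s l).
Proof.
rewrite /= sym_aut_hincl; congr hincl; exact: (geometric_rep_refl cox).
Qed.

Lemma actD w : {morph act w : x y / x + y}.
Proof. by case: (linear_parts (act_linear act w)). Qed.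
Lemma actMr w : {morph act w : x y / x * y}.
Proof. by case: (act_monoid act w). Qed.
Lemma act_alg w c : act w c%:A = c%:A.
Proof.
have [_ _ Z] := linear_parts (act_linear act w).
by rewrite Z; case: (act_monoid act w) => ->.
Qed.

Lemma hinclD : {morph @hincl K S : l u / l + u}.
Proof. by case: (linear_parts (@hincl_linear K S)). Qed.
Lemma hinclZ c (l : hstar K S) : hincl (c *: l) = c *: hincl l.
Proof. by case: (linear_parts (@hincl_linear K S)). Qed.

Lemma hincl_refl s l : hincl (simple_reflection m s l) = hincl l - coroot m s l *: X s.
Proof. by rewrite /simple_reflection hinclD -scaleNr hinclZ hincl_alpha scaleNr. Qed.

(** For a linear form the difference is a multiple of alpha_s by the definition of the reflection;
    the twisted product rule carries divisibility over to products. *)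
Lemma demazure_exists s (f : R) : exists g, X s * g = f - act (sg s) f.
Proof.
elim/sym_ind: f => [c|x y [g eg] [h eh]|t x [g eg]].
- by exists 0; rewrite act_alg subrr mulr0.
- by exists (g + h); rewrite mulrDr eg eh actD opprD addrACA.
exists ((coroot m s (alpha K t))%:A * x + act (sg s) (X t) * g).
rewrite (actMr _ (X t)); apply: twisted_leibniz; last exact: eg.
rewrite -[X t]hincl_alpha act_hincl hincl_refl opprB addrC subrK.
exact: mulr_algr.
Qed.

Definition demazure s (f : R) : R := sval (cid (demazure_exists s f)).
Lemma demazureE s f : X s * demazure s f = f - act (sg s) f.
Proof. exact: (svalP (cid (demazure_exists s f))). Qed.
Lemma demazureP s f g : X s * g = f - act (sg s) f -> g = demazure s f.
Proof. by move=> e; apply: (sym_mulfI (symX_neq0 _ s)); rewrite demazureE. Qed.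

Lemma demazureM s f g :
  demazure s (f * g) = demazure s f * g + act (sg s) f * demazure s g.
Proof.
apply/esym/demazureP; rewrite (actMr _ f).
by apply: twisted_leibniz; exact: demazureE.
Qed.

Lemma demazure_linear s : linear (demazure s).
Proof.
move=> c x y; apply/esym/demazureP.
apply: etrans (mulr_linear_comb c (demazureE s x) (demazureE s y)) _.
by rewrite (act_linear act) scalerBr opprD addrACA.
Qed.

Lemma demazure_alg s c : demazure s c%:A = 0.
Proof. by apply/esym/demazureP; rewrite act_alg subrr (mulr0 (X s)). Qed.

Lemma demazure1 s : demazure s 1 = 0.
Proof.
have [act1 _] := act_monoid act (sg s).
by apply/esym/demazureP; rewrite act1 subrr (mulr0 (X s)).
Qed.

Lemma demazure_hincl s l : demazure s (hincl l) = (coroot m s l)%:A.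
Proof.
apply/esym/demazureP; rewrite act_hincl hincl_refl opprB addrC subrK.
exact: mulr_algr.
Qed.

Lemma act_symX s : act (sg s) (X s) = - X s.
Proof.
rewrite -hincl_alpha act_hincl hincl_refl hincl_alpha.
rewrite (coroot_form (cox_diag cox)) (cox_form_diag K (cox_diag cox)).
by rewrite mulr1 scaler_nat mulr2n opprD addrA subrr sub0r.
Qed.

(** The polynomial del_s f is fixed by s: in alpha_s del_s f = f - s(f) both alpha_s and the
    right-hand side change sign under s. *)
Lemma demazure_nil s f : demazure s (demazure s f) = 0.
Proof.
apply/esym/demazureP; rewrite (mulr0 (X s)); apply/esym/eqP; rewrite subr_eq0.
apply/eqP/(sym_mulfI (symX_neq0 _ s)); rewrite demazureE.
have : act (sg s) (X s * demazure s f) = act (sg s) f - f.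
  rewrite demazureE (zmorphD (act_zmod act (sg s))) (zmorphN (act_zmod act (sg s))).
  by rewrite -(actM act) (cox_sg2 cox) (act1 act).
rewrite actMr act_symX (mulNr (X s)) => /(congr1 -%R).
by rewrite opprK opprB.
Qed.

Definition dem_lend s : lend R := Lend (demazure_linear s).
Lemma mul_linear (r : R) : linear (fun f : R => r * f).
Proof. by move=> c x y; rewrite (mulrDr r) -(scalerAr c r). Qed.
Definition mul_lend r : lend R := Lend (mul_linear r).

Lemma demazure_family : nh_family m (fun l => mul_lend (hincl l)) dem_lend.
Proof.
split=> [c l u|l u|s l|s]; apply: lendP => f.
- rewrite /= (hincl_linear c l u) (mulrDl (c *: hincl l)); congr (_ + _).
  exact: (esym (scalerAl c (hincl l) f)).
- exact: mulrCA.
- apply: etrans (demazureM s (hincl l) f) _.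
  rewrite act_hincl demazure_hincl addrC; apply: (congr1 ( +%R _)).
  exact: mulr_algl.
- exact: demazure_nil.
Qed.

(** The difference E of the two words satisfies E l = w(l) E, so it vanishes on R once it kills the
    constants; each word ends in a Demazure operator, and these kill constants. *)
Lemma demazure_braided : nh_braided m dem_lend.
Proof.
move=> s t st mst; apply/eqP; rewrite -subr_eq0; apply/eqP/lendP.
set E := _ - _ : lend R.
have ME := braid_diff_lam demazure_family (cox_diag cox) (cox_sym cox)
  (cox_off_diag cox) _ st mst.
have [E0 ED EZ] := lend_parts E.
elim/sym_ind => [c|x y ex ey|u x ex].
- rewrite EZ.
  have alt1 n x y : alt n.+1 (dem_lend x) (dem_lend y) (1 : R) = 0.
    rewrite altSr /= -[1]scale1r.
    have [Z _ _] := lend_parts (alt n (dem_lend x) (dem_lend y)).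
    by case: odd; rewrite /= demazure_alg Z.
  by rewrite /E -(prednK mst) lendDE lendNE !alt1 subrr scaler0.
- by rewrite ED ex ey addr0.
have e : E (hincl (alpha K u) * x) = hincl (alt_refl m (m s t) s t (alpha K u)) * E x.
  by have e := congr1 (fun F : lend R => F x) (ME (alpha K u)); exact: e.
by move: e; rewrite hincl_alpha ex (mulr0 (hincl _)).
Qed.

Definition nh_rho (h : nilHecke K m) (f : R) : R :=
  nh_lift (fun l => mul_lend (hincl l)) dem_lend h f.

Let rho_morph := nh_lift_morphism demazure_family demazure_braided.

Lemma nh_rho_vec l f : nh_rho (nh_vec m l) f = hincl l * f.
Proof. by rewrite /nh_rho (nh_lift_vec demazure_family demazure_braided). Qed.
Lemma nh_rho_del s f : nh_rho (nh_del K m s) f = demazure s f.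
Proof. by rewrite /nh_rho (nh_lift_del demazure_family demazure_braided). Qed.
Lemma nh_rho_linear h : linear (nh_rho h). Proof. exact: lend_linear. Qed.
Lemma nh_rhoD h h' f : nh_rho (h + h') f = nh_rho h f + nh_rho h' f.
Proof. by case: rho_morph => rz _ _; rewrite /nh_rho (zmorphD rz). Qed.
Lemma nh_rho_zmod f : zmod_morphism (nh_rho^~ f).
Proof. by apply: morphD_zmod => x y; exact: nh_rhoD. Qed.
Lemma nh_rhoM h h' f : nh_rho (h * h') f = nh_rho h (nh_rho h' f).
Proof. by case: rho_morph => _ [_ rM] _; rewrite /nh_rho rM. Qed.
Lemma nh_rho1 f : nh_rho 1 f = f.
Proof. by case: rho_morph => _ [r1 _] _; rewrite /nh_rho r1. Qed.
Lemma nh_rho_kin c f : nh_rho (kin c) f = c *: f.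
Proof. by case: rho_morph => _ _ rk; rewrite /nh_rho rk. Qed.
Lemma nh_rho_eta r f : nh_rho (nh_eta m r) f = r * f.
Proof.
elim/sym_ind: r f => [c|x y ex ey|s x ex] f.
- by rewrite nh_eta_kin nh_rho_kin; exact: (esym (mulr_algl c f)).
- by rewrite (zmorphD (nh_eta_zmod m)) nh_rhoD ex ey -(mulrDl x).
- rewrite nh_etaM nh_eta_symX nh_rhoM nh_rho_vec ex hincl_alpha; exact: mulrA.
Qed.

Lemma nh_rho_representation : is_representation nh_rho.
Proof. exact: (lend_representation rho_morph). Qed.

Lemma nh_rho_is_rep : is_nh_representation cox nh_rho.
Proof.
split; [exact: nh_rho_representation| |exact: nh_rho_vec|].
- move=> h f g fW; move: h g; apply: nh_ind => [c|l|s|x y hx hy|x y hx hy] g.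
  + by rewrite !nh_rho_kin; exact: scalerAr.
  + by rewrite !nh_rho_vec; exact: mulrCA.
  + rewrite !nh_rho_del; apply/esym/demazureP.
    rewrite (actMr _ f) fW -(mulrBr f) -demazureE; exact: mulrCA.
  + by rewrite !nh_rhoD hx hy -(mulrDr f).
  + by rewrite !nh_rhoM hy hx.
- by move=> s f; rewrite nh_rho_del hincl_alpha demazureE.
Qed.

Lemma nh_eta_inj : injective (@nh_eta K S m).
Proof.
by move=> r r' /(congr1 (nh_rho^~ 1)); rewrite !nh_rho_eta !(mulr1 (_ : R)).
Qed.

Lemma nh_rho_rfl s f : nh_rho (nh_refl K m s) f = act (sg s) f.
Proof.
rewrite /nh_refl nh_rhoD nh_rho1 (zmorphN (nh_rho_zmod f)) nh_rhoM nh_rho_vec.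
by rewrite nh_rho_del hincl_alpha demazureE opprB addrC subrK.
Qed.
End Demazure.

(** * Independence of the alternating words *)

Lemma scaler_comb (k : pzRingType) (V : lmodType k) (a b c d : k) (v : V) :
  (a * b + c * d) *: v = a *: (b *: v) + c *: (d *: v).
Proof. by rewrite !scalerA -scalerDl. Qed.

Section DihedralWords.
Variables (K : realType) (S : choiceType) (W : groupType) (sg : S -> W).
Variables (m : S -> S -> nat) (cox : coxeter_system sg m).
Local Notation R := (Sym K S).
Local Notation H := (nilHecke K m).
Local Notation eta := (@nh_eta K S m).
Local Notation rho := (@nh_rho K S W sg m cox).
Local Notation del := (nh_del K m).
Local Notation vec := (nh_vec m).
Let fam := nh_generators_family K m.

Lemma nh_del_nil x : del x * del x = 0. Proof. exact: (nhf_nil fam). Qed.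

Lemma rho_chevalley n (x y : S) l f :
  rho (alt n.+2 (del x) (del y)) (hincl l * f) =
    hincl (alt_refl m n.+2 x y l) * rho (alt n.+2 (del x) (del y)) f
    + coroot m x (alt_refl m n.+1 y x l) *: rho (alt n.+1 (del y) (del x)) f
    + coroot m (if odd n then x else y) l *: rho (alt n.+1 (del x) (del y)) f.
Proof.
have vM l' h : rho (vec l' * h) f = hincl l' * rho h f.
  exact: etrans (nh_rhoM cox _ _ _) (nh_rho_vec cox _ _).
have kM c h : rho (kin c * h) f = c *: rho h f.
  exact: etrans (nh_rhoM cox _ _ _) (nh_rho_kin cox _ _).
have e : rho (alt n.+2 (del x) (del y) * vec l) f =
    rho (alt n.+2 (del x) (del y)) (hincl l * f).
  apply: etrans (nh_rhoM cox _ _ _) _; exact: (congr1 (rho _) (nh_rho_vec cox _ _)).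
by rewrite -e (alt_chevalley fam) 2!nh_rhoD vM 2!kM.
Qed.

(** Every letter lowers the degree by one; the commutation formula turns this into an induction on
    the exponent. *)
Lemma rho_alt_vanish (x y : S) l k n : (n < k)%N ->
  rho (alt k (del x) (del y)) (hincl l ^+ n) = 0.
Proof.
have rho0 f : rho 0 f = 0 by exact: (zmorph0 (nh_rho_zmod cox f)).
have rhoz h : rho h 0 = 0 by case: (linear_parts (nh_rho_linear cox h)).
elim: n k x y => [|n IH] [|k] // x y nk.
  rewrite altSr nh_rhoM.
  have -> : rho (if odd k then del y else del x) (hincl l ^+ 0) = 0.
    rewrite expr0 -[1](scale1r (1 : R)).
    by case: odd; rewrite nh_rho_del demazure_alg.
  exact: rhoz.
case: k nk => // k nk.
have nk1 : (n < k.+1)%N by []; have nk2 : (n < k.+2)%N by exact: ltnW.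
rewrite exprS rho_chevalley (IH k.+2 _ _ nk2) !(IH k.+1 _ _ nk1).
by rewrite !scaler0 !addr0; exact: mulr0.
Qed.

(** Split off one factor of the power: the term with the full word vanishes for degree reasons, and
    the coefficients of the two shorter words are positive by [dominant_form]. Hence no cancellation
    can occur. *)
Lemma rho_alt_dominant (x y : S) n : x <> y -> (0 < m x y)%N -> (n <= m x y)%N ->
  exists2 c : K, 0 < c &
    rho (alt n (del x) (del y)) (hincl (dominant K x y) ^+ n) = c%:A.
Proof.
have dC (a b : S) : dominant K a b = dominant K b a by exact: addrC.
have pos a b n' : a <> b -> (0 < m a b)%N -> (n' < m a b)%N ->
    0 < coroot m a (alt_refl m n' b a (dominant K a b)).
  move=> ab mab nm; rewrite (coroot_form (cox_diag cox)) mulr_gt0 ?ltr0n //.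
  exact: (dominant_form K (cox_diag cox) (cox_sym cox) (cox_off_diag cox)).
elim: n x y => [|n IH] x y xy mxy nm.
  by exists 1; [exact: ltr01|rewrite expr0 nh_rho1 scale1r].
have yx : y <> x by move=> e; apply: xy.
have myx : (0 < m y x)%N by rewrite -(cox_sym cox).
have [c1 c10 e1] := IH x y xy mxy (ltnW nm).
have nm' : (n <= m y x)%N by rewrite -(cox_sym cox) ltnW.
have [c2 c20 e2] := IH y x yx myx nm'.
have p0 b : 0 < coroot m (if b then x else y) (dominant K x y).
  case: b; first exact: (pos x y 0%N).
  by rewrite dC; exact: (pos y x 0%N).
case: n nm e1 e2 {IH nm'} => [|n] nm e1 e2.
  exists (coroot m x (dominant K x y)); first exact: (p0 true).
  rewrite altS (mulr1 (del x)) expr1.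
  exact: etrans (nh_rho_del cox _ _) (demazure_hincl cox _ _).
exists (coroot m x (alt_refl m n.+1 y x (dominant K x y)) * c2 +
        coroot m (if odd n then x else y) (dominant K x y) * c1).
  by apply: addr_gt0; apply: mulr_gt0; rewrite ?pos.
rewrite (dC y x) in e2.
have z := @rho_alt_vanish x y (dominant K x y) n.+2 n.+1 (ltnSn _).
rewrite (exprS (hincl _) n.+1) rho_chevalley z e1 e2 (mulr0 (hincl _)) add0r.
exact: (esym (scaler_comb _ _ _ _ _)).
Qed.

Section Pair.
Variables s t : S.
Hypotheses (st : s <> t) (mst : (0 < m s t)%N).
Local Notation M := (m s t).

Let d (b : bool) : H := if b then del s else del t.
Let d2 b : d b * d b = 0. Proof. by case: b; exact: nh_del_nil. Qed.

Definition dword (b : bool) k : H := alt k (d b) (d (~~ b)).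

Lemma dword_top b : dword b M = dword true M.
Proof. by case: b => //; apply/esym; exact: nh_generators_braided. Qed.

(** The braid relation rewrites the M letters after the first one so that they begin with that same
    letter, and a square appears. *)
Lemma dword_gt b k : (M < k)%N -> dword b k = 0.
Proof.
move=> Mk; have z : dword b M.+1 = 0.
  rewrite /dword altS -[alt _ _ _]/(alt M (d (~~ b)) (d b)).
  have -> : alt M (d (~~ b)) (d b) = alt M (d b) (d (~~ b)).
    have := dword_top b; rewrite -(dword_top (~~ b)) /dword negbK => ->.
    by [].
  by rewrite -(prednK mst) alt_nill.
by rewrite /dword -(subnKC Mk) altD -/(dword b M.+1) z mul0r.
Qed.

Lemma dword_mul b b' k j : (0 < k)%N -> (0 < j)%N ->
  dword b k * dword b' j = if b' == b (+) odd k then dword b (k + j) else 0.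
Proof.
case: k j => [|k] [|j] // _ _.
case: eqP => [->|nb].
  rewrite /dword altD addbC /=; case: (odd k) => /=; rewrite ?negbK //.
rewrite {1}/dword altSr /dword altS -mulrA (mulrA _ (d b')).
have -> : (if odd k then d (~~ b) else d b) = d b'.
  by move: nb; rewrite /=; case: (odd k); case: b; case: b'.
by rewrite d2 mul0r mulr0.
Qed.

(** One index per element of the dihedral group: [true] takes care of the lengths 0, ..., M - 1 and
    [false] of the lengths 1, ..., M, so the empty word and the longest word are each counted
    once. *)
Definition didx : finType := (bool * 'I_M)%type.
Definition dlen (i : didx) : nat := i.2 + ~~ i.1.
Definition dbasis (i : didx) : H := dword i.1 (dlen i).

Lemma dlen_le i : (dlen i <= M)%N.
Proof. by case: i => -[] n; rewrite /dlen /= ?addn0 ?addn1 // ltnW. Qed.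

Lemma dlen_inj i j : i != j -> dlen i = dlen j ->
  [/\ (0 < dlen i)%N, (dlen i < M)%N & i.1 = ~~ j.1].
Proof.
case: i j => -[] [n nM] [[] [k kM]] /eqP ne; rewrite /dlen /= ?addn0 ?addn1 => e.
- by case: ne; congr (_, _); apply: val_inj.
- by rewrite e ltnS leq0n -e.
- by split=> //; rewrite e.
- by case: ne; congr (_, _); apply: val_inj; case: e.
Qed.

(** The continuation of the word i to the longest word; its first letter is the one that alternation
    prescribes after the word i. *)
Definition dcompl (i : didx) : H := dword (i.1 (+) odd (dlen i)) (M - dlen i).

Lemma dbasis_compl i : dbasis i * dcompl i = dword true M.
Proof.
rewrite /dbasis /dcompl; have := dlen_le i; case: (dlen i) => [_|k kM].
  by rewrite /= mul1r subn0 dword_top.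
have [->|kM'] := eqVneq k.+1 M; first by rewrite subnn [X in _ * X]/= mulr1 dword_top.
rewrite dword_mul ?eqxx ?subn_gt0 1?ltn_neqAle ?kM' //.
by rewrite subnKC // dword_top.
Qed.

(** At equal lengths the words start with different letters, so a letter is repeated where the
    factors meet; otherwise the product is either such a repetition or longer than M. *)
Lemma dbasis_compl0 i j : j != i -> (dlen i <= dlen j)%N -> dbasis j * dcompl i = 0.
Proof.
move=> ji; rewrite leq_eqVlt => /orP[/eqP e|lt].
  have [j0 jM jb] := dlen_inj ji (esym e).
  rewrite /dbasis /dcompl e dword_mul ?subn_gt0 // jb.
  by case: eqP => //; case: (i.1); case: (odd _).
rewrite /dbasis /dcompl dword_mul; first last.
- by rewrite subn_gt0; apply: leq_trans lt (dlen_le j).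
- exact: leq_trans lt.
case: eqP => // _; apply: dword_gt.
by rewrite -{1}(subnKC (dlen_le i)) ltn_add2r.
Qed.

(** Induction on the length of the word i, testing on the polynomial obtained by applying the
    completing word to the M-th power of the dominant vector. Shorter words already have coefficient
    0, all other words but i itself give 0, and i gives a positive constant. *)
Lemma dbasis_indep (r : didx -> R) :
  (forall f, \sum_i r i * rho (dbasis i) f = 0) -> forall i, r i = 0.
Proof.
move=> r0; have [c c0 ec] := rho_alt_dominant st mst (leqnn M).
suff h n : forall i, dlen i = n -> r i = 0 by move=> i; exact: (h _ i erefl).
elim/ltn_ind: n => n IH i en.
have := r0 (rho (dcompl i) (hincl (dominant K s t) ^+ M)).
rewrite (bigD1 i) //= -nh_rhoM dbasis_compl ec big1 => [|j ji].
  rewrite addr0 => /sym_mulf_eq0 /orP[/eqP //|].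
  by rewrite scaler_eq0 oner_eq0 orbF gt_eqF.
rewrite -nh_rhoM; have [lt|le] := ltnP (dlen j) (dlen i).
  by rewrite (IH (dlen j)) -?en // mul0r.
by rewrite dbasis_compl0 // (zmorph0 (nh_rho_zmod cox _)) mulr0.
Qed.

Definition dspan (z : H) : Prop := exists r : didx -> R, z = \sum_i eta (r i) * dbasis i.

Lemma dspan0 : dspan 0.
Proof.
exists (fun _ => 0); rewrite big1 // => i _.
by rewrite (zmorph0 (nh_eta_zmod m)) mul0r.
Qed.

Lemma dspanD z z' : dspan z -> dspan z' -> dspan (z + z').
Proof.
case=> r -> [r' ->]; exists (fun i => r i + r' i); rewrite -big_split /=.
by apply: eq_bigr => i _; rewrite (zmorphD (nh_eta_zmod m)) mulrDl.
Qed.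

Lemma dspan_eta q z : dspan z -> dspan (eta q * z).
Proof.
case=> r ->; exists (fun i => q * r i); rewrite mulr_sumr.
by apply: eq_bigr => i _; rewrite nh_etaM mulrA.
Qed.

Lemma dspan_kin c z : dspan z -> dspan (kin c * z).
Proof. by rewrite -nh_eta_kin; exact: dspan_eta. Qed.

Lemma dspan_vec l z : dspan z -> dspan (vec l * z).
Proof. by rewrite -nh_eta_hincl; exact: dspan_eta. Qed.

Lemma dspanN z : dspan z -> dspan (- z).
Proof.
move=> zd; rewrite -mulN1r -nh_eta1 -(zmorphN (nh_eta_zmod m)).
exact: dspan_eta.
Qed.

Lemma dspan_basis i : dspan (dbasis i).
Proof.
exists (fun j => (i == j)%:R); rewrite (bigD1 i) //= eqxx nh_eta1 mul1r big1 ?addr0 //.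
by move=> j ji; rewrite eq_sym (negPf ji) (zmorph0 (nh_eta_zmod m)) mul0r.
Qed.

Lemma dspan_word b k : dspan (dword b k).
Proof.
have [kM|kM|->] := ltngtP k M; last first.
- have MM : (M.-1 < M)%N by rewrite prednK.
  rewrite dword_top -(dword_top false); have := dspan_basis (false, Ordinal MM).
  by rewrite /dbasis /dlen /= addn1 prednK.
- rewrite dword_gt //; exact: dspan0.
case: b; first by have := dspan_basis (true, Ordinal kM); rewrite /dbasis /dlen /= addn0.
case: k kM => [|k] kM; first by have := dspan_basis (true, Ordinal kM).
by have := dspan_basis (false, Ordinal (ltnW kM)); rewrite /dbasis /dlen /= addn1.
Qed.

Definition dspan_stable (g : H) : Prop := forall z, dspan z -> dspan (z * g).

Lemma dspan_stable_words g : (forall b k, dspan (dword b k * g)) -> dspan_stable g.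
Proof.
move=> hg z [r ->]; rewrite mulr_suml; apply: big_ind => [||i _].
- exact: dspan0.
- exact: dspanD.
by rewrite -mulrA; apply/dspan_eta/hg.
Qed.

Lemma dspan_stable1 : dspan_stable 1.
Proof. by move=> z; rewrite mulr1. Qed.

Lemma dspan_stable_del b : dspan_stable (d b).
Proof.
apply: dspan_stable_words => b' [|k].
  by rewrite mul1r; have := dspan_word b 1; rewrite /dword /= mulr1.
have := @dword_mul b' b k.+1 1 isT isT; rewrite {2}/dword /= mulr1 => ->.
by case: eqP => _; [exact: dspan_word|exact: dspan0].
Qed.

(** The commutation formula moves l to the left and produces only further words. *)
Lemma dspan_stable_vec l : dspan_stable (vec l).
Proof.
have E b : exists x y, d b = del x /\ d (~~ b) = del y.
  by case: b; [exists s, t|exists t, s].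
apply: dspan_stable_words => b k; have [x [y [ex ey]]] := E b.
case: k => [|[|k]].
- by rewrite mul1r -[vec l]mulr1; apply/dspan_vec/(dspan_word true 0).
- rewrite /dword /= mulr1 ex (nhf_cross fam) -ex; apply: dspanD.
    by apply: dspan_vec; have := dspan_word b 1; rewrite /dword /= mulr1.
  by rewrite -[kin _]mulr1; apply/dspan_kin/(dspan_word true 0).
- rewrite /dword ex ey (alt_chevalley fam) -ex -ey.
  do 2?[apply: dspanD]; first exact/dspan_vec/(dspan_word b k.+2).
    by apply: dspan_kin; have := dspan_word (~~ b) k.+1; rewrite /dword negbK.
  exact/dspan_kin/(dspan_word b k.+1).
Qed.

Lemma dspan_stableM g h : dspan_stable g -> dspan_stable h -> dspan_stable (g * h).
Proof. by move=> gs hs z zd; rewrite mulrA; apply/hs/gs. Qed.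
Lemma dspan_stableB g h : dspan_stable g -> dspan_stable h -> dspan_stable (g - h).
Proof.
move=> gs hs z zd; rewrite mulrBr; apply: dspanD; first exact: gs.
exact/dspanN/hs.
Qed.

Lemma dspan_stable_del_s : dspan_stable (del s).
Proof. exact: (dspan_stable_del true). Qed.
Lemma dspan_stable_del_t : dspan_stable (del t).
Proof. exact: (dspan_stable_del false). Qed.
Lemma dspan_stable_rfl_s : dspan_stable (nh_refl K m s).
Proof.
apply: dspan_stableB; first exact: dspan_stable1.
exact: dspan_stableM (dspan_stable_vec _) dspan_stable_del_s.
Qed.
Lemma dspan_stable_rfl_t : dspan_stable (nh_refl K m t).
Proof.
apply: dspan_stableB; first exact: dspan_stable1.
exact: dspan_stableM (dspan_stable_vec _) dspan_stable_del_t.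
Qed.

(** By independence of the words, relations between elements built from s and t may be verified on
    polynomials. *)
Lemma dspan_detect z : dspan z -> (forall f, rho z f = 0) -> z = 0.
Proof.
case=> r -> h.
have r0 : forall i, r i = 0.
  apply: dbasis_indep => f; rewrite -[RHS](h f) (zmorph_sum (nh_rho_zmod cox f)).
  by apply: eq_bigr => i _; rewrite nh_rhoM nh_rho_eta.
by apply: big1 => i _; rewrite r0 (zmorph0 (nh_eta_zmod m)) mul0r.
Qed.
End Pair.
End DihedralWords.

(** * The comultiplication *)

Section TakeuchiSym.
Variables (K : realType) (S : choiceType) (A B : kalgType K).
Variables (a : Sym K S -> A) (b : Sym K S -> B).
Hypotheses (az : zmod_morphism a) (aM : {morph a : x y / x * y}).
Hypotheses (bz : zmod_morphism b) (bM : {morph b : x y / x * y}).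
Hypotheses (ak : forall c, a c%:A = kin c) (bk : forall c, b c%:A = kin c).

(** The set of r for which the condition holds is a subalgebra, R being commutative, so the
    variables suffice. *)
Lemma takeuchi_cond_sym (x : ltens a b) :
  (forall s, rmult (a (symX K s)) 1 x = rmult 1 (b (symX K s)) x) -> takeuchi_cond x.
Proof.
move=> h; elim/sym_ind => [c|r q er eq|s r er].
- rewrite ak bk; elim/ltens_ind: x {h} => [|x y ex ey|p q]; first by rewrite !rmult0.
    by rewrite !rmultD ex ey.
  by rewrite !rmult_pure !mulr1 -!kinC -{1}ak -bk lpureA.
- by rewrite (zmorphD az) (zmorphD bz) rmultDl rmultDr er eq.
rewrite -[1 in LHS]mulr1 aM -rmult_comp h rmult_comp mulr1 mul1r.
have -> : rmult (a r) (b (symX K s)) x = rmult 1 (b (symX K s)) (rmult (a r) 1 x).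
  by rewrite rmult_comp mulr1 mul1r.
by rewrite er rmult_comp mulr1 -bM (mulrC r).
Qed.

Hypothesis (a1 : a 1 = 1).
Lemma takeuchi_cond_eta q : takeuchi_cond (lpure a b (a q) 1).
Proof.
move=> r; rewrite !rmult_pure !mulr1 mul1r -aM (mulrC q r) aM lpureA.
by rewrite mulr1.
Qed.
End TakeuchiSym.

Section Comultiplication.
Variables (K : realType) (S : choiceType) (W : groupType) (sg : S -> W).
Variables (m : S -> S -> nat) (cox : coxeter_system sg m).
Local Notation R := (Sym K S).
Local Notation H := (nilHecke K m).
Local Notation eta := (@nh_eta K S m).
Local Notation rho := (@nh_rho K S W sg m cox).
Local Notation del := (nh_del K m).
Local Notation vec := (@nh_vec K S m).
Local Notation rfl := (nh_refl K m).
Local Notation T := (takeuchi_lr eta).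
Local Notation lp := (lpure eta eta).
Let fam := nh_generators_family K m.
Let etaz := @nh_eta_zmod K S m.
Let etaM := @nh_etaM K S m.
Let etak := @nh_eta_kin K S m.

Lemma nh_vecC l u : vec l * vec u = vec u * vec l.
Proof. exact: (nhf_comm fam). Qed.
Lemma nh_del_vec s l : del s * vec l =
  vec (simple_reflection m s l) * del s + kin (coroot m s l).
Proof. exact: (nhf_cross fam). Qed.

Lemma nh_vec_refl s l :
  vec (simple_reflection m s l) = vec l - kin (coroot m s l) * vec (alpha K s).
Proof. by rewrite /simple_reflection (nhf_zmod fam) (nhfZ fam). Qed.

Lemma coroot_alpha s : coroot m s (alpha K s) = 2.
Proof.
by rewrite (coroot_form (cox_diag cox)) (cox_form_diag K (cox_diag cox)) mulr1.
Qed.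

Lemma nh_del_alpha s : del s * vec (alpha K s) = 2%:R - vec (alpha K s) * del s.
Proof.
rewrite nh_del_vec nh_vec_refl coroot_alpha.
have -> : kin 2 = 2%:R :> H by exact: (rmorph_nat (kin : K -> H)).
have -> x : x - 2%:R * x = - x :> H.
  by rewrite mulr_natl mulr2n opprD addrA subrr sub0r.
by rewrite mulNr addrC.
Qed.

Lemma nh_del_rfl s : del s * rfl s = - del s.
Proof.
rewrite /nh_refl mulrBr mulr1 mulrA nh_del_alpha mulrBl -mulrA nh_del_nil mulr0 subr0.
by rewrite mulr_natl mulr2n opprD addrA subrr sub0r.
Qed.

Lemma nh_rfl_del s : rfl s * del s = del s.
Proof. by rewrite /nh_refl mulrBl mul1r -mulrA nh_del_nil mulr0 subr0. Qed.

Lemma nh_rfl2 s : rfl s * rfl s = 1.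
Proof.
rewrite {1}/nh_refl mulrBl mul1r -mulrA nh_del_rfl mulrN opprK.
by rewrite /nh_refl subrK.
Qed.

Lemma nh_cross_aux s l :
  kin (coroot m s l) * rfl s + vec l * del s =
  vec (simple_reflection m s l) * del s + kin (coroot m s l).
Proof.
rewrite /nh_refl mulrBr mulr1 nh_vec_refl mulrBl -mulrA -addrA addrC.
by rewrite [X in X + _]addrC.
Qed.

Lemma nh_rfl_vec s l : rfl s * vec l = vec (simple_reflection m s l) * rfl s.
Proof.
rewrite /nh_refl mulrBl mul1r mulrBr mulr1 -mulrA nh_del_vec mulrDr -kinC.
rewrite !mulrA (nh_vecC (alpha K s)) nh_vec_refl.
by rewrite opprD addrA addrAC.
Qed.

Lemma lp_vec l x y : lp (vec l * x) y = lp x (vec l * y).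
Proof. by rewrite -nh_eta_hincl; exact: lpureA. Qed.
Lemma lp_kin c x y : lp (kin c * x) y = lp x (kin c * y).
Proof. by rewrite -nh_eta_kin; exact: lpureA. Qed.

Definition delta_del s : ltens eta eta := lp (del s) (rfl s) + lp 1 (del s).

Lemma delta_del_flip s : delta_del s = lp (del s) 1 + lp (rfl s) (del s).
Proof.
by rewrite /delta_del /nh_refl lpureBr lpureBl lp_vec addrAC addrA.
Qed.

Lemma delta_del_aux s l :
  lp 1 (kin (coroot m s l) * rfl s) + lp 1 (vec l * del s) =
  lp 1 (vec (simple_reflection m s l) * del s) + lp 1 (kin (coroot m s l)).
Proof. by rewrite -!lpureDr nh_cross_aux. Qed.

Lemma rmult_delta_del s l : rmult (vec l) 1 (delta_del s) =
  lp (del s) (vec (simple_reflection m s l) * rfl s)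
  + (lp 1 (vec (simple_reflection m s l) * del s) + lp 1 (kin (coroot m s l))).
Proof.
rewrite rmultD !rmult_pure !mulr1 mul1r nh_del_vec lpureDl lp_vec -addrA.
rewrite -delta_del_aux -lp_kin mulr1; congr (_ + (_ + _)).
by rewrite -lp_vec mulr1.
Qed.

Lemma delta_del_cond s : takeuchi_cond (delta_del s).
Proof.
apply: (takeuchi_cond_sym etaz etaM etaz etaM etak etak) => t.
rewrite nh_eta_symX rmult_delta_del rmultD !rmult_pure !mulr1 nh_rfl_vec nh_del_vec.
by rewrite lpureDr.
Qed.

(* The following two constants are opaque, which keeps unification away from   *)
(* the polynomials inside them.                                                *)
Lemma delta_vec_sig l : {x : T | takeuchi_val x = lp (vec l) 1}.
Proof.
exists (mk_takeuchi (@takeuchi_cond_eta _ _ _ _ eta eta etaM (hincl l))).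
exact: (congr1 (lp^~ 1) (nh_eta_hincl m l)).
Qed.
Definition delta_vec l : T := sval (delta_vec_sig l).
Lemma delta_vecE l : takeuchi_val (delta_vec l) = lp (vec l) 1.
Proof. exact: (svalP (delta_vec_sig l)). Qed.

Lemma delta_gen_sig s : {x : T | takeuchi_val x = delta_del s}.
Proof. by exists (mk_takeuchi (delta_del_cond s)). Qed.
Definition delta_gen s : T := sval (delta_gen_sig s).
Lemma delta_genE s : takeuchi_val (delta_gen s) = lp (del s) (rfl s) + lp 1 (del s).
Proof. exact: (svalP (delta_gen_sig s)). Qed.

Lemma tmul_delta_del (x : T) s :
  takeuchi_val (x * delta_gen s) =
  rmult (del s) (rfl s) (takeuchi_val x) + rmult 1 (del s) (takeuchi_val x).
Proof.
rewrite takeuchi_valM delta_genE (tmulDr _ _ (takeuchiP x)).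
by rewrite !(tmul_pure _ _ (takeuchiP x)).
Qed.

Lemma tmul_delta_vec (x : T) l :
  takeuchi_val (x * delta_vec l) = rmult (vec l) 1 (takeuchi_val x).
Proof. by rewrite takeuchi_valM delta_vecE (tmul_pure _ _ (takeuchiP x)). Qed.

Lemma tmul_pure_eta q h h' : tmul (lp (eta q) 1) (lp h h') = lp (eta q * h) h'.
Proof.
rewrite tmul_pure; last exact: (@takeuchi_cond_eta _ _ _ _ eta eta etaM).
by rewrite rmult_pure mul1r.
Qed.

Lemma delta_family : nh_family m delta_vec delta_gen.
Proof.
split=> [c l u|l u|s l|s]; apply: val_inj.
- apply: etrans (delta_vecE _) _; apply: esym.
  apply: etrans (congr2 +%R (congr1 (tmul (lp (kin c) 1)) (delta_vecE l)) (delta_vecE u)) _.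
  by rewrite -nh_eta_kin tmul_pure_eta (nhf_lin fam) lpureDl nh_eta_kin.
- apply: etrans (tmul_delta_vec _ _) _; apply: esym; apply: etrans (tmul_delta_vec _ _) _.
  by rewrite (delta_vecE l) (delta_vecE u) !rmult_pure nh_vecC.
- apply: etrans (tmul_delta_vec _ _) _.
  rewrite delta_genE -/(delta_del s) rmult_delta_del; apply: esym.
  apply: etrans (congr1 (fun x => x + lp (kin _) 1) (tmul_delta_del _ _)) _.
  rewrite delta_vecE !rmult_pure !mul1r !mulr1 lp_vec -addrA.
  congr (_ + (_ + _)); first by rewrite -lp_vec mulr1.
  by rewrite -[kin _ in RHS]mulr1 -lp_kin mulr1.
(* In the square of del_s (x) s + 1 (x) del_s the cross terms are del_s (x) s del_s = del_s (x)
   del_s and del_s (x) del_s s = - del_s (x) del_s. *)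
- apply: etrans (tmul_delta_del _ _) _; rewrite delta_genE !rmultD !rmult_pure.
  rewrite !mul1r !mulr1 nh_del_nil nh_rfl2 nh_del_rfl nh_rfl_del lpureNr.
  rewrite [lp 0 1](zmorph0 (tpure_zmodl _ _ _)) [lp 1 0](zmorph0 (tpure_zmodr _ _ _)).
  by rewrite add0r addr0 addNr.
Qed.

Section Evaluation.
Variables f g : R.

(** H (x) H is not an algebra acting on R; these forms take the place of a polynomial
    representation. They respect the tensor product over R because R is commutative. *)
Definition bieval : ltens eta eta -> R := tlift (fun h h' => rho h f * rho h' g).

Lemma bieval_balanced :
  balanced (lmult eta) (lmult eta) (fun h h' => rho h f * rho h' g).
Proof.
split=> [h h' k|h k k'|r h k].
- by rewrite nh_rhoD (mulrDl (rho h f)).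
- by rewrite nh_rhoD (mulrDr (rho h f)).
- rewrite /lmult !nh_rhoM !nh_rho_eta.
  by rewrite -(mulrA r) (mulrCA r (rho h f) (rho k g)).
Qed.

Lemma bieval_zmod : zmod_morphism bieval.
Proof. exact: (tlift_zmod bieval_balanced). Qed.
Lemma bieval_pure h h' : bieval (lp h h') = rho h f * rho h' g.
Proof. exact: (tlift_pure bieval_balanced). Qed.
End Evaluation.

Lemma bieval_rmult f g h h' x :
  bieval f g (rmult h h' x) = bieval (rho h f) (rho h' g) x.
Proof.
elim/ltens_ind: x => [|x y ex ey|p q].
- by rewrite rmult0 !(zmorph0 (bieval_zmod _ _)).
- by rewrite rmultD !(zmorphD (bieval_zmod _ _)) ex ey.
- by rewrite rmult_pure !bieval_pure !nh_rhoM.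
Qed.

Lemma nh_rhoDr h : {morph rho h : f g / f + g}.
Proof. by case: (linear_parts (nh_rho_linear cox h)). Qed.

Lemma zmorph_add (U V : zmodType) (F G : U -> V) : zmod_morphism F ->
  zmod_morphism G -> zmod_morphism (fun x => F x + G x).
Proof. by move=> Fz Gz x y; rewrite Fz Gz opprD addrACA. Qed.

Lemma bievalDl f f' g x : bieval (f + f') g x = bieval f g x + bieval f' g x.
Proof.
move: x; apply: tens_eq_on => [||p q]; first exact: bieval_zmod.
  by apply: zmorph_add; exact: bieval_zmod.
apply: etrans (bieval_pure _ _ _ _) _; rewrite nh_rhoDr (mulrDl (rho p f)).
exact: esym (congr2 +%R (bieval_pure _ _ _ _) (bieval_pure _ _ _ _)).
Qed.

Lemma bievalDr f g g' x : bieval f (g + g') x = bieval f g x + bieval f g' x.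
Proof.
move: x; apply: tens_eq_on => [||p q]; first exact: bieval_zmod.
  by apply: zmorph_add; exact: bieval_zmod.
apply: etrans (bieval_pure _ _ _ _) _; rewrite nh_rhoDr (mulrDr (rho p f)).
exact: esym (congr2 +%R (bieval_pure _ _ _ _) (bieval_pure _ _ _ _)).
Qed.

Lemma bieval0l g x : bieval 0 g x = 0.
Proof. exact: (zmorph0 (morphD_zmod (fun f f' => bievalDl f f' g x))). Qed.
Lemma bieval0r f x : bieval f 0 x = 0.
Proof. exact: (zmorph0 (morphD_zmod (fun g g' => bievalDr f g g' x))). Qed.

Lemma bieval_eta f g q x : bieval f g (tmul (lp (eta q) 1) x) = q * bieval f g x.
Proof.
elim/ltens_ind: x => [|x y ex ey|p p'].
- rewrite tmul0; last exact: (@takeuchi_cond_eta _ _ _ _ eta eta etaM).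
  by rewrite !(zmorph0 (bieval_zmod _ _)) (mulr0 q).
- rewrite tmulDr; last exact: (@takeuchi_cond_eta _ _ _ _ eta eta etaM).
  by rewrite !(zmorphD (bieval_zmod _ _)) ex ey (mulrDr q).
- by rewrite tmul_pure_eta !bieval_pure nh_rhoM nh_rho_eta (mulrA q).
Qed.

Section Pair.
Variables s t : S.
Hypotheses (st : s <> t) (mst : (0 < m s t)%N).
Local Notation I := (didx m s t).
Local Notation e i := (@dbasis K S m s t i).
Local Notation span := (@dspan K S m s t).
Local Notation stable := (@dspan_stable K S m s t).

(** Combinations of pairs of words, grouped by the second word so that independence can be used in
    one factor after the other. *)
Definition dspan2 (x : ltens eta eta) : Prop :=
  exists z : I -> H, (forall i, span (z i)) /\ x = \sum_i lp (z i) (e i).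

Lemma dspan2D x y : dspan2 x -> dspan2 y -> dspan2 (x + y).
Proof.
case=> z [zs ->] [w [ws ->]]; exists (fun i => z i + w i); split.
  by move=> i; exact: dspanD.
by rewrite -big_split /=; apply: eq_bigr => i _; rewrite lpureDl.
Qed.

Lemma dspan2N x : dspan2 x -> dspan2 (- x).
Proof.
case=> z [zs ->]; exists (fun i => - z i); split; first by move=> i; exact: dspanN.
by rewrite -sumrN; apply: eq_bigr => i _; rewrite lpureNl.
Qed.

Lemma dspan2_1 : dspan2 (lp 1 1).
Proof.
pose i0 : I := (true, Ordinal mst).
have e0 : e i0 = 1 by [].
exists (fun i => if i == i0 then 1 else 0); split.
  move=> i; case: eqP => _; last exact: dspan0.
  by rewrite -e0; exact: dspan_basis.
rewrite (bigD1 i0) // eqxx e0 big1; first by exact: (esym (addr0 _)).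
move=> i /negPf ->.
exact: (zmorph0 (tpure_zmodl _ _ _)).
Qed.

Lemma dspan2_rmult g h x : stable g -> stable h -> dspan2 x -> dspan2 (rmult g h x).
Proof.
move=> gs hs [z [zs ->]].
have /choice [b be] : forall i : I, exists r : I -> R, e i * h = \sum_j eta (r j) * e j.
  by move=> i; have := hs _ (dspan_basis K i).
exists (fun j => \sum_i eta (b i j) * (z i * g)); split.
  move=> j; apply: big_ind => [||i _]; [exact: dspan0|exact: dspanD|].
  exact/dspan_eta/gs.
rewrite (zmorph_sum (rmult_zmod _ _)).
under eq_bigr do rewrite rmult_pure be lpure_sumr.
rewrite exchange_big /=; apply: eq_bigr => j _; rewrite lpure_suml.
by apply: eq_bigr => i _; rewrite lpureA.
Qed.

(** For fixed f, letting g vary and using the independence of the second words kills every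
    [rho (z i) f]; then [dspan_detect] applies to each [z i]. *)
Lemma dspan2_detect x : dspan2 x -> (forall f g, bieval f g x = 0) -> x = 0.
Proof.
case=> z [zs ->] h.
suff z0 i : z i = 0.
  by apply: big1 => i _; rewrite z0; exact: (zmorph0 (tpure_zmodl _ _ _)).
apply: (dspan_detect (cox := cox) st mst (zs i)) => f; move: i.
apply: (dbasis_indep (cox := cox) st mst) => g.
rewrite -[RHS](h f g) (zmorph_sum (bieval_zmod f g)).
by apply: eq_bigr => i _; rewrite bieval_pure.
Qed.

Lemma dspan2_alt (b : bool) n :
  dspan2 (takeuchi_val (alt n (delta_gen (if b then s else t))
                              (delta_gen (if b then t else s)))).
Proof.
have stab (c : bool) : stable (del (if c then s else t)) /\ stable (rfl (if c then s else t)).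
  case: c; split.
  - exact: dspan_stable_del_s.
  - exact: dspan_stable_rfl_s.
  - exact: dspan_stable_del_t.
  - exact: dspan_stable_rfl_t.
elim: n => [|n IH]; first exact: dspan2_1.
rewrite altSr.
have -> : (if odd n then delta_gen (if b then t else s) else delta_gen (if b then s else t)) =
    delta_gen (if b (+) odd n then s else t) by case: (odd n); case: (b).
have [h1 h2] := stab (b (+) odd n).
rewrite tmul_delta_del; apply: dspan2D; apply: dspan2_rmult => //.
exact: dspan_stable1.
Qed.

(** Each summand of the last letter has a del in one of its factors, and this del kills the constant
    in its slot. *)
Lemma bieval_alt_const (x y : S) n c c' : (0 < n)%N ->
  bieval c%:A c'%:A (takeuchi_val (alt n (delta_gen x) (delta_gen y))) = 0.
Proof.
case: n => // n _; rewrite altSr.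
have rc z d : rho (del z) d%:A = 0.
  exact: etrans (nh_rho_del cox _ _) (demazure_alg cox _ _).
have D0 (u : T) z : bieval c%:A c'%:A (takeuchi_val (u * delta_gen z)) = 0.
  apply: etrans (congr1 (bieval _ _) (tmul_delta_del u z)) _.
  apply: etrans (zmorphD (bieval_zmod _ _) _ _) _.
  apply: etrans (congr2 +%R (bieval_rmult _ _ _ _ _) (bieval_rmult _ _ _ _ _)) _.
  apply: etrans (congr2 +%R (congr1 (fun f => bieval f _ _) (rc z c))
    (congr1 (fun g => bieval _ g _) (rc z c'))) _.
  by rewrite bieval0l bieval0r addr0.
by case: odd; exact: D0.
Qed.

(** The difference E again satisfies E l = w(l) E. As E lies in the Takeuchi product, a linear form
    may be extracted from either argument of [bieval], which reduces the vanishing to pairs of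
    constants; then [dspan2_detect] concludes. *)
Lemma delta_braid_pair : alt (m s t) (delta_gen s) (delta_gen t) =
  alt (m s t) (delta_gen t) (delta_gen s).
Proof.
apply/eqP; rewrite -subr_eq0; apply/eqP/val_inj.
set E := _ - _ : T.
have EE l : E * delta_vec l = delta_vec (alt_refl m (m s t) s t l) * E.
  by have := braid_diff_lam delta_family (cox_diag cox) (cox_sym cox)
    (cox_off_diag cox) l st mst.
apply: dspan2_detect.
  apply: dspan2D; first exact: (dspan2_alt true).
  apply: dspan2N; exact: (dspan2_alt false).
have vE q : takeuchi_val (delta_vec q * E) = tmul (lp (eta (hincl q)) 1) (takeuchi_val E).
  by rewrite takeuchi_valM delta_vecE nh_eta_hincl.
have El0 f g l : bieval (hincl l * f) g (takeuchi_val E) =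
    bieval f g (rmult (vec l) 1 (takeuchi_val E)).
  apply: esym; apply: etrans (bieval_rmult _ _ _ _ _) _.
  exact: (congr2 (fun a b => bieval a b (takeuchi_val E)) (nh_rho_vec cox l f) (nh_rho1 cox g)).
have El f g l : bieval (hincl l * f) g (takeuchi_val E) =
    hincl (alt_refl m (m s t) s t l) * bieval f g (takeuchi_val E).
  by rewrite El0 -bieval_eta -vE -EE tmul_delta_vec.
have Er f g l : bieval f (hincl l * g) (takeuchi_val E) =
    hincl (alt_refl m (m s t) s t l) * bieval f g (takeuchi_val E).
  apply: etrans (El f g l); apply: etrans (esym (El0 f g l)).
  have -> : rmult (vec l) 1 (takeuchi_val E) = rmult 1 (vec l) (takeuchi_val E).
    by rewrite -nh_eta_hincl; exact: takeuchiP.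
  apply: esym; apply: etrans (bieval_rmult _ _ _ _ _) _.
  exact: (congr2 (fun a b => bieval a b (takeuchi_val E)) (nh_rho1 cox f) (nh_rho_vec cox l g)).
move=> f g; elim/sym_ind: f => [c|x y ex ey|u x ex].
- elim/sym_ind: g => [c'|x y ex ey|u x ex].
  + rewrite (zmorphD (bieval_zmod _ _)) (zmorphN (bieval_zmod _ _)).
    by rewrite !bieval_alt_const // subrr.
  + by apply: etrans (bievalDr _ _ _ _) _; rewrite ex ey addr0.
  + apply: etrans (congr1 (fun a => bieval _ (a * x) _) (esym (hincl_alpha K u))) _.
    apply: etrans (Er _ _ _) _; apply: etrans (congr1 _ ex) _; exact: mulr0.
- by apply: etrans (bievalDl _ _ _ _) _; rewrite ex ey addr0.
- apply: etrans (congr1 (fun a => bieval (a * x) _ _) (esym (hincl_alpha K u))) _.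
  apply: etrans (El _ _ _) _; apply: etrans (congr1 _ ex) _; exact: mulr0.
Qed.
End Pair.

Definition nh_Delta : H -> T := nh_lift delta_vec delta_gen.

Lemma delta_braided : nh_braided m delta_gen.
Proof. by move=> s t st mst; exact: delta_braid_pair. Qed.

Lemma nh_Delta_morphism : kalg_morphism nh_Delta.
Proof. exact: (nh_lift_morphism delta_family delta_braided). Qed.

Lemma nh_Delta_vec l : nh_Delta (vec l) = delta_vec l.
Proof. exact: (nh_lift_vec delta_family delta_braided). Qed.
Lemma nh_Delta_del s : nh_Delta (del s) = delta_gen s.
Proof. exact: (nh_lift_del delta_family delta_braided). Qed.
End Comultiplication.

(** * Generalities on bialgebroids *)

Section BialgebroidFacts.
Variables (k : comPzRingType) (R : comAlgType k) (A : kalgType k) (eta : R -> A).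
Hypotheses (etaz : zmod_morphism eta) (etaM : {morph eta : x y / x * y}).
Local Notation lp := (lpure eta eta).
Local Notation bp := (lpure (eta_c eta) eta).
Local Notation T := (takeuchi_lr eta).
Local Notation tfl := (@tflip R A A (lmult eta) (lmult eta)).
Local Notation lact := (@lr_act k R A eta).

Lemma etaC r q : eta r * eta q = eta q * eta r.
Proof. by rewrite -!etaM mulrC. Qed.

Lemma bp_mulr r x y : bp (x * eta r) y = bp x (eta r * y).
Proof. exact: (@lpureA _ _ A^c A (eta_c eta) eta r x y). Qed.

Lemma lr_act_balanced r : balanced (lmult eta) (lmult eta)
  (fun p q => tpure (lmult eta) (lmult eta) (lmult eta r p) q).
Proof.
apply: tmap_balanced => // [p q|q p p']; first exact: mulrBr.
by rewrite /lmult mulrA etaC -mulrA; exact: lpureA.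
Qed.
Lemma lr_act_pure r p q : lact r (lp p q) = lp (eta r * p) q.
Proof. exact: (tlift_pure (lr_act_balanced r)). Qed.
Lemma lr_act_zmod r : zmod_morphism (lact r).
Proof. exact: (tlift_zmod (lr_act_balanced r)). Qed.

Lemma lr_act_rmult r g h (x : ltens eta eta) : lact r (rmult g h x) = rmult g h (lact r x).
Proof.
move: x; apply: (@tens_eq_on _ _ _ _ _ _ (lact r \o rmult g h)
  (rmult g h \o lact r)).
- by move=> x y /=; rewrite rmult_zmod lr_act_zmod.
- by move=> x y /=; rewrite lr_act_zmod rmult_zmod.
move=> p q; rewrite /= [rmult g h _]rmult_pure lr_act_pure.
by rewrite [X in rmult _ _ X]lr_act_pure rmult_pure mulrA.
Qed.

Local Notation T3 := (tens (lmult eta) lact).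
Local Notation p3 := (tpure (lmult eta) lact).

Lemma assoc_inner_balanced h3 : balanced (lmult eta) (lmult eta)
  (fun h1 h2 => p3 h1 (lp h2 h3)).
Proof.
split=> [x x' y|x y y'|r x y].
- exact: tpureDl.
- by rewrite lpureDl; exact: tpureDr.
- by rewrite tpureA lr_act_pure.
Qed.
Local Notation inner h3 := (tlift (fun h1 h2 => p3 h1 (lp h2 h3))).

Lemma assoc_outer_balanced : balanced lact (lmult eta)
  (fun (x : ltens eta eta) h3 => inner h3 x).
Proof.
have z h := tlift_zmod (assoc_inner_balanced h).
split=> [x y h|x h h'|r x h].
- exact: (zmorphD (z h)).
- move: x; apply: (tens_eq_on (g := fun x => inner h x + inner h' x)) => [||p q].
  + exact: z.
  + by apply: zmorph_add; exact: z.
  rewrite !(tlift_pure (assoc_inner_balanced _)) lpureDr; exact: tpureDr.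
- move: x; apply: (tens_eq_on (f := inner h \o lact r)) => [||p q].
  + by move=> x y /=; rewrite lr_act_zmod z.
  + exact: z.
  rewrite /= [lact r _]lr_act_pure [LHS](tlift_pure (assoc_inner_balanced _)).
  rewrite (tlift_pure (assoc_inner_balanced _)) [LHS]tpureA lr_act_pure.
  by rewrite lpureA.
Qed.

Lemma tens_assoc_zmod : zmod_morphism (@tens_assoc _ _ _ eta).
Proof. exact: (tlift_zmod assoc_outer_balanced). Qed.
Lemma tens_assoc_pure x h3 : tens_assoc (tpure lact (lmult eta) x h3) =
  inner h3 x.
Proof. exact: (tlift_pure assoc_outer_balanced). Qed.
Lemma tens_assoc_pure3 h1 h2 h3 :
  tens_assoc (tpure lact (lmult eta) (lp h1 h2) h3) = p3 h1 (lp h2 h3).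
Proof. by rewrite tens_assoc_pure; exact: (tlift_pure (assoc_inner_balanced _)). Qed.

(** Componentwise right multiplication on threefold tensors, in terms of which both iterated
    coproducts of h g are expressed by those of h. *)
Definition rmult3 g1 g2 g3 : T3 -> T3 :=
  tmap (lmult eta) lact (fun x => x * g1) (rmult g2 g3).

Lemma rmult3_balanced g1 g2 g3 : balanced (lmult eta) lact
  (fun x y => p3 (x * g1) (rmult g2 g3 y)).
Proof.
apply: tmap_balanced => [x y|x y|r x y]; [exact: mulrBl|exact: rmult_zmod|].
by rewrite -lr_act_rmult /lmult -mulrA; exact: tpureA.
Qed.
Lemma rmult3_pure g1 g2 g3 x y : rmult3 g1 g2 g3 (p3 x y) = p3 (x * g1) (rmult g2 g3 y).
Proof. exact: (tlift_pure (rmult3_balanced _ _ _)). Qed.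
Lemma rmult3_zmod g1 g2 g3 : zmod_morphism (rmult3 g1 g2 g3).
Proof. exact: (tlift_zmod (rmult3_balanced _ _ _)). Qed.

Lemma tens_assoc_rmult g1 g2 g3 x h :
  tens_assoc (tpure lact (lmult eta) (rmult g1 g2 x) (h * g3)) =
  rmult3 g1 g2 g3 (tens_assoc (tpure lact (lmult eta) x h)).
Proof.
rewrite !tens_assoc_pure; have z h' := tlift_zmod (assoc_inner_balanced h').
move: x; apply: (tens_eq_on (f := inner (h * g3) \o rmult g1 g2)
  (g := rmult3 g1 g2 g3 \o inner h)) => [||p q].
- by move=> x y /=; rewrite rmult_zmod z.
- by move=> x y /=; rewrite z rmult3_zmod.
rewrite /= [rmult g1 g2 _]rmult_pure [LHS](tlift_pure (assoc_inner_balanced _)).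
rewrite (tlift_pure (assoc_inner_balanced _)) rmult3_pure.
by rewrite rmult_pure.
Qed.

Variable Delta : A -> T.
Hypotheses (Dm : kalg_morphism Delta).
Hypotheses (De : forall r, lrval (Delta (eta r)) = lp (eta r) 1).
Local Notation D h := (takeuchi_val (Delta h) : ltens eta eta).

Lemma Delta_mul g h : D (g * h) = tmul (D g) (D h).
Proof. by case: Dm => _ [_ ->]. Qed.
Lemma Delta_1 : D 1 = lp 1 1.
Proof. by case: Dm => _ [-> _]. Qed.
Lemma Delta_zmod : zmod_morphism (fun h => D h).
Proof. by case: Dm => z _ _ x y; rewrite z. Qed.

Lemma Delta_mul_eta h r : D (h * eta r) = rmult (eta r) 1 (D h).
Proof.
rewrite Delta_mul; have := De r; rewrite /lrval => ->.
by rewrite (tmul_pure _ _ (takeuchiP (Delta h))).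
Qed.

Lemma Delta_eta_mul r h : D (eta r * h) = lact r (D h).
Proof.
rewrite Delta_mul; have e : D (eta r) = lp (eta r) 1 := De r.
move: (takeuchi_val (Delta h) : ltens eta eta).
have z := tmul_zmodr (Delta (eta r)).
apply: tens_eq_on => [||p q]; first exact: z.
  exact: lr_act_zmod.
rewrite [LHS](tmul_pure _ _ (takeuchiP (Delta (eta r)))) e rmult_pure mul1r.
by rewrite [RHS]lr_act_pure.
Qed.

Definition coassL (x : ltens eta eta) : T3 :=
  tens_assoc (tmap lact (lmult eta) (fun h => D h) idfun x).
Definition coassR (x : ltens eta eta) : T3 :=
  tmap (lmult eta) lact idfun (fun h => D h) x.

Lemma coassL_balanced : balanced (lmult eta) (lmult eta)
  (fun p q => tpure lact (lmult eta) (D p) q).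
Proof.
apply: tmap_balanced => // [x y|r p q]; first exact: Delta_zmod.
by rewrite /lmult Delta_eta_mul; exact: tpureA.
Qed.
Lemma coassR_balanced : balanced (lmult eta) (lmult eta) (fun p q => p3 p (D q)).
Proof.
apply: tmap_balanced => // [x y|r p q]; first exact: Delta_zmod.
by rewrite /lmult Delta_eta_mul; exact: tpureA.
Qed.
Lemma coassL_zmod : zmod_morphism coassL.
Proof.
move=> x y; apply: etrans (congr1 _ (tlift_zmod coassL_balanced x y)) _.
exact: tens_assoc_zmod.
Qed.
Lemma coassR_zmod : zmod_morphism coassR.
Proof. exact: (tlift_zmod coassR_balanced). Qed.
Lemma coassL_pure p q :
  coassL (lp p q) = tens_assoc (tpure lact (lmult eta) (D p) q).
Proof. exact: (congr1 _ (tlift_pure coassL_balanced p q)). Qed.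
Lemma coassR_pure p q : coassR (lp p q) = p3 p (D q).
Proof. exact: (tlift_pure coassR_balanced). Qed.

Section Counit.
Variable eps : A -> R.
Hypotheses (epsz : zmod_morphism eps) (epsl : forall r h, eps (eta r * h) = r * eps h).

Lemma counitl_balanced : balanced (lmult eta) (lmult eta)
  (fun h1 h2 => eta (eps h1) * h2).
Proof.
split=> [x x' y|x y y'|r x y].
- by rewrite (zmorphD epsz) (zmorphD etaz) mulrDl.
- exact: mulrDr.
- by rewrite /lmult epsl mulrC etaM mulrA.
Qed.
Lemma counitr_balanced : balanced (lmult eta) (lmult eta)
  (fun h1 h2 => eta (eps h2) * h1).
Proof.
split=> [x x' y|x y y'|r x y].
- exact: mulrDr.
- by rewrite (zmorphD epsz) (zmorphD etaz) mulrDl.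
- by rewrite /lmult epsl (mulrC r) etaM mulrA.
Qed.
Definition counitl : ltens eta eta -> A := tlift (fun h1 h2 => eta (eps h1) * h2).
Definition counitr : ltens eta eta -> A := tlift (fun h1 h2 => eta (eps h2) * h1).
Lemma counitl_zmod : zmod_morphism counitl.
Proof. exact: (tlift_zmod counitl_balanced). Qed.
Lemma counitr_zmod : zmod_morphism counitr.
Proof. exact: (tlift_zmod counitr_balanced). Qed.
Lemma counitl_pure p q : counitl (lp p q) = eta (eps p) * q.
Proof. exact: (tlift_pure counitl_balanced). Qed.
Lemma counitr_pure p q : counitr (lp p q) = eta (eps q) * p.
Proof. exact: (tlift_pure counitr_balanced). Qed.
End Counit.

Lemma tflip_balanced : balanced (lmult eta) (lmult eta)
  (fun p q => tpure (lmult eta) (lmult eta) q p).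
Proof.
split=> [x x' y|x y y'|r x y]; [exact: tpureDr|exact: tpureDl|].
by apply/esym; exact: tpureA.
Qed.
Lemma tflip_zmod : zmod_morphism (tfl : ltens eta eta -> ltens eta eta).
Proof. exact: (tlift_zmod tflip_balanced). Qed.
Lemma tflip_pure p q : tfl (lp p q) = lp q p.
Proof. exact: (tlift_pure tflip_balanced). Qed.
Lemma tflip_rmult g h (x : ltens eta eta) : tfl (rmult g h x) = rmult h g (tfl x).
Proof.
move: x; apply: (@tens_eq_on _ _ _ _ _ _ (tfl \o rmult g h) (rmult h g \o tfl)).
- by move=> x y /=; rewrite rmult_zmod tflip_zmod.
- by move=> x y /=; rewrite tflip_zmod rmult_zmod.
move=> p q; rewrite /= [rmult g h _]rmult_pure tflip_pure.
by rewrite [X in rmult _ _ X]tflip_pure rmult_pure.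
Qed.

Local Notation gal := (galois Delta : ltens (eta_c eta) eta -> ltens eta eta).

Lemma galois_balanced : balanced (lmult (eta_c eta)) (lmult eta)
  (fun (h h' : A) => rmult 1 h' (D h)).
Proof.
split=> [x x' y|x y y'|r x y].
- by rewrite (zmorphD Delta_zmod) rmultD.
- exact: rmultDr.
rewrite -[lmult _ _ _]/((x : A) * eta r) Delta_mul_eta.
(* The Takeuchi condition on Delta(x) is what makes the Galois map well defined on the balanced
   tensor product. *)
have -> : rmult (eta r) 1 (D x) = rmult 1 (eta r) (D x) by exact: takeuchiP.
by rewrite rmult_comp mulr1.
Qed.
Lemma galois_zmod : zmod_morphism gal.
Proof. exact: (tlift_zmod galois_balanced). Qed.
Lemma galois_pure p q : gal (bp p q) = rmult 1 q (D p).
Proof. exact: (tlift_pure galois_balanced). Qed.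

(** Right multiplication by g in the converse algebra is left multiplication by g in A, so it
    corresponds to left multiplication by Delta(g). *)
Lemma galois_rmult (g : A^c) g' (y : ltens (eta_c eta) eta) :
  gal (rmult g g' y) = tmul (D g) (rmult 1 g' (gal y)).
Proof.
move: y; apply: (@tens_eq_on _ _ _ _ _ _ (gal \o rmult g g')
  (fun y => tmul (D g) (rmult 1 g' (gal y)))).
- by move=> x y /=; rewrite rmult_zmod galois_zmod.
- by move=> x y /=; rewrite galois_zmod rmult_zmod (tmul_zmodr (Delta g)).
move=> p q; rewrite /= [rmult g g' _]rmult_pure !galois_pure.
rewrite -[(p : A^c) * g]/((g : A) * (p : A)) Delta_mul.
by rewrite rmult_comp mulr1 (tmul_rmult _ _ _ (takeuchiP (Delta g))).
Qed.

Variable red : A -> takeuchi_op eta.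
Hypotheses (rm : kalg_morphism red).
Hypotheses (re : forall r, opval (red (eta r)) = bp (eta r) 1).
Local Notation D' h := (takeuchi_val (red h : takeuchi (eta_c eta) eta)).

Lemma red_mul g h : D' (g * h) = tmul (D' h) (D' g).
Proof. by case: rm => _ [_ ->]. Qed.
Lemma red_1 : D' 1 = bp 1 1.
Proof. by case: rm => _ [-> _]. Qed.
Lemma red_zmod : zmod_morphism (fun h => D' h).
Proof. by case: rm => z _ _ x y; rewrite z. Qed.

Lemma red_eta_mul r h : D' (eta r * h) = rmult (eta r : A^c) 1 (D' h).
Proof.
rewrite red_mul; have := re r; rewrite /opval => ->.
by rewrite (tmul_pure _ _ (takeuchiP (red h : takeuchi (eta_c eta) eta))).
Qed.

Definition ungalois : ltens eta eta -> ltens (eta_c eta) eta :=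
  tlift (fun h h' : A => rmult (1 : A^c) h' (D' h)).

Lemma ungalois_balanced : balanced (lmult eta) (lmult eta)
  (fun (h h' : A) => rmult (1 : A^c) h' (D' h)).
Proof.
split=> [x x' y|x y y'|r x y].
- by rewrite (zmorphD red_zmod) rmultD.
- exact: rmultDr.
rewrite /lmult red_eta_mul.
have -> : rmult (eta r : A^c) 1 (D' x) = rmult 1 (eta r) (D' x).
  exact: (takeuchiP (red x : takeuchi (eta_c eta) eta)).
by rewrite rmult_comp mulr1.
Qed.
Lemma ungalois_zmod : zmod_morphism ungalois.
Proof. exact: (tlift_zmod ungalois_balanced). Qed.
Lemma ungalois_pure p q : ungalois (lp p q) = rmult (1 : A^c) q (D' p).
Proof. exact: (tlift_pure ungalois_balanced). Qed.

Lemma ungalois_rmult g g' x :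
  ungalois (rmult g g' x) = rmult 1 g' (tmul (D' g) (ungalois x)).
Proof.
have gT := takeuchiP (red g : takeuchi (eta_c eta) eta).
move: x; apply: (@tens_eq_on _ _ _ _ _ _ (ungalois \o rmult g g')
  (fun x => rmult 1 g' (tmul (D' g) (ungalois x)))).
- by move=> x y /=; rewrite rmult_zmod ungalois_zmod.
- move=> x y /=.
  by rewrite ungalois_zmod (tmul_zmodr (red g : takeuchi (eta_c eta) eta)) rmult_zmod.
move=> p q; rewrite /= [rmult g g' _]rmult_pure !ungalois_pure red_mul.
by rewrite (tmul_rmult _ _ _ gT) rmult_comp mulr1.
Qed.

(** Both maps commute with right multiplication in the second factor, so the composites need only be
    checked on h (x) 1 and h [x] 1; there they are given by the two hypotheses. *)
Lemma galois_bijective : is_red Delta red ->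
  (forall h, ungalois (D h) = bp h 1) -> bijective (galois Delta).
Proof.
move=> isred un; exists ungalois.
- apply: (tens_eq_on (f := ungalois \o gal) (g := idfun)) => // [x y|p q] /=.
    by rewrite galois_zmod ungalois_zmod.
  rewrite [X in ungalois X]galois_pure ungalois_rmult un.
  rewrite (_ : D' 1 = bp 1 1); last exact: red_1.
  rewrite tmul1x rmult_pure; congr (bp _ _); first exact: mulr1.
  exact: mul1r.
- apply: (tens_eq_on (f := gal \o ungalois) (g := idfun)) => // [x y|p q] /=.
    by rewrite ungalois_zmod galois_zmod.
  rewrite [X in gal X]ungalois_pure galois_rmult (isred p) rmult_pure.
  rewrite -[D (1 : A^c)]/(D (1 : A)) Delta_1 tmul1x; congr (lp _ _).
    exact: mulr1.
  exact: mul1r.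
Qed.
End BialgebroidFacts.

(** * The Hopf algebroid structure *)

Lemma alt_converse (A : pzRingType) n (x y : A) :
  alt n (x : A^c) (y : A^c) = if odd n then alt n x y else alt n y x.
Proof.
elim: n x y => [|n IH] x y //.
rewrite altS IH -[LHS]/((if odd n then alt n y x else alt n x y) * x).
by rewrite [odd n.+1]oddS if_neg (altSr n x y) (altSr n y x); case: (odd n).
Qed.

Lemma id_kalg (k : pzRingType) (A : kalgType k) : kalg_morphism (@idfun A).
Proof. by []. Qed.

Lemma kalg_morphism_converse (k : comPzRingType) (B C : kalgType k) (f : B -> C) :
  kalg_morphism f -> kalg_morphism (f : B^c -> C^c).
Proof. by case=> fz [f1 fM] fk; split=> //; split=> // x y; exact: fM. Qed.

Section NilHeckeHopf.
Variables (K : realType) (S : choiceType) (W : groupType) (sg : S -> W).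
Variables (m : S -> S -> nat) (cox : coxeter_system sg m).
Local Notation R := (Sym K S).
Local Notation H := (nilHecke K m).
Local Notation eta := (@nh_eta K S m).
Local Notation rho := (@nh_rho K S W sg m cox).
Local Notation del := (nh_del K m).
Local Notation vec := (@nh_vec K S m).
Local Notation rfl := (nh_refl K m).
Local Notation T := (takeuchi_lr eta).
Local Notation lp := (lpure eta eta).
Local Notation bp := (lpure (eta_c eta) eta).
Local Notation Delta := (@nh_Delta K S m : H -> T).
Local Notation D h := (takeuchi_val (Delta h) : ltens eta eta).
Let fam := nh_generators_family K m.
Let etaz := @nh_eta_zmod K S m.
Let etaM := @nh_etaM K S m.
Let Dm := nh_Delta_morphism K cox.

Lemma nh_indr_eta (P : H -> Prop) : P 1 -> (forall x y, P x -> P y -> P (x + y)) ->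
  (forall r x, P x -> P (x * eta r)) -> (forall s x, P x -> P (x * del s)) ->
  forall x, P x.
Proof.
move=> P1 PD Pe Pd; apply: nh_indr => // [c x Px|l x Px].
  by rewrite kinC -nh_eta_kin; exact: Pe.
by rewrite -nh_eta_hincl; exact: Pe.
Qed.

Lemma nh_indl_eta (P : H -> Prop) : P 1 -> (forall x y, P x -> P y -> P (x + y)) ->
  (forall r x, P x -> P (eta r * x)) -> (forall s x, P x -> P (del s * x)) ->
  forall x, P x.
Proof.
move=> P1 PD Pe Pd; apply: nh_indl => // [c x Px|l x Px].
  by rewrite -nh_eta_kin; exact: Pe.
by rewrite -nh_eta_hincl; exact: Pe.
Qed.

Lemma nh_Delta_eta r : lrval (Delta (eta r)) = lp (eta r) 1.
Proof.
have [Dz [D1 DM] Dk] := Dm.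
elim/sym_ind: r => [c|x y ex ey|s x ex].
- by rewrite nh_eta_kin Dk.
- by rewrite (zmorphD etaz) (zmorphD Dz) /lrval takeuchi_valD lpureDl; congr (_ + _).
- rewrite nh_etaM DM nh_eta_symX /lrval takeuchi_valM (nh_Delta_vec cox).
  apply: etrans (congr1 (tmul _) ex) _; rewrite delta_vecE.
  by rewrite -nh_eta_hincl tmul_pure_eta.
Qed.

Lemma D_mul_del h s : D (h * del s) = rmult (del s) (rfl s) (D h) + rmult 1 (del s) (D h).
Proof. by have [_ [_ ->] _] := Dm; rewrite (nh_Delta_del K cox) tmul_delta_del. Qed.

Lemma D_mul_eta h r : D (h * eta r) = rmult (eta r) 1 (D h).
Proof. exact: (Delta_mul_eta Dm nh_Delta_eta). Qed.

Lemma D_mul_vec h l : D (h * vec l) = rmult (vec l) 1 (D h).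
Proof. by rewrite -nh_eta_hincl D_mul_eta. Qed.

Lemma D_1 : D 1 = lp 1 1. Proof. by have [_ [-> _] _] := Dm. Qed.
Lemma D_zmod : zmod_morphism (fun h => D h). Proof. exact: (Delta_zmod Dm). Qed.

(** The element s is group-like: Delta(alpha_s del_s) = (1 - s) (x) s + 1 (x) (1 - s) = 1 (x) 1 - s
    (x) s, where alpha_s has been moved across the tensor sign in the second term. *)
Lemma D_mul_rfl h s : D (h * rfl s) = rmult (rfl s) (rfl s) (D h).
Proof.
rewrite /nh_refl mulrBr mulr1 mulrA (zmorphD D_zmod) (zmorphN D_zmod).
rewrite D_mul_del D_mul_vec -/(nh_refl K m s) !rmult_comp mulr1 !mul1r.
have -> : rmult (vec (alpha K s)) (del s) (D h) = rmult 1 (vec (alpha K s) * del s) (D h).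
  transitivity (rmult 1 (del s) (rmult (vec (alpha K s)) 1 (D h))).
    by rewrite rmult_comp mulr1 mul1r.
  have -> : rmult (vec (alpha K s)) 1 (D h) = rmult 1 (vec (alpha K s)) (D h).
    by rewrite -nh_eta_hincl; exact: takeuchiP.
  by rewrite rmult_comp mul1r.
have NL g h' x : rmult (a := eta) (b := eta) (- g) h' x = - rmult g h' x.
  by apply: (zmorphN (morphD_zmod (fun g g' => rmultDl g g' h' x))).
have NR g h' x : rmult (a := eta) (b := eta) g (- h') x = - rmult g h' x.
  by apply: (zmorphN (morphD_zmod (fun h h' => rmultDr g h h' x))).
have -> : vec (alpha K s) * del s = 1 - rfl s by rewrite /nh_refl opprB addrC subrK.
rewrite (rmultDl 1 (- rfl s) (rfl s)) (NL (rfl s)) (rmultDr 1 1 (- rfl s)) (NR 1 (rfl s)).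
rewrite rmult_id.
have cancel (Z : zmodType) (x a b : Z) : x - (a - b + (x - a)) = b.
  by rewrite (addrC (a - b)) addrA subrK opprB addrC subrK.
exact: cancel.
Qed.

Local Notation coL := (coassL (eta := eta) Delta).
Local Notation coR := (coassR (eta := eta) Delta).

(** On both sides, multiplying h by del_s multiplies the threefold tensor by del_s (x) s (x) s + 1
    (x) del_s (x) s + 1 (x) 1 (x) del_s; on the right-hand side this uses that s is group-like. *)
Lemma nh_coassoc h : coL (D h) = coR (D h).
Proof.
have Lz := coassL_zmod etaM Dm nh_Delta_eta.
have Rz := coassR_zmod etaM Dm nh_Delta_eta.
have L0 := coassL_pure etaM Dm nh_Delta_eta; have R0 := coassR_pure etaM Dm nh_Delta_eta.
have Cz g1 g2 g3 := rmult3_zmod etaM g1 g2 g3.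
have C0 g1 g2 g3 := rmult3_pure etaM g1 g2 g3.
have TA g1 g2 g3 := tens_assoc_rmult etaM g1 g2 g3.
have Ldel s x : coL (rmult (del s) (rfl s) x) =
    rmult3 (del s) (rfl s) (rfl s) (coL x) + rmult3 1 (del s) (rfl s) (coL x).
  elim/ltens_ind: x => [|x y ex ey|p q].
  - by rewrite rmult0 !(zmorph0 Lz) !(zmorph0 (Cz _ _ _)) addr0.
  - by rewrite rmultD !(zmorphD Lz) ex ey !(zmorphD (Cz _ _ _)) addrACA.
  - by rewrite rmult_pure !L0 D_mul_del tpureDl (zmorphD (tens_assoc_zmod etaM)) !TA.
have L1 g x : coL (rmult 1 g x) = rmult3 1 1 g (coL x).
  elim/ltens_ind: x => [|x y ex ey|p q].
  - by rewrite rmult0 !(zmorph0 Lz) !(zmorph0 (Cz _ _ _)).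
  - by rewrite rmultD !(zmorphD Lz) ex ey !(zmorphD (Cz _ _ _)).
  - by rewrite rmult_pure !L0 -TA rmult_id mulr1.
have Le r x : coL (rmult (eta r) 1 x) = rmult3 (eta r) 1 1 (coL x).
  elim/ltens_ind: x => [|x y ex ey|p q].
  - by rewrite rmult0 !(zmorph0 Lz) !(zmorph0 (Cz _ _ _)).
  - by rewrite rmultD !(zmorphD Lz) ex ey !(zmorphD (Cz _ _ _)).
  - by rewrite rmult_pure !L0 D_mul_eta TA.
have Rrfl g s x : coR (rmult g (rfl s) x) = rmult3 g (rfl s) (rfl s) (coR x).
  elim/ltens_ind: x => [|x y ex ey|p q].
  - by rewrite rmult0 !(zmorph0 Rz) !(zmorph0 (Cz _ _ _)).
  - by rewrite rmultD !(zmorphD Rz) ex ey !(zmorphD (Cz _ _ _)).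
  - by rewrite rmult_pure !R0 D_mul_rfl C0.
have Rdel s x : coR (rmult 1 (del s) x) =
    rmult3 1 (del s) (rfl s) (coR x) + rmult3 1 1 (del s) (coR x).
  elim/ltens_ind: x => [|x y ex ey|p q].
  - by rewrite rmult0 !(zmorph0 Rz) !(zmorph0 (Cz _ _ _)) addr0.
  - by rewrite rmultD !(zmorphD Rz) ex ey !(zmorphD (Cz _ _ _)) addrACA.
  - by rewrite rmult_pure !R0 D_mul_del tpureDr !C0.
have Re g x : coR (rmult g 1 x) = rmult3 g 1 1 (coR x).
  elim/ltens_ind: x => [|x y ex ey|p q].
  - by rewrite rmult0 !(zmorph0 Rz) !(zmorph0 (Cz _ _ _)).
  - by rewrite rmultD !(zmorphD Rz) ex ey !(zmorphD (Cz _ _ _)).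
  - by rewrite rmult_pure !R0 mulr1 C0 rmult_id.
move: h; apply: nh_indr_eta => [|x y ex ey|r x ex|s x ex].
- by rewrite D_1 L0 R0 D_1 (tens_assoc_pure3 etaM).
- by rewrite (zmorphD D_zmod) (zmorphD Lz) (zmorphD Rz) ex ey.
- by rewrite D_mul_eta Le Re ex.
- by rewrite D_mul_del (zmorphD Lz) (zmorphD Rz) Ldel L1 Rrfl Rdel ex addrA.
Qed.

Definition nh_eps (h : H) : R := rho h 1.

Lemma nh_eps_zmod : zmod_morphism nh_eps. Proof. exact: nh_rho_zmod. Qed.
Lemma nh_eps_eta r h : nh_eps (eta r * h) = r * nh_eps h.
Proof. exact: etrans (nh_rhoM cox _ _ _) (nh_rho_eta cox _ _). Qed.
Lemma nh_eps_mul_eta h r : nh_eps (h * eta r) = rho h r.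
Proof.
apply: etrans (nh_rhoM cox _ _ _) _; apply: (congr1 (rho h)).
apply: etrans (nh_rho_eta cox _ _) _; exact: mulr1.
Qed.

Lemma nh_eps_mul_del h s : nh_eps (h * del s) = 0.
Proof.
have z : rho (del s) 1 = 0.
  exact: etrans (nh_rho_del cox _ _) (demazure1 K cox s).
apply: etrans (nh_rhoM cox _ _ _) _; apply: etrans (congr1 (rho h) z) _.
by case: (linear_parts (nh_rho_linear cox h)).
Qed.

Lemma nh_eps_mul_rfl h s : nh_eps (h * rfl s) = nh_eps h.
Proof.
apply: etrans (nh_rhoM cox _ _ _) _; apply: (congr1 (rho h)).
apply: etrans (nh_rho_rfl cox _ _) _.
by case: (act_monoid (geometric_action K cox) (sg s)).
Qed.

Local Notation cl := (counitl (eta := eta) nh_eps).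
Local Notation cr := (counitr (eta := eta) nh_eps).

(** As del_s kills 1, only the summand 1 (x) del_s of Delta(del_s) contributes. *)
Lemma nh_counitl h : cl (D h) = h.
Proof.
have Lz := counitl_zmod etaz etaM nh_eps_zmod nh_eps_eta.
have L0 := counitl_pure etaz etaM nh_eps_zmod nh_eps_eta.
have L1 g x : cl (rmult 1 g x) = cl x * g.
  elim/ltens_ind: x => [|x y ex ey|p q].
  - by rewrite rmult0 !(zmorph0 Lz) mul0r.
  - by rewrite rmultD !(zmorphD Lz) ex ey mulrDl.
  - by rewrite rmult_pure !L0 mulr1 mulrA.
have Ld s g x : cl (rmult (del s) g x) = 0.
  elim/ltens_ind: x => [|x y ex ey|p q].
  - by rewrite rmult0 (zmorph0 Lz).
  - by rewrite rmultD (zmorphD Lz) ex ey addr0.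
  - by rewrite rmult_pure L0 nh_eps_mul_del (zmorph0 etaz) mul0r.
move: h; apply: nh_indr_eta => [|x y ex ey|r x ex|s x ex].
- by rewrite D_1 L0 mulr1 /nh_eps nh_rho1 nh_eta1.
- by rewrite (zmorphD D_zmod) (zmorphD Lz) ex ey.
- rewrite D_mul_eta.
  have -> : rmult (eta r) 1 (D x) = rmult 1 (eta r) (D x) by exact: takeuchiP.
  by rewrite L1 ex.
- by rewrite D_mul_del (zmorphD Lz) Ld L1 ex add0r.
Qed.

(** Here del_s (x) s is the summand that contributes, through eps(h s) = eps(h). *)
Lemma nh_counitr h : cr (D h) = h.
Proof.
have Lz := counitr_zmod etaz etaM nh_eps_zmod nh_eps_eta.
have L0 := counitr_pure etaz etaM nh_eps_zmod nh_eps_eta.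
have L1 g x : cr (rmult g 1 x) = cr x * g.
  elim/ltens_ind: x => [|x y ex ey|p q].
  - by rewrite rmult0 !(zmorph0 Lz) mul0r.
  - by rewrite rmultD !(zmorphD Lz) ex ey mulrDl.
  - by rewrite rmult_pure !L0 mulr1 mulrA.
have Ls g s x : cr (rmult g (rfl s) x) = cr x * g.
  elim/ltens_ind: x => [|x y ex ey|p q].
  - by rewrite rmult0 !(zmorph0 Lz) mul0r.
  - by rewrite rmultD !(zmorphD Lz) ex ey mulrDl.
  - by rewrite rmult_pure !L0 nh_eps_mul_rfl mulrA.
have Ld s g x : cr (rmult g (del s) x) = 0.
  elim/ltens_ind: x => [|x y ex ey|p q].
  - by rewrite rmult0 (zmorph0 Lz).
  - by rewrite rmultD (zmorphD Lz) ex ey addr0.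
  - by rewrite rmult_pure L0 nh_eps_mul_del (zmorph0 etaz) mul0r.
move: h; apply: nh_indr_eta => [|x y ex ey|r x ex|s x ex].
- by rewrite D_1 L0 mulr1 /nh_eps nh_rho1 nh_eta1.
- by rewrite (zmorphD D_zmod) (zmorphD Lz) ex ey.
- by rewrite D_mul_eta L1 ex.
- by rewrite D_mul_del (zmorphD Lz) Ld Ls ex addr0.
Qed.

Lemma nh_subalgebra : is_subalgebra_map eta.
Proof.
split; [exact: etaz|exact: nh_eta_monoid|exact: nh_eta_kin|exact: (nh_eta_inj cox)].
Qed.

Lemma nh_bialgebroid : is_bialgebroid Delta nh_eps.
Proof.
split.
- exact: nh_subalgebra.
- by move=> r h; exact: (Delta_eta_mul etaM Dm nh_Delta_eta).
- exact: nh_eps_zmod.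
- exact: nh_eps_eta.
- exact: nh_coassoc.
- exact: nh_counitl.
- exact: nh_counitr.
- exact: Dm.
- have e h r : nh_eps (h * eta r) = rho h r by exact: nh_eps_mul_eta.
  have [rl rD r1 rM rk] := nh_rho_representation K cox.
  split=> [a c u v|a b v|v|a b v|c v]; rewrite !e.
  + exact: rl.
  + exact: rD.
  + exact: r1.
  + exact: rM.
  + exact: rk.
- by move=> r r'; rewrite nh_eps_mul_eta nh_rho_eta.
Qed.

(** The flip exchanges the two expressions for Delta(del_s), and the Takeuchi condition absorbs the
    flip on elements of R. *)
Lemma nh_cocommutative : is_cocommutative Delta.
Proof.
rewrite /is_cocommutative /lrval.
have Fz := @tflip_zmod _ _ _ eta; have F0 := @tflip_pure _ _ _ eta.
have FR := @tflip_rmult _ _ _ eta.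
apply: nh_indr_eta => [|x y ex ey|r x ex|s x ex].
- by rewrite D_1 F0.
- by rewrite (zmorphD D_zmod) (zmorphD Fz) ex ey.
- by rewrite D_mul_eta FR ex; apply: esym; exact: takeuchiP.
- rewrite D_mul_del (zmorphD Fz) !FR ex.
  rewrite -!(tmul_pure _ _ (takeuchiP (Delta x))) -!(tmulDr _ _ (takeuchiP (Delta x))).
  by rewrite -/(delta_del K m s) (delta_del_flip K m s) addrC.
Qed.

(* The anti-automorphism fixing R and every del_s; it sends s to - s.          *)
Definition nh_tau : H -> H^c := nh_lift (A := H^c) vec del.

(** Read backwards, the cross relation for l is the original one for s(l), since the pairing with
    the coroot changes sign under s. *)
Lemma tau_family : nh_family (A := H^c) m vec del.
Proof.
split=> [c l u|l u|s l|s].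
- rewrite -[RHS]/(vec l * kin c + vec u) -kinC; exact: (nhf_lin fam).
- exact: (nhf_comm fam).
- rewrite -[LHS]/(vec l * del s).
  rewrite -[RHS]/(del s * vec (simple_reflection m s l) + kin (coroot m s l)).
  rewrite (nhf_cross fam) (reflK (cox_diag cox)) (coroot_refl_diag (cox_diag cox)).
  by rewrite (zmorphN (raddfB (kin : K -> H))) subrK.
- exact: (nhf_nil fam).
Qed.

Lemma tau_braided : nh_braided (A := H^c) m del.
Proof.
move=> s t st mst; rewrite !alt_converse.
by rewrite (nh_generators_braided K st mst); case: odd.
Qed.

Lemma nh_tau_morphism : kalg_morphism nh_tau.
Proof. exact: (nh_lift_morphism tau_family tau_braided). Qed.
Lemma nh_tau_vec l : nh_tau (vec l) = vec l.
Proof. exact: (nh_lift_vec tau_family tau_braided). Qed.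
Lemma nh_tau_del s : nh_tau (del s) = del s.
Proof. exact: (nh_lift_del tau_family tau_braided). Qed.

Lemma nh_tau_eta r : nh_tau (eta r) = eta_c eta r.
Proof.
have [tz [t1 tM] tk] := nh_tau_morphism.
elim/sym_ind: r => [c|x y ex ey|s x ex].
- by rewrite /eta_c nh_eta_kin tk.
- by rewrite /eta_c !(zmorphD etaz) (zmorphD tz) ex ey.
rewrite nh_etaM tM nh_eta_symX nh_tau_vec ex /eta_c.
rewrite -[LHS]/(eta x * vec (alpha K s)) -nh_eta_symX -!nh_etaM.
by rewrite (mulrC x).
Qed.

Let eta_id r : idfun (eta r) = eta r. Proof. by []. Qed.

Definition nh_red_map : T -> takeuchi (eta_c eta) eta :=
  takeuchi_map nh_tau_morphism (g := idfun) (id_kalg H) nh_tau_eta eta_id.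

(** The inner [nh_tau] and the converse in [takeuchi_op] both reverse products, so the composite is
    multiplicative. The [nh_tau] inside [nh_red_map], applied to the first factor, turns the tensor
    product of left modules into the balanced one. *)
Definition nh_red (h : H) : takeuchi_op eta := nh_red_map (Delta (nh_tau h)).

Local Notation D' h := (takeuchi_val (nh_red h : takeuchi (eta_c eta) eta)).

Lemma nh_red_morphism : kalg_morphism nh_red.
Proof.
have [tz [t1 tM] tk] := nh_tau_morphism; have [Dz [D1 DM] Dk] := Dm.
have [mz [m1 mM] mk] : kalg_morphism nh_red_map by exact: takeuchi_map_morphism.
split=> [x y||c].
- by rewrite /nh_red tz Dz mz.
- split=> [|x y]; first by rewrite /nh_red t1 D1 m1.
  by rewrite /nh_red tM -[(_ : H^c) * _]/((nh_tau y : H) * (nh_tau x : H)) DM mM.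
- by rewrite /nh_red tk Dk mk.
Qed.

Lemma nh_red_eta r : opval (nh_red (eta r)) = bp (eta r) 1.
Proof.
rewrite /opval /nh_red nh_tau_eta /=.
apply: etrans (congr1 _ (nh_Delta_eta r)) _.
apply: etrans (ltens_map_pure nh_tau_morphism (id_kalg H) nh_tau_eta eta_id _ _) _.
by rewrite nh_tau_eta.
Qed.

Lemma nh_red_del s : opval (nh_red (del s)) = bp (del s) (rfl s) + bp 1 (del s).
Proof.
have [tz [t1 tM] tk] := nh_tau_morphism.
have P := ltens_map_pure nh_tau_morphism (id_kalg H) nh_tau_eta eta_id.
have Z := ltens_map_zmod nh_tau_morphism (id_kalg H) nh_tau_eta eta_id.
rewrite /opval /nh_red nh_tau_del (nh_Delta_del K cox) /= delta_genE.
by rewrite (zmorphD Z) !P nh_tau_del t1.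
Qed.

Lemma bp_vec l x y : bp (x * vec l) y = bp x (vec l * y).
Proof. by rewrite -nh_eta_hincl; exact: bp_mulr. Qed.

Lemma bpDl x y z : bp (x + y) z = bp x z + bp y z.
Proof. exact: (@lpureDl _ _ H^c H (eta_c eta) eta x y z). Qed.

(** From del_s alpha_s = 2 - alpha_s del_s = 1 + s one gets del_s [x] s = del_s [x] 1 - (1 + s) [x]
    del_s. *)
Lemma nh_red_del_flip s : opval (nh_red (del s)) = bp (del s) 1 - bp (rfl s) (del s).
Proof.
rewrite nh_red_del; have -> : rfl s = 1 - vec (alpha K s) * del s by [].
rewrite lpureBr -bp_vec (nh_del_alpha K cox).
have -> : 2%:R - vec (alpha K s) * del s = (1 - vec (alpha K s) * del s) + 1.
  by rewrite addrAC.
by rewrite bpDl opprD addrA subrK.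
Qed.

(** If the claim holds for x, then red(del_s x) is sent to del_s x (x) s s + x (x) del_s s + x (x)
    del_s, where s s = 1 and the last two terms cancel. *)
Lemma nh_is_red : is_red Delta nh_red.
Proof.
have rm := nh_red_morphism; have re := nh_red_eta.
have Gz := galois_zmod Dm nh_Delta_eta.
have G0 := galois_pure Dm nh_Delta_eta; have GR := galois_rmult Dm nh_Delta_eta.
have Dd s : D (del s) = lp (del s) (rfl s) + lp 1 (del s).
  by rewrite (nh_Delta_del K cox) delta_genE.
rewrite /is_red /lrpure; apply: nh_indl_eta => [|x y ex ey|r x ex|s x ex].
- by case: rm => _ [r1 _] _; rewrite r1; apply: etrans (G0 _ _) _; rewrite D_1 rmult_id.
- by case: rm => rz _ _; rewrite (zmorphD rz) [LHS](zmorphD Gz) lpureDl; congr (_ + _).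
- rewrite /opval (red_eta_mul rm re) GR [galois _ _]ex rmult_id.
  apply: etrans (congr1 (fun d => tmul d _) (nh_Delta_eta r)) _.
  by rewrite tmul_pure_eta.
have rT := takeuchiP (nh_red x : takeuchi (eta_c eta) eta).
have e : D' (del s * x) = rmult (del s : H^c) (rfl s) (D' x) + rmult (1 : H^c) (del s) (D' x).
  rewrite (red_mul rm) [D' (del s)](nh_red_del s) (tmulDr _ _ rT).
  by rewrite !(tmul_pure _ _ rT).
rewrite /opval e; apply: etrans (zmorphD Gz _ _) _; rewrite !GR [galois _ _]ex.
rewrite !rmult_pure -[D (1 : H^c)]/(D (1 : H)) D_1 tmul1x (mulr1 x) !mul1r.
rewrite (tmul_pure _ _ (takeuchiP (Delta (del s)))) Dd rmultD !rmult_pure mul1r.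
by rewrite (nh_rfl2 K cox) (nh_del_rfl K cox) lpureNr subrK.
Qed.

(** The mirror computation, for right multiplication by del_s: x del_s [x] s s + x [x] del_s s + x
    [x] del_s = x del_s [x] 1. *)
Lemma nh_ungalois h : ungalois nh_red (D h) = bp h 1.
Proof.
have rm := nh_red_morphism; have re := nh_red_eta.
have Uz := ungalois_zmod rm re.
have U0 := ungalois_pure rm re; have UR := ungalois_rmult rm re.
have r1 : D' 1 = bp 1 1 by exact: red_1.
move: h; apply: nh_indr_eta => [|x y ex ey|r x ex|s x ex].
- by rewrite D_1 U0 r1 rmult_id.
- by rewrite (zmorphD D_zmod) (zmorphD Uz) bpDl ex ey.
- rewrite D_mul_eta UR ex rmult_id.
  rewrite (tmul_pure _ _ (takeuchiP (nh_red (eta r) : takeuchi (eta_c eta) eta))).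
  by rewrite [D' (eta r)](nh_red_eta r) rmult_pure mulr1.
rewrite D_mul_del (zmorphD Uz) !UR ex r1 tmul1x.
rewrite (tmul_pure _ _ (takeuchiP (nh_red (del s) : takeuchi (eta_c eta) eta))).
rewrite [D' (del s)](nh_red_del s) !rmultD !rmult_pure !mulr1 !mul1r.
rewrite (nh_rfl2 K cox) (nh_del_rfl K cox).
by rewrite lpureNr subrK.
Qed.

Lemma nh_hopf : is_hopf_algebroid Delta nh_eps.
Proof.
split; first exact: nh_bialgebroid.
apply: (galois_bijective Dm nh_Delta_eta nh_red_morphism nh_red_eta).
- exact: nh_is_red.
- exact: nh_ungalois.
Qed.
End NilHeckeHopf.

(** * The group W inside the nil Hecke algebra *)

Section GroupElements.
Variables (K : realType) (S : choiceType) (W : groupType) (sg : S -> W).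
Variables (m : S -> S -> nat) (cox : coxeter_system sg m).
Local Notation R := (Sym K S).
Local Notation H := (nilHecke K m).
Local Notation eta := (@nh_eta K S m).
Local Notation rho := (@nh_rho K S W sg m cox).
Local Notation act := (geometric_action K cox).
Local Notation del := (nh_del K m).
Local Notation vec := (@nh_vec K S m).
Local Notation rfl := (nh_refl K m).
Local Notation T := (takeuchi_lr eta).
Local Notation lp := (lpure eta eta).
Local Notation bp := (lpure (eta_c eta) eta).
Local Notation Delta := (@nh_Delta K S m : H -> T).
Local Notation D h := (takeuchi_val (Delta h) : ltens eta eta).
Local Notation D' h := (takeuchi_val (nh_red cox h : takeuchi (eta_c eta) eta)).

Definition rfl_unit s : runit H := RUnit (nh_rfl2 K cox s) (nh_rfl2 K cox s).

(* Both sides lie in the span of the words in del_s and del_t and act equally  *)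
(* on R.                                                                       *)
Lemma rfl_braid s t : s <> t -> (0 < m s t)%N -> (rfl s * rfl t) ^+ m s t = 1.
Proof.
move=> st mst; apply/eqP; rewrite -subr_eq0; apply/eqP.
have spanX n : dspan s t ((rfl s * rfl t) ^+ n).
  elim: n => [|n IH]; first exact: (dspan_word K st mst true 0).
  rewrite exprSr; apply: (dspan_stableM (dspan_stable_rfl_s st mst)
    (dspan_stable_rfl_t st mst)) IH.
apply: (dspan_detect (cox := cox) st mst).
  by apply: dspanD; [exact: spanX|apply: dspanN; exact: (spanX 0%N)].
move=> f; have rX n : rho ((rfl s * rfl t) ^+ n) f = act ((sg s * sg t) ^+ n)%g f.
  elim: n => [|n IH]; first by rewrite expr0 expg0 (nh_rho1 cox) (act1 act).
  rewrite exprS expgS !(actM act) -IH.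
  apply: etrans (nh_rhoM cox _ _ _) _; apply: etrans (nh_rhoM cox _ _ _) _.
  apply: etrans (nh_rho_rfl cox _ _) _; apply: (congr1 (act (sg s))).
  exact: nh_rho_rfl.
apply: etrans (nh_rhoD cox _ _ _) _; rewrite rX.
rewrite ((cox_order cox s t (m s t)).2 (dvdnn _)) (act1 act).
apply: etrans (congr1 ( +%R f) (zmorphN (nh_rho_zmod cox f) 1)) _.
by rewrite nh_rho1 subrr.
Qed.

Lemma group_embedding_exists : exists u : W -> runit H,
  {morph u : v w / (v * w)%g} /\ (forall s, u (sg s) = rfl_unit s).
Proof.
have [||u [h _]] := cox_presentation cox (f := rfl_unit).
- by move=> s; apply: runitP; exact: (nh_rfl2 K cox).
- move=> s t st mst; apply: runitP; rewrite runitX; exact: rfl_braid.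
- by exists u.
Qed.

Definition gelt (w : W) : H := runit_val (sval (cid group_embedding_exists) w).

Lemma geltM v w : gelt (v * w)%g = gelt v * gelt w.
Proof. by rewrite /gelt (svalP (cid group_embedding_exists)).1. Qed.
Lemma gelt_sg s : gelt (sg s) = rfl s.
Proof. by rewrite /gelt (svalP (cid group_embedding_exists)).2. Qed.
Lemma gelt1 : gelt 1%g = 1.
Proof.
have e : sval (cid group_embedding_exists) 1%g = 1%g.
  set u := sval _; apply: (mulgI (u 1%g)).
  by rewrite -(svalP (cid group_embedding_exists)).1 !mulg1.
by rewrite /gelt e.
Qed.

Lemma rho_gelt w f : rho (gelt w) f = act w f.
Proof.
move: f; apply: (cox_ind cox (P := fun w => forall f, rho (gelt w) f = act w f)) => [f|s v IH f].
  by rewrite gelt1 nh_rho1 (act1 act).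
rewrite geltM gelt_sg (actM act) -IH; apply: etrans (nh_rhoM cox _ _ _) _.
exact: nh_rho_rfl.
Qed.

Lemma rfl_eta s r : rfl s * eta r = eta (act (sg s) r) * rfl s.
Proof.
elim/sym_ind: r => [c|x y ex ey|t x ex].
- by rewrite act_alg nh_eta_kin kinC.
- rewrite (actD cox (sg s) x y) !(zmorphD (@nh_eta_zmod K S m)).
  by rewrite (mulrDr (rfl s)) (mulrDl (eta _)) ex ey.
have e1 : eta (symX K t * x) = vec (alpha K t) * eta x.
  by apply: etrans (nh_etaM m _ _) _; rewrite nh_eta_symX.
have e2 : eta (act (sg s) (symX K t)) = vec (simple_reflection m s (alpha K t)).
  have <- := nh_eta_hincl m (simple_reflection m s (alpha K t)).
  apply: (congr1 eta); apply: etrans (act_hincl cox s (alpha K t)).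
  exact: (congr1 (act (sg s)) (esym (hincl_alpha K t))).
have e3 : eta (act (sg s) (symX K t * x)) =
    vec (simple_reflection m s (alpha K t)) * eta (act (sg s) x).
  have e4 := congr1 eta (actMr cox (sg s) (symX K t) x).
  have e5 := nh_etaM m (act (sg s) (symX K t)) (act (sg s) x).
  exact: etrans e4 (etrans e5 (congr1 (fun y => y * eta (act (sg s) x)) e2)).
by rewrite e1 e3 mulrA nh_rfl_vec -mulrA ex mulrA.
Qed.

Lemma gelt_eta w r : gelt w * eta r = eta (act w r) * gelt w.
Proof.
move: r; apply: (cox_ind cox (P := fun w => forall r, gelt w * eta r = _)) => [r|s v IH r].
  by rewrite gelt1 (act1 act) mul1r mulr1.
by rewrite geltM gelt_sg -mulrA IH mulrA rfl_eta -mulrA (actM act).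
Qed.

Lemma D_rfl s : D (rfl s) = lp (rfl s) (rfl s).
Proof.
have e := D_mul_rfl cox (1 : H) s; rewrite (D_1 K cox) in e.
by rewrite -[rfl s in LHS]mul1r e rmult_pure !mul1r.
Qed.

Lemma D_gelt w : D (gelt w) = lp (gelt w) (gelt w).
Proof.
apply: (cox_ind cox (P := fun w => D (gelt w) = _)) => [|s v IH].
  by rewrite gelt1 (D_1 K cox).
rewrite geltM gelt_sg (Delta_mul (nh_Delta_morphism K cox)) IH.
by rewrite (tmul_pure _ _ (takeuchiP (Delta (rfl s)))) D_rfl rmult_pure.
Qed.

(** The second expression for red(del_s) gives red(s) = s [x] 1 + alpha_s s [x] del_s; since alpha_s
    s = - s alpha_s, this is s [x] (1 - alpha_s del_s). *)
Lemma red_rfl s : D' (rfl s) = bp (rfl s) (rfl s).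
Proof.
have rm := nh_red_morphism K cox; have re := @nh_red_eta K S W sg m cox.
have rz := red_zmod rm.
have e1 : D' (rfl s) = bp 1 1 - rmult (vec (alpha K s) : H^c) 1 (D' (del s)).
  rewrite {1}/nh_refl (rz 1) (red_1 rm); congr (_ - _).
  by rewrite -nh_eta_hincl (red_eta_mul rm re).
rewrite e1 [D' (del s)](nh_red_del_flip K cox s) rmultD (rmultN (a := eta_c eta)) !rmult_pure.
have vs : vec (alpha K s) * rfl s = - (rfl s * vec (alpha K s)).
  rewrite nh_rfl_vec nh_vec_refl (coroot_alpha K cox).
  have -> : kin 2 = 2%:R :> H by exact: (rmorph_nat (kin : K -> H)).
  by rewrite mulrBl mulr_natl mulr2n mulrDl opprB addrK.
rewrite -[(del s : H^c) * _]/(vec (alpha K s) * del s).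
rewrite -[(rfl s : H^c) * _]/(vec (alpha K s) * rfl s) vs !mulr1.
have Nl (x y : H) : bp (- x) y = - bp x y.
  exact: (@lpureNl _ _ H^c H (eta_c eta) eta x y).
have Dl := bpDl (K := K) (m := m).
rewrite Nl (bp_vec (m := m)) opprK opprD addrA -Nl -Dl.
rewrite -/(nh_refl K m s) -lpureNr -lpureDr.
by [].
Qed.

Lemma red_gelt w : D' (gelt w) = bp (gelt w) (gelt (w^-1)%g).
Proof.
apply: (cox_ind cox (P := fun w => D' (gelt w) = bp (gelt w) (gelt (w^-1)%g))) => [|s v IH].
  by rewrite invg1 gelt1 (red_1 (nh_red_morphism K cox)).
rewrite geltM gelt_sg (red_mul (nh_red_morphism K cox)) red_rfl.
rewrite (tmul_pure _ _ (takeuchiP (nh_red cox (gelt v) : takeuchi (eta_c eta) eta))) IH rmult_pure.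
by rewrite invgM (cox_sgV cox) geltM gelt_sg.
Qed.
End GroupElements.

(** * The nil Hecke algebra acting on functions on W *)

Section FunctionModule.
Variables (K : comNzRingType) (F : fieldType) (kap : {rmorphism K -> F}) (W : Type).

(** The morphism is an index of the type because the scalar action depends on it. *)
Definition fmod of {rmorphism K -> F} := W -> F.
Local Notation V := (fmod kap).
HB.instance Definition _ := gen_eqMixin V.
HB.instance Definition _ := gen_choiceMixin V.

Definition fmod0 : V := fun=> 0.
Definition fmod_opp (g : V) : V := fun v => - g v.
Definition fmod_add (g h : V) : V := fun v => g v + h v.
Definition fmod_scale (c : K) (g : V) : V := fun v => kap c * g v.

Lemma fmod_addA : associative fmod_add.
Proof. by move=> f g h; apply/funext => v; exact: addrA. Qed.
Lemma fmod_addC : commutative fmod_add.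
Proof. by move=> f g; apply/funext => v; exact: addrC. Qed.
Lemma fmod_add0 : left_id fmod0 fmod_add.
Proof. by move=> f; apply/funext => v; exact: add0r. Qed.
Lemma fmod_addN : left_inverse fmod0 fmod_opp fmod_add.
Proof. by move=> f; apply/funext => v; exact: addNr. Qed.
HB.instance Definition _ :=
  GRing.isZmodule.Build V fmod_addA fmod_addC fmod_add0 fmod_addN.

Lemma fmod_scaleA c d g : fmod_scale c (fmod_scale d g) = fmod_scale (c * d) g.
Proof. by apply/funext => v; rewrite /fmod_scale rmorphM mulrA. Qed.
Lemma fmod_scale1 : left_id 1 fmod_scale.
Proof. by move=> g; apply/funext => v; rewrite /fmod_scale rmorph1 mul1r. Qed.
Lemma fmod_scaleDr : right_distributive fmod_scale +%R.
Proof. by move=> c g h; apply/funext => v; exact: mulrDr. Qed.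
Lemma fmod_scaleDl g : {morph fmod_scale^~ g : c d / c + d}.
Proof. by move=> c d; apply/funext => v; rewrite /fmod_scale rmorphD mulrDl. Qed.
HB.instance Definition _ := GRing.Zmodule_isLmodule.Build K V
  fmod_scaleA fmod_scale1 fmod_scaleDr fmod_scaleDl.

Lemma fmodDE (g h : V) v : (g + h) v = g v + h v. Proof. by []. Qed.
Lemma fmodZE c (g : V) v : (c *: g) v = kap c * g v. Proof. by []. Qed.
End FunctionModule.

Section TwistedFunctions.
Variables (K : realType) (S : choiceType) (W : groupType) (sg : S -> W).
Variables (m : S -> S -> nat) (cox : coxeter_system sg m).
(** The model to keep in mind: F is the fraction field of R and [e v l] is v^-1(l). *)
Variables (F : fieldType) (kap : {rmorphism K -> F}) (e : W -> hstar K S -> F).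
Hypothesis e_lin : forall v c l u, e v (c *: l + u) = kap c * e v l + e v u.
Hypothesis e_refl : forall s v l, e (sg s * v)%g l = e v (simple_reflection m s l).
Hypothesis e_inj : forall v l, e v l = 0 -> l = 0.

Local Notation V := (fmod W kap).
Local Notation E := (lend V).
Let m_diag := cox_diag cox.
Let m_sym := cox_sym cox.
Let m_off := cox_off_diag cox.

Lemma e_zmod v : zmod_morphism (e v).
Proof.
move=> l u; rewrite addrC -scaleN1r e_lin rmorphN rmorph1 mulN1r addrC.
by [].
Qed.

Lemma e_root_neq0 v s : e v (alpha K s) != 0.
Proof.
apply/eqP => /e_inj /(congr1 (fun l : hstar K S => l@_s)).
by rewrite mcoeffUU mcoeff0 => /eqP; rewrite oner_eq0.
Qed.

Lemma e_reflE v s l : e v (simple_reflection m s l) =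
  e v l - kap (coroot m s l) * e v (alpha K s).
Proof. by rewrite /simple_reflection addrC -scaleNr e_lin rmorphN mulNr addrC. Qed.

Lemma fvec_linear l : linear (fun g : V => (fun v => e v l * g v) : V).
Proof. by move=> c g h; apply/funext => v; rewrite !fmodDE !fmodZE mulrDr mulrCA. Qed.
Definition fvec l : E := Lend (fvec_linear l).

(** The operator is chosen so that 1 - alpha_s del_s becomes the translation sending g to v |-> g(s
    v). *)
Lemma fdel_linear s :
  linear (fun g : V => (fun v => (g v - g (sg s * v)%g) / e v (alpha K s)) : V).
Proof.
move=> c g h; apply/funext => v; rewrite !fmodDE !fmodZE mulrA -mulrDl.
by congr (_ / _); rewrite mulrBr opprD addrACA.
Qed.
Definition fdel s : E := Lend (fdel_linear s).

Lemma fvecE l g v : fvec l g v = e v l * g v. Proof. by []. Qed.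
Lemma fdelE s g v : fdel s g v = (g v - g (sg s * v)%g) / e v (alpha K s).
Proof. by []. Qed.

Lemma function_family : nh_family m fvec fdel.
Proof.
have LP (f g : E) : (forall h v, f h v = g h v) -> f = g.
  by move=> fg; apply: lendP => h; apply/funext => v; exact: fg.
split=> [c l u|l u|s l|s]; apply: LP => g v.
- rewrite fvecE e_lin mulrDl -mulrA.
  by rewrite -[RHS]/(kap c * (e v l * g v) + e v u * g v).
- by rewrite -[LHS]/(e v l * (e v u * g v)) -[RHS]/(e v u * (e v l * g v)) mulrCA.
- rewrite -[LHS]/((e v l * g v - e (sg s * v)%g l * g (sg s * v)%g) / e v (alpha K s)).
  rewrite -[RHS]/(e v (simple_reflection m s l) *
    ((g v - g (sg s * v)%g) / e v (alpha K s)) + kap (coroot m s l) * g v).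
  rewrite e_refl e_reflE; have := e_root_neq0 v s.
  move: (e v l) (e v (alpha K s)) (g v) (g _) (kap _) => a r x y c r0.
  by field.
- rewrite -[LHS]/((fdel s g v - fdel s g (sg s * v)%g) / e v (alpha K s)) !fdelE.
  rewrite e_refl e_reflE (coroot_alpha K cox) mulgA (cox_sg2 cox) mul1g.
  rewrite -[RHS]/(0 : F) rmorphD rmorph1.
  have := e_root_neq0 v s; move: (e v (alpha K s)) (g v) (g _) => r x y r0.
  have -> : r - (1 + 1) * r = - r by ring.
  by rewrite invrN mulrN -mulNr opprB subrr mul0r.
Qed.

(** The points v, x v, y x v, ... at which an alternating word in the [fdel] reads its argument. *)
Fixpoint walk n (x y : S) (v : W) : W := if n is n'.+1 then walk n' y x (sg x * v)%g else v.

Lemma walkM n x y v w : walk n x y (v * w)%g = (walk n x y v * w)%g.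
Proof. by elim: n x y v => [|n IH] x y v //=; rewrite mulgA IH. Qed.

Lemma walkSr n x y v : walk n.+1 x y v = (sg (if odd n then y else x) * walk n x y v)%g.
Proof.
elim: n x y v => [|n IH] x y v //.
by rewrite -[LHS]/(walk n.+1 y x (sg x * v)%g) IH /=; case: (odd n).
Qed.

Lemma walkD n k x y v : walk (n + k) x y v =
  (if odd n then walk k y x else walk k x y) (walk n x y v).
Proof.
elim: n x y v => [|n IH] x y v //.
by rewrite addSn -[LHS]/(walk (n + k) y x (sg x * v)%g) IH /=; case: (odd n).
Qed.

Lemma walk_rev n x y v : (if odd n then walk n x y else walk n y x) (walk n x y v) = v.
Proof.
elim: n x y v => [|n IH] x y v //.
have IH' := IH y x (sg x * v)%g; rewrite -[walk n.+1 x y v]/(walk n y x (sg x * v)%g).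
have -> : (if odd n.+1 then walk n.+1 x y else walk n.+1 y x)
    (walk n y x (sg x * v)%g) =
    (sg x * (if odd n then walk n y x else walk n x y) (walk n y x (sg x * v)%g))%g.
  by rewrite oddS; case: (odd n) (walkSr n) => /= ps; rewrite -/(walk n.+1 _ _ _) ps.
by rewrite IH' mulgA (cox_sg2 cox) mul1g.
Qed.

Lemma walk_double n x y v : walk n.*2 x y v = ((sg y * sg x) ^+ n * v)%g.
Proof.
elim: n v => [|n IH] v; first by rewrite expg0 mul1g.
by rewrite doubleS /= IH expgSr !mulgA.
Qed.

Lemma e_walk n x y v l : e (walk n x y v) l = e v (alt_refl m n x y l).
Proof. by elim: n x y v => [|n IH] x y v //=; rewrite IH e_refl. Qed.

(** The coefficient with which the value at the far end of the walk enters; [leadE] writes it as a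
    product of factors -1/beta over the roots beta met by the word. *)
Fixpoint lead n (x y : S) (v : W) : F :=
  if n is n'.+1 then - (lead n' y x (sg x * v)%g) / e v (alpha K x) else 1.

Lemma alt_fdelS n x y g v : alt n.+1 (fdel x) (fdel y) g v =
  (alt n (fdel y) (fdel x) g v - alt n (fdel y) (fdel x) g (sg x * v)%g) / e v (alpha K x).
Proof. by []. Qed.

Lemma alt_fdel_local n x y (g : V) v :
  (forall k, (k <= n)%N -> g (walk k x y v) = 0 /\ g (walk k y x v) = 0) ->
  alt n (fdel x) (fdel y) g v = 0.
Proof.
elim: n x y v => [|n IH] x y v gv; first by have [] := gv 0%N isT.
rewrite alt_fdelS IH => [|k kn]; last by have [] := gv k (leqW kn).
rewrite IH ?subrr ?mul0r // => k kn; split; first by have [] := gv k.+1 kn.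
case: k kn => [_|k kn]; first by have [] := gv 1%N isT.
by rewrite /= mulgA (cox_sg2 cox) mul1g; have [] := gv k (leq_trans (ltnW kn) (leqnSn _)).
Qed.

(** Of the points read by the word, only the far end of the walk starting with x can carry a nonzero
    value. To reach it every letter must contribute its translation term. *)
Lemma alt_fdel_lead n x y (g : V) v :
  (forall k, (k < n)%N -> g (walk k x y v) = 0 /\ g (walk k y x v) = 0) ->
  alt n (fdel x) (fdel y) g v = lead n x y v * g (walk n x y v).
Proof.
elim: n x y v => [|n IH] x y v gv; first by rewrite mul1r.
rewrite alt_fdelS alt_fdel_local => [|k kn]; last by have [] := gv k kn.
rewrite sub0r IH => [|k kn]; first by rewrite /= !mulNr mulrAC.
split; first by have [] := gv k.+1 kn.
case: k kn => [n0|k kn]; first by have [] := gv 1%N n0.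
by rewrite /= mulgA (cox_sg2 cox) mul1g; have [] := gv k (leq_trans (ltnW kn) (leqnSn _)).
Qed.

Lemma leadE n x y v : lead n x y v =
  \prod_(k < n) - (e v (alt_refl m k x y (alpha K (if odd k then y else x))))^-1.
Proof.
elim: n x y v => [|n IH] x y v; first by rewrite big_ord0.
rewrite big_ord_recl /= IH mulNr mulrC -mulNr; congr (_ * _).
by apply: eq_bigr => k _; rewrite e_refl /bump /= if_neg.
Qed.

Section Pair.
Variables s t : S.
Hypotheses (st : s <> t) (mst : (0 < m s t)%N).
Local Notation M := (m s t).
Let c := cos (@cox_angle K S m s t).

(** The recursion of [chebU] is reversible, and [cheb_top] provides the mirror image (1, 0) of its
    initial value (0, 1). *)
Lemma cheb_rev k : (k < M)%N ->
  chebU c (M.-1 - k) = ((chebU c k).2, (chebU c k).1).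
Proof.
elim: k => [|k IH] kM; first by rewrite subn0 (cheb_top K m_off st mst).
have := IH (ltnW kM); have -> : (M.-1 - k = (M.-1 - k.+1).+1)%N.
  by rewrite subnSK // -ltnS prednK.
rewrite /=; case: (chebU c (M.-1 - k.+1)) => a b /=; case: (chebU c k) => u v /= [-> <-].
by congr (_, _); ring.
Qed.

(** Both words of length M meet all positive roots of the dihedral group once, in opposite orders;
    hence the reversal of the index. *)
Lemma lead_sym v : lead M s t v = lead M t s v.
Proof.
rewrite !leadE.
have sE (k : 'I_M) : alt_refl m k s t (alpha K (if odd k then t else s)) =
    (chebU c k).2 *: alpha K s + (chebU c k).1 *: alpha K t.
  exact: (alt_refl_root K m_diag m_sym k s t).
have tE (k : 'I_M) : alt_refl m k t s (alpha K (if odd k then s else t)) =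
    (chebU c k).2 *: alpha K t + (chebU c k).1 *: alpha K s.
  by have := alt_refl_root K m_diag m_sym k t s; rewrite (cox_angle_sym K m_sym t s).
under eq_bigr do rewrite sE; under [RHS]eq_bigr do rewrite tE.
rewrite [LHS](reindex_inj rev_ord_inj) /=; apply: eq_bigr => k _.
have -> : (M - k.+1 = M.-1 - k)%N by rewrite subnS predn_sub.
by rewrite cheb_rev //= addrC.
Qed.

(** The same translation q undoes both walks: the first because (t s)^M = 1, the second because it
    retraces the steps. *)
Lemma walk_top v : walk M s t v = walk M t s v.
Proof.
pose q := if odd M then walk M t s else walk M s t.
have q1 : q (walk M s t v) = v.
  rewrite /q -walkD addnn walk_double (cox_sym cox s t).
  by rewrite ((cox_order cox t s (m t s)).2 (dvdnn _)) mul1g.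
have q2 : q (walk M t s v) = v by exact: walk_rev.
have qM a b : q (a * b)%g = (q a * b)%g by rewrite /q; case: odd; exact: walkM.
by apply: (mulgI (q 1%g)); rewrite -!qM !mul1g q1 q2.
Qed.

(** The longest element makes the dominant vector pair negatively with both simple roots, whereas
    each shorter word leaves one of these pairings positive. *)
Lemma dominant_top k : (k < M)%N ->
  let u := alt_refl m M s t (dominant K s t) in
  u <> alt_refl m k s t (dominant K s t) /\ u <> alt_refl m k t s (dominant K s t).
Proof.
move=> kM /=; have ts : t <> s by move=> ts; apply: st.
have mts : (0 < m t s)%N by rewrite (cox_sym cox).
have pS n : (n < M)%N -> 0 < cox_form m (alt_refl m n t s (dominant K s t)) (alpha K s).
  by move=> nM; apply: (dominant_form K m_diag m_sym m_off st mst).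
have pT n : (n < M)%N -> 0 < cox_form m (alt_refl m n s t (dominant K s t)) (alpha K t).
  move=> nM; have -> : dominant K s t = dominant K t s by exact: addrC.
  by apply: (dominant_form K m_diag m_sym m_off ts mts); rewrite (cox_sym cox).
have M1 : (M.-1 < M)%N by rewrite prednK.
split=> eq_u.
- have := pT _ kM; rewrite -eq_u (alt_refl_braid m_diag m_sym m_off st mst).
  rewrite -(prednK mst) -[alt_refl m _.+1 t s _]/(simple_reflection m t _).
  by rewrite (form_refl_diag m_diag) oppr_gt0 ltNge ltW // pT.
- have := pS _ kM; rewrite -eq_u.
  rewrite -(prednK mst) -[alt_refl m _.+1 s t _]/(simple_reflection m s _).
  by rewrite (form_refl_diag m_diag) oppr_gt0 ltNge ltW // pS.
Qed.

Definition fscal (a : F) (g : V) : V := fun v => a * g v.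

Lemma alt_fdel_scal a n x y g v :
  alt n (fdel x) (fdel y) (fscal a g) v = a * alt n (fdel x) (fdel y) g v.
Proof.
elim: n x y v => [|n IH] x y v //.
by rewrite !alt_fdelS !IH -mulrBr mulrA.
Qed.

Let X : E := alt M (fdel s) (fdel t) - alt M (fdel t) (fdel s).

Lemma fbraidE g v :
  X g v = alt M (fdel s) (fdel t) g v - alt M (fdel t) (fdel s) g v.
Proof. by []. Qed.

Lemma fbraid_vec l g v :
  X (fvec l g) v = e v (alt_refl m M s t l) * X g v.
Proof.
have eX := braid_diff_lam function_family m_diag m_sym m_off l st mst.
by have := congr1 (fun f : E => f g v) eX.
Qed.

(* Applying polynomials in multiplication operators, one may assume that g     *)
(* vanishes at all points of the orbit but the longest one.                    *)
Lemma fbraid_poly (l : hstar K S) (as_ : seq F) (g : V) v : exists g' : V,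
  (forall w, g' w = (\prod_(a <- as_) (e w l - a)) * g w) /\
  X g' v = (\prod_(a <- as_) (e v (alt_refl m M s t l) - a)) * X g v.
Proof.
elim: as_ => [|a as_ [g' [g'E Xg']]].
  by exists g; split=> [w|]; rewrite big_nil mul1r.
exists (fvec l g' - fscal a g'); split=> [w|].
  rewrite big_cons -mulrA -g'E -[LHS]/(e w l * g' w - a * g' w).
  by rewrite mulrBl.
have [_ XD _] := lend_parts X.
have Xs : X (- fscal a g') v = - (a * X g' v).
  have XN := zmorphN (morphD_zmod XD) (fscal a g').
  rewrite XN -[LHS]/(- (X (fscal a g') v)); congr (- _).
  by rewrite !fbraidE !alt_fdel_scal mulrBr.
rewrite XD fmodDE fbraid_vec Xs big_cons -mulrA -Xg'.
by rewrite mulrBl.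
Qed.

(** The interpolating polynomial has as roots the values of a dominant l at all points of the two
    walks before their common end. On the modified function each word reduces to its leading term at
    that end, and these terms agree. The factor introduced is nonzero by [dominant_top], so the
    original difference vanishes as well. *)
Lemma fdel_braid_pair : alt M (fdel s) (fdel t) = alt M (fdel t) (fdel s).
Proof.
apply/eqP; rewrite -subr_eq0; apply/eqP/lendP => g; apply/funext => v.
rewrite -/X -[RHS]/(0 : F).
pose l := dominant K s t.
pose as_ := [seq e (walk k s t v) l | k <- iota 0 M] ++ [seq e (walk k t s v) l | k <- iota 0 M].
have [g' [g'E Xg']] := fbraid_poly l as_ g v.
have g'0 k : (k < M)%N -> g' (walk k s t v) = 0 /\ g' (walk k t s v) = 0.
  move=> kM; rewrite !g'E; split; apply/eqP; rewrite mulf_eq0; apply/orP; left.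
  - rewrite prodf_seq_eq0; apply/hasP; exists (e (walk k s t v) l); last by rewrite /= subrr.
    by rewrite mem_cat map_f // mem_iota.
  - rewrite prodf_seq_eq0; apply/hasP; exists (e (walk k t s v) l); last by rewrite /= subrr.
    by rewrite mem_cat orbC map_f // mem_iota.
have X0 : X g' v = 0.
  rewrite fbraidE !alt_fdel_lead; last 2 first.
  - by move=> k kM; have [? ?] := g'0 k kM.
  - exact: g'0.
  by rewrite lead_sym walk_top subrr.
have : \prod_(a <- as_) (e v (alt_refl m M s t l) - a) != 0.
  rewrite prodf_seq_neq0; apply/allP => a; rewrite mem_cat => /orP[] /mapP[k].
  - rewrite mem_iota add0n => kM -> /=; rewrite e_walk -(e_zmod v).
    have [ne _] := dominant_top kM; apply/eqP => /e_inj /eqP; rewrite subr_eq0.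
    by move/eqP.
  - rewrite mem_iota add0n => kM -> /=; rewrite e_walk -(e_zmod v).
    have [_ ne] := dominant_top kM; apply/eqP => /e_inj /eqP; rewrite subr_eq0.
    by move/eqP.
by move/negPf => p0; move/eqP: Xg'; rewrite X0 eq_sym mulf_eq0 p0 => /eqP.
Qed.
End Pair.

Lemma function_braided : nh_braided m fdel.
Proof. by move=> s t st mst; exact: fdel_braid_pair. Qed.
End TwistedFunctions.

(** * Embedding of the twisted group algebra *)

Section SymFractions.
Variables (K : realType) (S : choiceType).

Definition symd := Sym K S.
HB.instance Definition _ := GRing.ComNzRing.on symd.

Definition symd_unit : {pred symd} := fun x => `[< exists y, y * x = 1 >].
(** Inverses are picked by choice; they only serve to supply the ring structure over which fractions
    are formed. *)
Definition symd_inv (x : symd) : symd :=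
  if pselect (exists y : symd, y * x = 1) is left h then sval (cid h) else x.
Lemma symd_mulVx : {in symd_unit, left_inverse 1 symd_inv *%R}.
Proof.
move=> x /asboolP h; rewrite /symd_inv; case: pselect => // h'.
exact: (svalP (cid h')).
Qed.
Lemma symd_unitPl (x y : symd) : y * x = 1 -> symd_unit x.
Proof. by move=> e; apply/asboolP; exists y. Qed.
Lemma symd_inv_out : {in [predC symd_unit], symd_inv =1 id}.
Proof.
move=> x; rewrite inE => /asboolP h; rewrite /symd_inv.
by case: pselect.
Qed.
HB.instance Definition _ := GRing.ComNzRing_hasMulInverse.Build symd
  symd_mulVx symd_unitPl symd_inv_out.
Lemma symd_domain (x y : symd) : x * y = 0 -> (x == 0) || (y == 0).
Proof. exact: sym_mulf_eq0. Qed.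
HB.instance Definition _ := GRing.ComUnitRing_isIntegral.Build symd symd_domain.

Lemma sym_fraction_field :
  exists (F : fieldType) (iota : {rmorphism Sym K S -> F}), injective iota.
Proof.
exists {fraction symd}.
exists ((@FracField.tofrac symd : {rmorphism symd -> {fraction symd}})
  : {rmorphism Sym K S -> {fraction symd}}) => x y exy.
by apply/eqP; rewrite -(@tofrac_eq symd); apply/eqP.
Qed.
End SymFractions.

Section TwistedLift.
Variables (k : comNzRingType) (R : comAlgType k) (W : groupType) (a : alg_action R W).
Variables (Z : zmodType) (F : W -> R -> Z).
Hypothesis F_additive : forall w, {morph F w : r r' / r + r'}.

Definition tw_lift (x : twisted a) : Z := \sum_(w <- msupp x) F w x@_w.

Lemma tw_lift_tw r w : tw_lift (tw a r w) = F w r.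
Proof.
apply: (tw_sumU a (F := F)); apply: (addrI (F w 0)).
by rewrite -F_additive !addr0.
Qed.

Lemma tw_lift_zmod : zmod_morphism tw_lift.
Proof. by apply: morphD_zmod => x y; apply: tw_sumD. Qed.
End TwistedLift.

Section Embedding.
Variables (K : realType) (S : choiceType) (W : groupType) (sg : S -> W).
Variables (m : S -> S -> nat) (cox : coxeter_system sg m).
Local Notation R := (Sym K S).
Local Notation H := (nilHecke K m).
Local Notation eta := (@nh_eta K S m).
Local Notation act := (geometric_action K cox).
Local Notation A := (RW K cox).
Local Notation gelt := (@gelt K S W sg m cox).
Let etaz := @nh_eta_zmod K S m.
Let etaM := @nh_etaM K S m.

Definition rw_map : A -> H := tw_lift (fun w r => eta r * gelt w).

Let rw_map_additive w : {morph (fun r => eta r * gelt w) : r r' / r + r'}.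
Proof. by move=> r r'; rewrite (zmorphD etaz) mulrDl. Qed.

Lemma rw_map_rw r w : rw_map (rw cox r w) = eta r * gelt w.
Proof. exact: (tw_lift_tw act rw_map_additive). Qed.

Lemma rw_map_zmod : zmod_morphism rw_map.
Proof. exact: (tw_lift_zmod rw_map_additive). Qed.

Lemma rw_ind (P : A -> Prop) : P 0 -> (forall x y, P x -> P y -> P (x + y)) ->
  (forall r w, P (rw cox r w)) -> forall x, P x.
Proof. exact: tw_ind. Qed.

Lemma rw_mul r w r' w' : rw cox r w * rw cox r' w' = rw cox (r * act w r') (w * w')%g.
Proof. exact: tw_mulE. Qed.

Lemma rw_map_mul x y : rw_map (x * y) = rw_map x * rw_map y.
Proof.
have jD := zmorphD rw_map_zmod.
elim/rw_ind: x => [|x x' ex ex'|r w].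
- by rewrite (mul0r y) (zmorph0 rw_map_zmod) mul0r.
- apply: etrans (congr1 rw_map (mulrDl x x' y)) (etrans (jD _ _) _).
  apply: etrans (congr2 +%R ex ex') _.
  by apply: etrans (esym (mulrDl _ _ _)) _; congr (_ * _); exact: esym (jD _ _).
elim/rw_ind: y => [|y y' ey ey'|r' w'].
- by rewrite (mulr0 (rw cox r w)) (zmorph0 rw_map_zmod) mulr0.
- apply: etrans (congr1 rw_map (mulrDr _ y y')) (etrans (jD _ _) _).
  apply: etrans (congr2 +%R ey ey') _.
  by apply: etrans (esym (mulrDr _ _ _)) _; congr (_ * _); exact: esym (jD _ _).
apply: etrans (congr1 rw_map (rw_mul r w r' w')) _.
apply: etrans (rw_map_rw _ _) _.
apply: etrans (esym (congr2 *%R (rw_map_rw r w) (rw_map_rw r' w'))).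
by rewrite (etaM r) geltM -!mulrA; congr (_ * _); rewrite !mulrA gelt_eta.
Qed.

Lemma rw_map_morphism : kalg_morphism rw_map.
Proof.
split=> [||c]; first exact: rw_map_zmod.
  split=> [|x y]; last exact: rw_map_mul.
  by apply: etrans (rw_map_rw 1 1%g) _; rewrite nh_eta1 gelt1 mul1r.
apply: etrans (rw_map_rw _ _) _.
by rewrite gelt1 mulr1 nh_eta_kin.
Qed.

Lemma rw_map_eta r : rw_map (rw_eta cox r) = eta r.
Proof. by apply: etrans (rw_map_rw _ _) _; rewrite gelt1 mulr1. Qed.

(* R * W acts faithfully on the delta function of W at 1.                       *)
Lemma rw_map_inj : injective rw_map.
Proof.
have [F [iota iota_inj]] := sym_fraction_field K S.
pose kap : {rmorphism K -> F} := GRing.RMorphism.clone K F (iota \o in_alg R) _.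
pose e (v : W) (l : hstar K S) : F := iota (act (v^-1)%g (hincl l)).
have actI v f : act v f = 0 -> f = 0.
  move=> e0; rewrite -[f](act1 act) -(mulVg v) (actM act) e0.
  exact: (zmorph0 (act_zmod act _)).
have e_lin v c l u : e v (c *: l + u) = kap c * e v l + e v u.
  rewrite /e (hincl_linear c l u) (act_linear act) raddfD; congr (_ + _).
  rewrite -[kap c]/(iota c%:A) -rmorphM; congr (iota _).
  exact: (esym (mulr_algl _ _)).
have e_refl s v l : e (sg s * v)%g l = e v (simple_reflection m s l).
  rewrite /e invgM (cox_sgV cox) (actM act); congr (iota (act _ _)).
  exact: act_hincl.
have e_inj v l : e v l = 0 -> l = 0.
  rewrite /e -(rmorph0 iota) => /iota_inj /actI; exact: hincl_eq0.
have fam := function_family cox e_lin e_refl e_inj.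
have br := function_braided cox e_lin e_refl e_inj.
pose V := fmod W kap.
pose mu (h : H) : lend V := nh_lift (fvec kap e) (fdel sg kap e) h.
have [muz [mu1 muM] muk] : kalg_morphism mu by exact: nh_lift_morphism.
have mu_vec l : mu (nh_vec m l) = fvec kap e l by exact: (nh_lift_vec fam br).
have mu_del s : mu (nh_del K m s) = fdel sg kap e s by exact: (nh_lift_del fam br).
have mu_eta r (g : V) v : mu (eta r) g v = iota (act (v^-1)%g r) * g v.
  elim/sym_ind: r g => [c|x y ex ey|s x ex] g.
  - by rewrite nh_eta_kin muk (act_alg cox).
  - rewrite (zmorphD etaz) (zmorphD muz) lendDE fmodDE ex ey.
    by rewrite (actD cox) raddfD mulrDl.
  - rewrite etaM muM nh_eta_symX lendME.
    apply: etrans (congr1 (fun f : lend V => f (mu (eta x) g) v) (mu_vec _)) _.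
    apply: etrans (congr1 ( *%R (e v (alpha K s))) (ex g)) _.
    apply: etrans (mulrA _ _ _) _; apply: (congr1 (fun z => z * g v)).
    apply: etrans (esym (rmorphM iota _ _)) _; apply: (congr1 iota).
    apply: etrans (esym (actMr cox _ _ x)) _.
    apply: (congr1 (fun z => act (v^-1)%g (z * x))); exact: hincl_alpha.
have mu_rfl s (g : V) v : mu (nh_refl K m s) g v = g (sg s * v)%g.
  rewrite /nh_refl (muz 1) mu1 muM (mu_vec (alpha K s)) (mu_del s).
  rewrite -[LHS]/(g v - e v (alpha K s) * ((g v - g (sg s * v)%g) / e v (alpha K s))).
  have r0 := e_root_neq0 e_inj v s; rewrite mulrC divfK //.
  by rewrite opprB addrC subrK.
have mu_gelt w (g : V) v : mu (gelt w) g v = g (w^-1 * v)%g.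
  move: w g v; apply: (cox_ind cox) => [|s w IH] g v.
    by rewrite gelt1 mu1 invg1 mul1g.
  by rewrite geltM gelt_sg muM lendME mu_rfl IH invgM (cox_sgV cox) mulgA.
pose dl : V := fun v => (v == 1%g)%:R.
(* Here w moves the delta function from 1 to w, so the value at v isolates the coefficient of x at
   v, twisted by v^-1. *)
have mu_j x v : mu (rw_map x) dl v = iota (act (v^-1)%g x@_v).
  elim/rw_ind: x => [|x y ex ey|r w].
  - rewrite (zmorph0 rw_map_zmod) (zmorph0 muz) mcoeff0.
    by rewrite (zmorph0 (act_zmod act _)) rmorph0.
  - rewrite (zmorphD rw_map_zmod) (zmorphD muz) lendDE fmodDE.
    apply: etrans (congr2 +%R ex ey) _; apply: etrans (esym (rmorphD iota _ _)) _.
    apply: (congr1 iota); apply: etrans (esym (actD cox _ _ _)) _.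
    exact: (congr1 (act (v^-1)%g) (esym (mcoeffD v x y))).
  - rewrite [rw_map _]rw_map_rw muM lendME mu_eta mu_gelt /dl mcoeffU.
    have -> : ((w^-1 * v)%g == 1%g) = (w == v).
      apply/eqP/eqP => [e1|->]; last exact: mulVg.
      by rewrite -(mulVKg w v) e1 mulg1.
    case: eqP => _; first by rewrite mulr1 mulr1n.
    by rewrite mulr0 mulr0n (zmorph0 (act_zmod act _)) rmorph0.
move=> x y exy; apply/malgP => v.
have := mu_j x v; rewrite exy mu_j => /iota_inj exy'.
apply/eqP; rewrite -subr_eq0; apply/eqP/(actI (v^-1)%g).
by rewrite (act_zmod act) exy' subrr.
Qed.
End Embedding.

(** * The Hopf algebroid structure of a twisted group algebra *)

Local Opaque tw_mul.

Section TwistedHopf.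
Variables (k : comNzRingType) (R : comAlgType k) (W : groupType) (a : alg_action R W).
Local Notation A := (twisted a).
Local Notation eta := (@tw_eta k R W a).
Local Notation lp := (lpure eta eta).
Local Notation bp := (lpure (eta_c eta) eta).

Lemma tw_mulP r g r' h : tw a r g * tw a r' h = tw a (r * a g r') (g * h)%g.
Proof. exact: tw_mulE. Qed.

Lemma tw_eta_mul q r w : eta q * tw a r w = tw a (q * r) w.
Proof. by rewrite tw_mulP act1 mul1g. Qed.

Lemma tw_mul_eta r w q : tw a r w * eta q = eta (a w q) * tw a r w.
Proof. by rewrite tw_eta_mul tw_mulP mulg1 mulrC. Qed.

Lemma tw_etaz : zmod_morphism eta.
Proof. by apply: morphD_zmod => r r'; exact: twD. Qed.
Lemma tw_etaM : {morph eta : x y / x * y}.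
Proof. by move=> r q; rewrite tw_eta_mul. Qed.
Lemma tw_eta_subalgebra : is_subalgebra_map eta.
Proof.
split=> //; first exact: tw_etaz.
  by split=> //; exact: tw_etaM.
move=> r q /(congr1 (fun x : {malg R[W]} => x@_1%g)).
by rewrite !mcoeffUU.
Qed.

Lemma tw_Delta_cond w r : takeuchi_cond (lp (tw a r w) (tw a 1 w)).
Proof.
move=> q; rewrite !rmult_pure !mulr1 !tw_mul_eta; exact: lpureA.
Qed.
Definition tw_Delta : A -> takeuchi_lr eta :=
  tw_lift (fun w r => mk_takeuchi (@tw_Delta_cond w r)).

Let Delta_additive w :
  {morph (fun r => mk_takeuchi (@tw_Delta_cond w r) : takeuchi_lr eta) : r r' / r + r'}.
Proof.
move=> r r'; apply/val_inj; apply: etrans (takeuchi_valD _ _).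
by apply: etrans (congr1 (lp^~ _) (twD a r r' w)) _; exact: lpureDl.
Qed.

Lemma tw_Delta_zmod : zmod_morphism tw_Delta.
Proof. exact: (tw_lift_zmod Delta_additive). Qed.

Lemma tw_DeltaE r w : lrval (tw_Delta (tw a r w)) = lp (tw a r w) (tw a 1 w).
Proof. exact: (congr1 val (tw_lift_tw a Delta_additive r w)). Qed.
Local Notation D h := (takeuchi_val (tw_Delta h) : ltens eta eta).

Lemma tw_morphism_mul (B : pzRingType) (f : A -> B) : zmod_morphism f ->
  (forall r g r' h, f (tw a r g * tw a r' h) = f (tw a r g) * f (tw a r' h)) ->
  {morph f : x y / x * y}.
Proof.
move=> fz fU x y; elim/tw_ind: x => [|x x' ex ex'|r w].
- by rewrite mul0r (zmorph0 fz) mul0r.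
- by rewrite mulrDl !(zmorphD fz) mulrDl ex ex'.
elim/tw_ind: y => [|y y' ey ey'|r' w']; last exact: fU.
- by rewrite mulr0 (zmorph0 fz) mulr0.
- by rewrite mulrDr !(zmorphD fz) mulrDr ey ey'.
Qed.

Lemma tw_Delta_morphism : kalg_morphism tw_Delta.
Proof.
split; [exact: tw_Delta_zmod|split|].
- by apply/val_inj; exact: tw_DeltaE.
- apply: (tw_morphism_mul tw_Delta_zmod) => r g r' h; apply/val_inj.
  rewrite tw_mulP; apply: etrans (tw_DeltaE _ _) _; apply: esym.
  apply: etrans (takeuchi_valM _ _) _.
  apply: etrans (congr1 (tmul _) (tw_DeltaE r' h)) _.
  rewrite (tmul_pure _ _ (takeuchiP (tw_Delta (tw a r g)))).
  apply: etrans (congr1 (rmult _ _) (tw_DeltaE r g)) _.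
  rewrite rmult_pure !tw_mulP mul1r.
  by case: (act_monoid a g) => -> _.
- by move=> c; apply/val_inj; exact: tw_DeltaE.
Qed.
Let Dm := tw_Delta_morphism.

Lemma tw_Delta_eta r : lrval (tw_Delta (eta r)) = lp (eta r) 1.
Proof. exact: tw_DeltaE. Qed.

Definition tw_eps : A -> R := tw_lift (fun _ r => r).

Lemma tw_eps_zmod : zmod_morphism tw_eps.
Proof. by apply: tw_lift_zmod. Qed.
Lemma tw_epsE r w : tw_eps (tw a r w) = r.
Proof. by apply: (tw_lift_tw a (F := fun _ r => r)). Qed.
Lemma tw_eps_linear q x : tw_eps (eta q * x) = q * tw_eps x.
Proof.
elim/tw_ind: x => [|x y ex ey|r w].
- by rewrite mulr0 (zmorph0 tw_eps_zmod) mulr0.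
- by rewrite mulrDr !(zmorphD tw_eps_zmod) mulrDr ex ey.
- by rewrite tw_eta_mul !tw_epsE.
Qed.
Lemma tw_eps_act r w q : tw_eps (tw a r w * eta q) = r * a w q.
Proof. by rewrite tw_mulP tw_epsE. Qed.

Lemma tw_eps_rep : is_representation (fun x r => tw_eps (x * eta r)).
Proof.
have ez := zmorphD tw_eps_zmod; have eta1 : eta 1 = 1 by [].
have Dl x x' r : tw_eps ((x + x') * eta r) = tw_eps (x * eta r) + tw_eps (x' * eta r).
  exact: etrans (congr1 _ (mulrDl _ _ _)) (ez _ _).
have Dr x r r' : tw_eps (x * eta (r + r')) = tw_eps (x * eta r) + tw_eps (x * eta r').
  apply: etrans (congr1 (fun z => tw_eps (x * z)) (zmorphD tw_etaz r r')) _.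
  exact: etrans (congr1 _ (mulrDr _ _ _)) (ez _ _).
have e0 r : tw_eps (0 * eta r) = 0 by rewrite mul0r (zmorph0 tw_eps_zmod).
split=> [x c u v|x y r|r|x y r|c r].
- elim/tw_ind: x => [|x y ex ey|q w].
  + by rewrite !e0 scaler0 addr0.
  + rewrite (Dl x y (c *: u + v)) (Dl x y u) (Dl x y v) scalerDr addrACA.
    exact: congr2 ex ey.
  + by rewrite !tw_eps_act (act_linear a) mulrDr scalerAr.
- exact: Dl.
- by rewrite -eta1 tw_eps_act act1 mul1r.
- elim/tw_ind: x => [|x x' ex ex'|q w].
  + by rewrite mul0r !e0.
  + apply: etrans (congr1 (fun z => tw_eps (z * eta r)) (mulrDl x x' y)) _.
    apply: etrans (Dl _ _ _) (etrans (congr2 +%R ex ex') _); exact: esym (Dl _ _ _).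
  elim/tw_ind: y => [|y y' ey ey'|q' w'].
  + by rewrite mulr0 !e0 (zmorph0 tw_etaz) mulr0 (zmorph0 tw_eps_zmod).
  + apply: etrans (congr1 (fun z => tw_eps (z * eta r)) (mulrDr (tw a q w) y y')) _.
    apply: etrans (Dl _ _ _) (etrans (congr2 +%R ey ey') _).
    apply: etrans (esym (Dr _ _ _)) _.
    exact: (congr1 (fun z => tw_eps (tw a q w * eta z)) (esym (Dl _ _ _))).
  rewrite tw_mulP !tw_eps_act actM; case: (act_monoid a w) => _ ->.
  by rewrite mulrA.
- by rewrite tw_eps_act act1 mulr_algl.
Qed.

Lemma tw_bialgebroid : is_bialgebroid tw_Delta tw_eps.
Proof.
have De := tw_Delta_eta.
have Dz := Delta_zmod Dm.
split.
- exact: tw_eta_subalgebra.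
- by move=> r h; exact: (Delta_eta_mul tw_etaM Dm De).
- exact: tw_eps_zmod.
- exact: tw_eps_linear.
- have Lz := coassL_zmod tw_etaM Dm De; have Rz := coassR_zmod tw_etaM Dm De.
  have L0 := coassL_pure tw_etaM Dm De; have R0 := coassR_pure tw_etaM Dm De.
  suff co h : coassL (eta := eta) tw_Delta (D h) = coassR (eta := eta) tw_Delta (D h) by [].
  elim/tw_ind: h => [|x y ex ey|r w].
  + by rewrite (zmorph0 Dz) (zmorph0 Lz) (zmorph0 Rz).
  + by rewrite (zmorphD Dz) (zmorphD Lz) (zmorphD Rz) ex ey.
  rewrite [D (tw a r w)]tw_DeltaE L0 R0 [D (tw a r w)]tw_DeltaE [D (tw a 1 w)]tw_DeltaE.
  exact: (tens_assoc_pure3 tw_etaM).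
- have Lz := counitl_zmod tw_etaz tw_etaM tw_eps_zmod tw_eps_linear.
  have L0 := counitl_pure tw_etaz tw_etaM tw_eps_zmod tw_eps_linear.
  suff co h : counitl (eta := eta) tw_eps (D h) = h by [].
  elim/tw_ind: h => [|x y ex ey|r w].
  + by rewrite (zmorph0 Dz) (zmorph0 Lz).
  + by rewrite (zmorphD Dz) (zmorphD Lz) ex ey.
  by rewrite [D (tw a r w)]tw_DeltaE L0 tw_epsE tw_eta_mul mulr1.
- have Lz := counitr_zmod tw_etaz tw_etaM tw_eps_zmod tw_eps_linear.
  have L0 := counitr_pure tw_etaz tw_etaM tw_eps_zmod tw_eps_linear.
  suff co h : counitr (eta := eta) tw_eps (D h) = h by [].
  elim/tw_ind: h => [|x y ex ey|r w].
  + by rewrite (zmorph0 Dz) (zmorph0 Lz).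
  + by rewrite (zmorphD Dz) (zmorphD Lz) ex ey.
  by rewrite [D (tw a r w)]tw_DeltaE L0 tw_epsE tw_eta_mul mul1r.
- exact: Dm.
- exact: tw_eps_rep.
- by move=> r q; rewrite tw_eps_linear tw_epsE.
Qed.

Lemma tw_red_cond w r : takeuchi_cond (bp (tw a r w) (tw a 1 (w^-1)%g)).
Proof.
move=> q; rewrite !rmult_pure (mulr1 (tw a r w : A^c)) mulr1.
rewrite -[(tw a r w : A^c) * _]/(eta q * tw a r w) tw_mul_eta -bp_mulr tw_mul_eta.
by rewrite -actM mulgV act1.
Qed.
Definition tw_red : A -> takeuchi_op eta :=
  tw_lift (fun w r => mk_takeuchi (@tw_red_cond w r) : takeuchi_op eta).

Let red_additive w :
  {morph (fun r => mk_takeuchi (@tw_red_cond w r) : takeuchi_op eta) : r r' / r + r'}.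
Proof.
move=> r r'; apply/val_inj; apply: etrans (takeuchi_valD _ _).
apply: etrans (congr1 (bp^~ _) (twD a r r' w)) _.
exact: (@lpureDl _ _ A^c A (eta_c eta) eta).
Qed.

Lemma tw_red_zmod : zmod_morphism tw_red.
Proof. exact: (tw_lift_zmod red_additive). Qed.

Lemma tw_redE r w : opval (tw_red (tw a r w)) = bp (tw a r w) (tw a 1 (w^-1)%g).
Proof.
exact: (congr1 (fun x : takeuchi_op eta => takeuchi_val (x : takeuchi (eta_c eta) eta))
  (tw_lift_tw a red_additive r w)).
Qed.
Local Notation D' h := (takeuchi_val (tw_red h : takeuchi (eta_c eta) eta)).

Lemma tw_red_morphism : kalg_morphism tw_red.
Proof.
split; [exact: tw_red_zmod|split|].
- by apply/val_inj; rewrite [LHS]tw_redE invg1.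
- apply: (tw_morphism_mul tw_red_zmod) => r g r' h; apply/val_inj.
  rewrite tw_mulP; apply: etrans (tw_redE _ _) _; apply: esym.
  apply: etrans (takeuchi_valM (tw_red (tw a r' h) : takeuchi (eta_c eta) eta)
    (tw_red (tw a r g))) _.
  apply: etrans (congr1 (tmul _) (tw_redE r g)) _.
  rewrite (tmul_pure _ _ (takeuchiP (tw_red (tw a r' h) : takeuchi (eta_c eta) eta))).
  apply: etrans (congr1 (rmult _ _) (tw_redE r' h)) _.
  rewrite rmult_pure -[(tw a r' h : A^c) * _]/(tw a r g * tw a r' h) !tw_mulP mul1r invgM.
  by case: (act_monoid a (h^-1)%g) => -> _.
- by move=> c; apply/val_inj; rewrite [LHS]tw_redE invg1.
Qed.
Let rm := tw_red_morphism.

Lemma tw_red_eta r : opval (tw_red (eta r)) = bp (eta r) 1.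
Proof. by rewrite tw_redE invg1. Qed.

Lemma tw_inv w : tw a 1 w * tw a 1 (w^-1)%g = 1.
Proof. by rewrite tw_mulP mulgV mul1r; case: (act_monoid a w) => ->. Qed.

Lemma tw_is_red : is_red tw_Delta tw_red.
Proof.
have Gz := galois_zmod Dm tw_Delta_eta; have G0 := galois_pure Dm tw_Delta_eta.
move=> h; elim/tw_ind: h => [|x y ex ey|r w].
- by rewrite /opval (zmorph0 (red_zmod rm)) (zmorph0 Gz) /lrpure lpure0l.
- rewrite /opval (zmorphD (red_zmod rm)) [LHS](zmorphD Gz) /lrpure lpureDl.
  exact: congr2 ex ey.
rewrite tw_redE [LHS]G0 [D (tw a r w)]tw_DeltaE rmult_pure mulr1.
by rewrite tw_inv.
Qed.

Lemma tw_ungalois h : ungalois tw_red (D h) = bp h 1.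
Proof.
have Uz := ungalois_zmod rm tw_red_eta; have U0 := ungalois_pure rm tw_red_eta.
have Dz := Delta_zmod Dm.
elim/tw_ind: h => [|x y ex ey|r w].
- by rewrite (zmorph0 Dz) (zmorph0 Uz) (lpure0l (A := A^c)).
- rewrite (zmorphD Dz) (zmorphD Uz) ex ey.
  exact: esym (@lpureDl _ _ A^c A (eta_c eta) eta x y 1).
rewrite [D (tw a r w)]tw_DeltaE U0 [D' (tw a r w)]tw_redE rmult_pure mulr1.
by have := tw_inv (w^-1)%g; rewrite invgK => ->.
Qed.

Lemma tw_hopf : is_hopf_algebroid tw_Delta tw_eps.
Proof.
split; first exact: tw_bialgebroid.
exact: (galois_bijective Dm tw_Delta_eta rm tw_red_eta tw_is_red tw_ungalois).
Qed.
End TwistedHopf.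

(** * The twisted group algebra as a Hopf subalgebroid of nH *)

Section Subalgebroid.
Variables (K : realType) (S : choiceType) (W : groupType) (sg : S -> W).
Variables (m : S -> S -> nat) (cox : coxeter_system sg m).
Local Notation R := (Sym K S).
Local Notation H := (nilHecke K m).
Local Notation eta := (@nh_eta K S m).
Local Notation act := (geometric_action K cox).
Local Notation A := (RW K cox).
Local Notation etaW := (rw_eta cox).
Local Notation j := (@rw_map K S W sg m cox).
Local Notation Delta := (@nh_Delta K S m : H -> takeuchi_lr eta).

Definition rw_Delta : A -> takeuchi_lr etaW := @tw_Delta K R W act.
Definition rw_red : A -> takeuchi_op etaW := @tw_red K R W act.

Lemma rw_DeltaE r w :
  lrval (rw_Delta (rw cox r w)) = lpure etaW etaW (rw cox r w) (rw cox 1 w).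
Proof. exact: tw_DeltaE. Qed.
Lemma rw_redE r w :
  opval (rw_red (rw cox r w)) = lpure (eta_c etaW) etaW (rw cox r w) (rw cox 1 (w^-1)%g).
Proof. exact: tw_redE. Qed.

(** All maps are additive, so the compatibilities are checked on elements r w. There they come down
    to the values of Delta and red at the image of w ([D_gelt], [red_gelt]) and to w fixing 1
    ([rho_gelt]). *)
Lemma rw_hopf_subalgebroid :
  is_hopf_subalgebroid j rw_Delta (@rw_eps K S W sg m cox) rw_red
    Delta (nh_eps cox) (nh_red cox).
Proof.
have jm := rw_map_morphism K cox; have je := @rw_map_eta K S W sg m cox.
have jz := @rw_map_zmod K S W sg m cox.
have jmc := kalg_morphism_converse jm.
have jec r : (j : A^c -> H^c) (eta_c etaW r) = eta_c eta r by exact: je.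
have Dm := nh_Delta_morphism K cox; have De := @nh_Delta_eta K S W sg m cox.
have rm := nh_red_morphism K cox; have re := @nh_red_eta K S W sg m cox.
split.
- exact: jm.
- exact: rw_map_inj.
- exact: je.
- exact: tw_hopf.
- exact: tw_is_red.
- have jjP := ltens_map_pure jm jm je je; have jjz := ltens_map_zmod jm jm je je.
  move=> x; elim/rw_ind: x => [|x y ex ey|r w].
  + apply: etrans (congr1 _ (zmorph0 (Delta_zmod (@tw_Delta_morphism K R W act)))) _.
    apply: etrans (zmorph0 jjz) _; rewrite (zmorph0 jz).
    exact: esym (zmorph0 (Delta_zmod Dm)).
  + apply: etrans (congr1 _ (zmorphD (Delta_zmod (@tw_Delta_morphism K R W act)) x y)) _.
    apply: etrans (zmorphD jjz _ _) _; rewrite (zmorphD jz x y).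
    apply: etrans (congr2 +%R ex ey) _.
    exact: esym (zmorphD (Delta_zmod Dm) _ _).
  apply: etrans (congr1 _ (rw_DeltaE r w)) _.
  apply: etrans (jjP _ _) _.
  apply: etrans (congr2 (lpure eta eta) (rw_map_rw cox r w) (rw_map_rw cox 1 w)) _.
  rewrite (rw_map_rw cox r w) nh_eta1 mul1r /lrval.
  rewrite (Delta_eta_mul (@nh_etaM K S m) Dm De) (D_gelt K cox).
  exact: esym (lr_act_pure (@nh_etaM K S m) _ _ _).
- have ez := @nh_eps_zmod K S W sg m cox; have epsz := @tw_eps_zmod K R W act.
  move=> x; elim/rw_ind: x => [|x y ex ey|r w].
  + by rewrite (zmorph0 jz) (zmorph0 ez); exact: (zmorph0 epsz).
  + rewrite (zmorphD jz x y) (zmorphD ez).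
    by apply: etrans (zmorphD epsz x y) _; exact: congr2 ex ey.
  rewrite (rw_map_rw cox r w) (nh_eps_eta cox).
  apply: etrans (@tw_epsE K R W act r w) _.
  apply: etrans (esym (mulr1 r)) _; apply: (congr1 ( *%R r)).
  apply: esym; apply: etrans (rho_gelt cox w 1) _.
  by case: (act_monoid act w).
have jjP := ltens_map_pure jmc jm jec je; have jjz := ltens_map_zmod jmc jm jec je.
move=> x; elim/rw_ind: x => [|x y ex ey|r w].
- apply: etrans (congr1 _ (zmorph0 (red_zmod (@tw_red_morphism K R W act)))) _.
  apply: etrans (zmorph0 jjz) _; rewrite (zmorph0 jz).
  exact: esym (zmorph0 (red_zmod rm)).
- apply: etrans (congr1 _ (zmorphD (red_zmod (@tw_red_morphism K R W act)) x y)) _.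
  apply: etrans (zmorphD jjz _ _) _; rewrite (zmorphD jz x y).
  apply: etrans (congr2 +%R ex ey) _.
  exact: esym (zmorphD (red_zmod rm) _ _).
apply: etrans (congr1 _ (rw_redE r w)) _.
apply: etrans (jjP _ _) _.
apply: etrans (congr2 (lpure (eta_c eta) eta) (rw_map_rw cox r w)
  (rw_map_rw cox 1 (w^-1)%g)) _.
rewrite (rw_map_rw cox r w) nh_eta1 mul1r /opval.
rewrite (red_eta_mul rm re) (red_gelt K cox) rmult_pure.
by rewrite mulr1.
Qed.
End Subalgebroid.

Theorem theorem4p11 (K : realType) (S : choiceType) (W : groupType)
    (sg : S -> W) (m : S -> S -> nat) (cox : coxeter_system sg m) :
  let H := nilHecke K m in
  let eta : Sym K S -> H := nh_eta m in
  let vec : hstar K S -> H := nh_vec m in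
  let del : S -> H := nh_del K m in
  let rfl : S -> H := nh_refl K m in
  (forall s,
    lrpure eta (del s) (rfl s) + lrpure eta 1 (del s) =
    lrpure eta (del s) 1 + lrpure eta (rfl s) (del s)) /\
  exists rho : H -> Sym K S -> Sym K S,
  is_nh_representation cox rho /\
  exists Delta : H -> takeuchi_lr eta,
  [/\ kalg_morphism Delta,
      forall l, lrval (Delta (vec l)) = lrpure eta (vec l) 1 &
      forall s, lrval (Delta (del s)) =
        lrpure eta (del s) (rfl s) + lrpure eta 1 (del s)] /\
  let eps : H -> Sym K S := fun h => rho h 1 in
  is_hopf_algebroid Delta eps /\ is_cocommutative Delta /\
  exists red : H -> takeuchi_op eta,
  [/\ kalg_morphism red,
      is_red Delta red,
      forall l, opval (red (vec l)) = bpure eta (vec l) 1,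
      forall s, opval (red (del s)) =
        bpure eta (del s) (rfl s) + bpure eta 1 (del s) &
      forall s, opval (red (del s)) =
        bpure eta (del s) 1 - bpure eta (rfl s) (del s)] /\
  exists (j : RW K cox -> H)
         (DeltaW : RW K cox -> takeuchi_lr (@rw_eta K S W sg m cox))
         (redW : RW K cox -> takeuchi_op (@rw_eta K S W sg m cox)),
  [/\ forall s, j (rw cox 1 (sg s)) = rfl s,
      forall r w, lrval (DeltaW (rw cox r w)) =
        lrpure _ (rw cox r w) (rw cox 1 w),
      forall r w, opval (redW (rw cox r w)) =
        bpure _ (rw cox r w) (rw cox 1 (w^-1)%g) &
      is_hopf_subalgebroid j DeltaW (@rw_eps K S W sg m cox) redW Delta eps red].
Proof.
move=> H eta vec del rfl; split; first exact: (delta_del_flip K m).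
exists (nh_rho cox); split; first exact: nh_rho_is_rep.
exists (@nh_Delta K S m); split.
  split; first exact: (nh_Delta_morphism K cox).
  - by move=> l; rewrite /lrval (nh_Delta_vec cox) delta_vecE.
  - by move=> s; rewrite /lrval (nh_Delta_del K cox) delta_genE.
split; first exact: nh_hopf.
split; first exact: (nh_cocommutative cox).
exists (nh_red cox); split.
  split; [exact: nh_red_morphism|exact: nh_is_red| |exact: nh_red_del|exact: nh_red_del_flip].
  by move=> l; rewrite /vec -nh_eta_hincl; exact: nh_red_eta.
exists (@rw_map K S W sg m cox), (@rw_Delta K S W sg m cox), (@rw_red K S W sg m cox).
split; [|exact: rw_DeltaE|exact: rw_redE|exact: rw_hopf_subalgebroid].
by move=> s; rewrite rw_map_rw nh_eta1 mul1r gelt_sg.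
Qed.
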